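(* Let $A,B,b,(u_n),(\gamma_n),(x_n)$, the mean operators $\mathcal A,\mathcal B$ and the set $\mathcal Z=Z(\mathcal A+\mathcal B)$ be as introduced in the context. Assume the following. 1. The monotone operator $\mathcal A$ is maximal. 2. There exist an integer $p\ge 1$ and a point $x_\star\in\mathcal Z$ such that $\mathcal R_{2p}(x_\star)\neq\emptyset$. 3. For any compact set $K\subset\mathbb R^N$, there exists $\varepsilon\in\,]0,1]$ such that $$\sup_{x\in K\cap\mathcal D}\int\|A_0(\xi,x)\|^{1+\varepsilon}\,\mu(d\xi)<\infty ,$$ and moreover there exists $y_0\in\mathcal D$ such that $\int\|A_0(\xi,y_0)\|^{1+1/\varepsilon}\,\mu(d\xi)<\infty$. 4. There exists $C>0$ such that for all $x\in\mathbb R^N$, $\int d(\xi,x)^2\,\mu(d\xi)\ge C\,\boldsymbol d(x)^2$; furthermore $\gamma_{n+1}/\gamma_n\to 1$. 5. There exists $C>0$ such that for any $x\in\mathbb R^N$ and any $\gamma>0$, $$\frac1{\gamma^4}\int\|J_\gamma(\xi,x)-\Pi(\xi,x)\|^4\,\mu(d\xi)\le C(1+\|x\|^{2p}),$$ where $p$ is the integer of item 2. 6. There exists $M:\Xi\to\mathbb R_+$ such that $M^{2p}$ is $\mu$-integrable and $\|b(\xi,x)\|\le M(\xi)(1+\|x\|)$ for all $x\in\mathbb R^N$. Moreover, there exists $C>0$ such that $\int\|b(\xi,x)\|^4\,\mu(d\xi)\le C(1+\|x\|^{2p})$ for all $x\in\mathbb R^N$. 7. For any $x_\star\in\mathcal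 Z$, the set $\mathcal R_2(x_\star)$ is not empty. Then, for any initial value $x_0$, the sequence of empirical means $$\bar x_n=\frac{\sum_{k=1}^n\gamma_kx_k}{\sum_{k=1}^n\gamma_k}$$ converges almost surely as $n\to\infty$ to a random variable $U$ whose support lies in $\mathcal Z$.
   Context: Operators. A set-valued operator $\mathsf A:\mathbb R^N\rightrightarrows\mathbb R^N$ is monotone if $\langle y-y',x-x'\rangle\ge0$ for all $(x,y),(x',y')$ in its graph $\mathrm{gr}(\mathsf A)$; a non-empty monotone operator is maximal if its graph is maximal for inclusion among graphs of monotone operators. $\mathcal M$ is the set of maximal monotone operators on $\mathbb R^N$; $\mathrm{dom}(\mathsf A)=\{x:\mathsf A(x)\ne\emptyset\}$; $Z(\mathsf A)=\{x:0\in\mathsf A(x)\}$; $\mathrm{cl}$ is closure. Set-valued integrals. $(\Xi,\mathcal T,\mu)$ is a probability space with $\mathcal T$ $\mu$-complete. A closed-set-valued function $F$ on $\Xi$ is measurable if $\{\xi:F(\xi)\cap H\ne\emptyset\}\in\mathcal T$ for every Borel set $H$. For $1\le q<\infty$, $\mathcal S^q_F$ is the set of $\varphi\in\mathcal L^q(\Xi,\mathcal T,\mu;\mathbb R^N)$ with $\varphi(\xi)\in F(\xi)$ $\mu$-a.e.; $F$ is integrable if $\mathcal S^1_F\ne\emptyset$; its Aumann integral is $\int F\,d\mu=\{\int\varphi\,d\mu:\varphi\in\mathcal S^1_F\}$. Random operator $A$. $A:\Xi\to\mathcal M$ is such that $\xi\mapsto\mathrm{gr}(A(\xi,\cdot))$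 is measurable; $A(\xi,x)$ is the image of $x$ under $A(\xi,\cdot)$. $D(\xi)=\mathrm{dom}(A(\xi,\cdot))$; for $x\in D(\xi)$, $A_0(\xi,x)$ is the element of least norm of $A(\xi,x)$; $J_\gamma(\xi,x)=(I+\gamma A(\xi,\cdot))^{-1}(x)$ for $\gamma>0$. $\Pi(\xi,\cdot)$ is the projection onto $\mathrm{cl}(D(\xi))$, and $d(\xi,\cdot)$ the distance function to $D(\xi)$. $\mathcal D=\{x\in\mathbb R^N:\mu(\{\xi:x\in D(\xi)\})=1\}$ is assumed non-empty, $\boldsymbol d(\cdot)$ is the distance function to $\mathcal D$, and $A(\cdot,x)$ is assumed integrable for each $x\in\mathcal D$. The monotone operator $\mathcal A$ has domain $\mathcal D$ and $\mathcal A(x)=\int A(\xi,x)\,\mu(d\xi)$ (Aumann integral) for $x\in\mathcal D$. Random operator $B$. $B:\Xi\to\mathcal M$ is such that $\xi\mapsto\mathrm{gr}(B(\xi,\cdot))$ is measurable, $\mathrm{dom}(B(\xi,\cdot))=\mathbb R^N$ for almost every $\xi$, and $B(\cdot,x)$ is integrable for every $x\in\mathbb R^N$; $\mathcal B(x)=\int B(\xi,x)\,\mu(d\xi)$ (Aumann integral). The map $b:\Xi\times\mathbb R^N\to\mathbb R^N$ is $\mathcal T\otimes\mathcal B(\mathbb R^N)$-measurable (product of $\mathcal T$ with the Borel field) with $b(\cdot,x)\in\mathcal S^1_{B(\cdot,x)}$ for every $x$. $\mathcal Z=Z(\mathcal A+\mathcal B)$, and for $x_\star\in\mathcal Z$ and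 $q\geq 1$, $$\mathcal R_{q}(x_\star)=\Big\{(\varphi,\psi)\in\mathcal S^{q}_{A(\cdot,x_\star)}\times\mathcal S^{q}_{B(\cdot,x_\star)}:\int\varphi\,d\mu+\int\psi\,d\mu=0\Big\}.$$ Algorithm. $(u_n)_{n\ge1}$ is an iid sequence of random variables on a probability space $(\Omega,\mathcal F,\mathbb P)$ with values in $(\Xi,\mathcal T)$ and distribution $\mu$. $(\gamma_n)_{n\ge1}$ is a positive sequence in $\ell^2\setminus\ell^1$. Given an arbitrary $x_0\in\mathbb R^N$, $$x_{n+1}=J_{\gamma_{n+1}}\big(u_{n+1},\,x_n-\gamma_{n+1}b(u_{n+1},x_n)\big),\qquad n\ge0.$$ *)

(* Defs.v *)
From HB Require Import structures.
From mathcomp Require Import all_boot all_order all_algebra.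
From mathcomp Require Import all_classical all_reals all_analysis.

Set Implicit Arguments.
Unset Strict Implicit.
Unset Printing Implicit Defensive.

Import Order.TTheory GRing.Theory Num.Theory.
Import numFieldNormedType.Exports.

Local Open Scope classical_set_scope.
Local Open Scope ring_scope.

Section Euclidean.
Context {R : realType} {N : nat}.
Implicit Types (x y : 'rV[R]_N) (S : set 'rV[R]_N).

Definition dotp x y : R := \sum_(i < N) x 0 i * y 0 i.

(* [`|x|] on ['rV_N] is the sup norm: it induces the same topology, but least
   norm elements, projections and distances require the Euclidean norm. *)
Definition enorm x : R := Num.sqrt (dotp x x).

Definition eucl_dist S x : R := inf [set enorm (x - y) | y in S].

Definition is_eproj S x y :=
  S y /\ forall z, S z -> enorm (x - y) <= enorm (x - z).

(* [get] yields an arbitrary value when no point satisfies the predicate; a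
   nonempty closed convex set has exactly one projection of any point. *)
Definition eproj S x : 'rV[R]_N := get (is_eproj S x).

End Euclidean.

Notation borelRV R N := (g_sigma_algebraType (@open 'rV[R]_N)).

Section Operators.
Context {R : realType} {N : nat}.
Local Notation E := ('rV[R]_N).

Definition operator := E -> set E.
Implicit Types A B : operator.

Definition graph_of A : set (E * E) := [set xy | A xy.1 xy.2].

Definition opdom A : set E := [set x | A x !=set0].

Definition zeros A : set E := [set x | A x 0].

Definition op_id : operator := fun x => [set x].

Definition op_add A B : operator :=
  fun x => [set y + z | y in A x & z in B x].

Definition op_scale (c : R) A : operator := fun x => [set c *: y | y in A x].

Definition op_inv A : operator := fun y => [set x | A x y].

Definition monotone_op A := forall x y x' y',
  graph_of A (x, y) -> graph_of A (x', y') -> 0 <= dotp (y - y') (x - x').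

Definition maximal_monotone A :=
  [/\ graph_of A !=set0, monotone_op A &
      forall A', monotone_op A' -> graph_of A `<=` graph_of A' ->
        graph_of A' = graph_of A].

(* The resolvent [(I + gamma A)^-1], which is single-valued with full domain
   when [A] is maximal monotone and [gamma > 0]; [get] selects the value. *)
Definition resolvent (gamma : R) A (x : E) : E :=
  get (op_inv (op_add op_id (op_scale gamma A)) x).

(* Meaningful for [x] in [opdom A]. *)
Definition least_norm A (x : E) : E :=
  get [set y | A x y /\ forall z, A x z -> enorm y <= enorm z].

End Operators.
Arguments operator : clear implicits.

Section SetValued.
Context {R : realType} {N : nat} {d : measure_display} {Xi : measurableType d}.
Variable mu : {measure set Xi -> \bar R}.

Definition measurable_setfun (T : topologicalType) (F : Xi -> set T) :=
  forall H : set T, <<s @open T >> H -> measurable [set xi | F xi `&` H !=set0].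

Definition vintegral (phi : Xi -> 'rV[R]_N) : 'rV[R]_N :=
  \row_i \int[mu]_xi phi xi 0 i.

Definition vLq (q : R) : set (Xi -> 'rV[R]_N) :=
  [set phi | measurable_fun setT (phi : Xi -> borelRV R N) /\
     (\int[mu]_xi (enorm (phi xi) `^ q)%:E < +oo)%E].

Definition selections (q : R) (F : Xi -> set 'rV[R]_N)
    : set (Xi -> 'rV[R]_N) :=
  [set phi | vLq q phi /\ {ae mu, forall xi, F xi (phi xi)}].

Definition setfun_integrable (F : Xi -> set 'rV[R]_N) := selections 1 F !=set0.

Definition aumann (F : Xi -> set 'rV[R]_N) : set 'rV[R]_N :=
  [set vintegral phi | phi in selections 1 F].

End SetValued.

Section RandomOperators.
Context {R : realType} {N : nat} {d : measure_display} {Xi : measurableType d}.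
Variable mu : probability Xi R.
Implicit Types A B : Xi -> operator R N.

Definition random_maximal_monotone A :=
  (forall xi, maximal_monotone (A xi)) /\
  measurable_setfun (fun xi => graph_of (A xi)).

Definition essdom A : set 'rV[R]_N :=
  [set x | mu [set xi | opdom (A xi) x] = 1%E].

Definition mean_op A : operator R N :=
  fun x => aumann mu (fun xi => A xi x).

Definition mean_op_essdom A : operator R N :=
  fun x => [set y | essdom A x /\ mean_op A x y].

Definition representations (q : R) A B (x : 'rV[R]_N)
    : set ((Xi -> 'rV[R]_N) * (Xi -> 'rV[R]_N)) :=
  [set pp | [/\ selections mu q (fun xi => A xi x) pp.1,
                selections mu q (fun xi => B xi x) pp.2 &
                vintegral mu pp.1 + vintegral mu pp.2 = 0]].

End RandomOperators.

Section Algorithm.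
Context {R : realType} {N : nat}.
Context {d : measure_display} {Xi : measurableType d}.
Context {d' : measure_display} {Omega : measurableType d'}.
Variable P : probability Omega R.

(* The sequences [u] and [gamma] are indexed from 1; their value at 0 is
   unconstrained and unused. *)

Definition mutually_independent (u : nat -> Omega -> Xi) :=
  forall (s : seq nat) (H : nat -> set Xi),
    uniq s -> all (fun n => 0 < n)%N s -> (forall n, measurable (H n)) ->
    P (\bigcap_(n in [set` s]) (u n @^-1` H n)) =
    (\prod_(n <- s) P (u n @^-1` H n))%E.

Definition iid_with_law (mu : probability Xi R) (u : nat -> Omega -> Xi) :=
  [/\ forall n, (0 < n)%N -> measurable_fun setT (u n),
      forall n, (0 < n)%N -> forall H, measurable H -> P (u n @^-1` H) = mu H &
      mutually_independent u].

Definition law_support (U : Omega -> 'rV[R]_N) : set 'rV[R]_N :=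
  [set x | forall V, open V -> V x -> (0 < P (U @^-1` V))%E].

Fixpoint fb_iter (A : Xi -> operator R N) (b : Xi -> 'rV[R]_N -> 'rV[R]_N)
    (u : nat -> Omega -> Xi) (gamma : nat -> R) (x0 : 'rV[R]_N)
    (n : nat) (w : Omega) : 'rV[R]_N :=
  if n is m.+1 then
    let x := fb_iter A b u gamma x0 m w in
    resolvent (gamma m.+1) (A (u m.+1 w)) (x - gamma m.+1 *: b (u m.+1 w) x)
  else x0.

Definition weighted_mean (gamma : nat -> R) (x : nat -> Omega -> 'rV[R]_N)
    (n : nat) (w : Omega) : 'rV[R]_N :=
  (\sum_(1 <= k < n.+1) gamma k)^-1 *: \sum_(1 <= k < n.+1) gamma k *: x k w.

End Algorithm.

(* Main.v *)
(* Let [phi], [psi] be square-integrable selections of [A(., z)], [B(., z)] and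
   [y] the sum of their integrals. Monotonicity at the point [z] gives almost
   surely, with [c] convergent (martingale and square-summability terms),
     |x_{n+1} - z|^2 + 2 g_n <y, x_n - z> + |x_{n+1} - x_n|^2 / 2
       <= |x_n - z|^2 + c_{n+1} - c_n,   g_n = gamma_{n+1}.
   If [y = 0] then [|x_n - z|] converges. In general, summing shows that every
   cluster point [U] of the weighted means satisfies [<y, z - U> >= 0], first for
   countably many and, by density, for all [(z, y)] in the graph of the sum of
   the mean operators. As the mean of [A] is maximal and the mean of [B] has full
   domain and linear growth, [U] is a zero of the sum; Passty's argument (the
   differences [|x_n - z|^2 - |x_n - z'|^2] converge for zeros [z], [z']) leaves
   a single cluster point. The fourth-moment bound on the resolvents enters only
   through the existence of square-integrable selections of [A(., z)]. *)
Require Import Defs.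
From HB Require Import structures.
From mathcomp Require Import all_boot all_order all_algebra.
From mathcomp Require Import finmap ring lra.
From mathcomp Require Import all_classical all_reals all_analysis.
From mathcomp Require Import measurable_realfun.

Set Implicit Arguments.
Unset Strict Implicit.
Unset Printing Implicit Defensive.

Import Order.TTheory GRing.Theory Num.Theory.
Import numFieldNormedType.Exports.

Local Open Scope classical_set_scope.
Local Open Scope ring_scope.

(** * Euclidean structure of row vectors *)

(** Three obstacles shape the argument. Every exceptional null set depends on the pair [(z, y)] and
    on the chosen selections, whence countable dense families. Finite variance of the martingale
    terms calls for square-integrable selections, so only part of the graph of the sum of the means
    can be tested directly; truncation recovers the rest. Second moments of the iterates are bounded
    once, at a zero, where the drift has mean zero, and every other pair borrows that bound.

    In the step inequality the drift is taken at [x_n], of which the new sample is independent; the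
    price for not taking it at [x_{n+1}] is absorbed by half of [|x_{n+1} - x_n|^2] and a term of
    order [g_n^2].

    Maximality of the sum of the means is not established. The limit [U] is shown to be a zero by
    comparing the least-norm element of the sum at [U] with the limit of [(U - J_{tA}(U - t w)) / t]
    as [t] tends to 0. Limits of selections bounded in [L^2] are strong limits of nearly minimal
    elements of nested convex sets, since all conditions to be preserved are convex inequalities. *)

Section DotProduct.
Context {R : realType} {N : nat}.
Implicit Types (x y z : 'rV[R]_N) (c : R).

Lemma dotpC x y : dotp x y = dotp y x.
Proof. by apply: eq_bigr => i _; rewrite mulrC. Qed.

Lemma dotpDl x y z : dotp (x + y) z = dotp x z + dotp y z.
Proof. by rewrite -big_split; apply: eq_bigr => i _; rewrite mxE mulrDl. Qed.

Lemma dotpZl c x z : dotp (c *: x) z = c * dotp x z.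
Proof. by rewrite mulr_sumr; apply: eq_bigr => i _; rewrite mxE mulrA. Qed.

Lemma dotpNl x z : dotp (- x) z = - dotp x z.
Proof. by rewrite -scaleN1r dotpZl mulN1r. Qed.

Lemma dotpBl x y z : dotp (x - y) z = dotp x z - dotp y z.
Proof. by rewrite dotpDl dotpNl. Qed.

Lemma dotp0l z : dotp 0 z = 0.
Proof. by rewrite -(scale0r 0) dotpZl mul0r. Qed.

Lemma dotpDr x y z : dotp z (x + y) = dotp z x + dotp z y.
Proof. by rewrite dotpC dotpDl !(dotpC _ z). Qed.

Lemma dotpZr c x z : dotp z (c *: x) = c * dotp z x.
Proof. by rewrite dotpC dotpZl dotpC. Qed.

Lemma dotpNr x z : dotp z (- x) = - dotp z x.
Proof. by rewrite dotpC dotpNl dotpC. Qed.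

Lemma dotpBr x y z : dotp z (x - y) = dotp z x - dotp z y.
Proof. by rewrite dotpDr dotpNr. Qed.

Lemma dotp0r z : dotp z 0 = 0.
Proof. by rewrite dotpC dotp0l. Qed.

Definition dotpE := (dotpDl, dotpDr, dotpNl, dotpNr, dotpZl, dotpZr).

Lemma dotp_suml (I : Type) (r : seq I) (P : pred I) (F : I -> 'rV[R]_N) z :
  dotp (\sum_(i <- r | P i) F i) z = \sum_(i <- r | P i) dotp (F i) z.
Proof.
by apply: (big_morph (dotp^~ z)) => [x y|]; rewrite ?dotpDl// dotp0l.
Qed.

Lemma dotp_sumr (I : Type) (r : seq I) (P : pred I) (F : I -> 'rV[R]_N) z :
  dotp z (\sum_(i <- r | P i) F i) = \sum_(i <- r | P i) dotp z (F i).
Proof. by rewrite dotpC dotp_suml; under eq_bigr do rewrite dotpC. Qed.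

Lemma dotp_ge0 x : 0 <= dotp x x.
Proof. by apply: sumr_ge0 => i _; rewrite -expr2 sqr_ge0. Qed.

Lemma sqr_coord_le x i : x 0 i ^+ 2 <= dotp x x.
Proof.
rewrite /dotp (bigD1 i)//= -expr2 lerDl; apply: sumr_ge0 => j _.
by rewrite -expr2 sqr_ge0.
Qed.

Lemma dotp_eq0 x : dotp x x <= 0 -> x = 0.
Proof.
move=> x0; apply/rowP => i; rewrite mxE; apply/eqP; rewrite -sqrf_eq0 eq_le.
by rewrite sqr_ge0 andbT (le_trans (sqr_coord_le x i)).
Qed.

Lemma dotp_young x y : 2 * dotp x y <= dotp x x + dotp y y.
Proof. by have := dotp_ge0 (x - y); rewrite !dotpE (dotpC y x); lra. Qed.

Lemma dotp_youngN x y : - (2 * dotp x y) <= dotp x x + dotp y y.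
Proof. by have := dotp_young (- x) y; rewrite !dotpE; lra. Qed.

Lemma dotp_sqrD x y : dotp (x + y) (x + y) <= 2 * (dotp x x + dotp y y).
Proof. by have := dotp_young x y; rewrite !dotpE (dotpC y x); lra. Qed.

Lemma dotp_sqrB x y : dotp (x - y) (x - y) <= 2 * (dotp x x + dotp y y).
Proof. by have := dotp_sqrD x (- y); rewrite !dotpNl !dotpNr opprK. Qed.

Lemma dotp_CS x y : dotp x y ^+ 2 <= dotp x x * dotp y y.
Proof.
have [y0|y0] := eqVneq (dotp y y) 0.
  by rewrite (@dotp_eq0 y) ?y0// !dotp0r mulr0 expr2 mulr0.
have yp : 0 < dotp y y by rewrite lt_def y0 dotp_ge0.
have := dotp_ge0 (dotp y y *: x - dotp x y *: y).
rewrite !dotpE (dotpC y x) -(pmulr_rge0 _ yp) => H.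
suff : 0 <= dotp y y * (dotp x x * dotp y y - dotp x y ^+ 2).
  by rewrite (pmulr_rge0 _ yp) subr_ge0.
by move: H; rewrite (pmulr_rge0 _ yp); congr (_ <= _); ring.
Qed.

Lemma enorm_ge0 x : 0 <= enorm x.
Proof. exact: sqrtr_ge0. Qed.

Lemma sqr_enorm x : enorm x ^+ 2 = dotp x x.
Proof. by rewrite sqr_sqrtr// dotp_ge0. Qed.

Lemma le_enorm x y : (enorm x <= enorm y) = (dotp x x <= dotp y y).
Proof. by rewrite ler_sqrt// dotp_ge0. Qed.

Lemma dotp_le_enorm x y : dotp x y <= enorm x * enorm y.
Proof.
rewrite -sqrtrM ?dotp_ge0//; apply: le_trans (ler_norm _) _.
by rewrite -sqrtr_sqr ler_sqrt ?dotp_CS// mulr_ge0 ?dotp_ge0.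
Qed.

Lemma enormN x : enorm (- x) = enorm x.
Proof. by rewrite /enorm dotpNl dotpNr opprK. Qed.

Lemma normr_dotp_le x y : `|dotp x y| <= enorm x * enorm y.
Proof.
rewrite ler_norml dotp_le_enorm andbT lerNl -dotpNl.
by rewrite (le_trans (dotp_le_enorm _ _))// enormN.
Qed.

Lemma enormD x y : enorm (x + y) <= enorm x + enorm y.
Proof.
rewrite -(@ler_pXn2r _ 2)// ?nnegrE ?addr_ge0 ?enorm_ge0//.
rewrite sqrrD !sqr_enorm !dotpE (dotpC y x).
by have := dotp_le_enorm x y; lra.
Qed.

Lemma enormZ c x : enorm (c *: x) = `|c| * enorm x.
Proof. by rewrite /enorm !dotpE mulrA -expr2 sqrtrM ?sqr_ge0// sqrtr_sqr. Qed.

Lemma normr_coord_le x i : `|x 0 i| <= enorm x.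
Proof. by rewrite -sqrtr_sqr ler_sqrt ?sqr_coord_le// dotp_ge0. Qed.

Lemma enorm_le_sum x : enorm x <= \sum_i `|x 0 i|.
Proof.
rewrite -(@ler_pXn2r _ 2)// ?nnegrE ?enorm_ge0 ?sumr_ge0// sqr_enorm expr2.
rewrite mulr_suml /dotp; apply: ler_sum => i _.
rewrite (le_trans (ler_norm _))// normrM ler_wpM2l//.
by rewrite (bigD1 i)//= lerDl sumr_ge0.
Qed.

Lemma mx_norm_le_enorm x : `|x| <= enorm x.
Proof.
rewrite {1}/Num.norm /= mx_normrE; apply/bigmax_leP; split=> [|[i j] _ /=].
  exact: enorm_ge0.
by rewrite (ord1 i) normr_coord_le.
Qed.

End DotProduct.

(** * Convergence and compactness of row vectors *)

Section RowConvergence.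
Context {R : realType} {N : nat}.
Implicit Types (x y z : 'rV[R]_N).

Lemma cvg_rowP (T : Type) (F : set_system T) {FF : Filter F}
    (f : T -> 'rV[R]_N) (l : 'rV[R]_N) :
  (f @ F --> l) <-> (forall i, f t 0 i @[t --> F] --> l 0 i).
Proof.
split=> [fl i|fl].
  by apply: (cvg_comp f (fun M : 'rV[R]_N => M 0 i) fl); exact: coord_continuous.
apply/cvg_ballP => e e0.
have : \forall t \near F, forall i, ball (l 0 i) e (f t 0 i).
  by apply: filter_forall => i; exact: (cvg_ballP _ _).1 (fl i) _ e0.
by apply: filterS => t H; split=> // i j; rewrite (ord1 i); exact: H.
Qed.

Lemma cvg_dotp (T : Type) (F : set_system T) {FF : Filter F}
    (f g : T -> 'rV[R]_N) (k l : 'rV[R]_N) :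
  f @ F --> k -> g @ F --> l -> dotp (f t) (g t) @[t --> F] --> dotp k l.
Proof.
move=> /cvg_rowP fk /cvg_rowP gl; apply: cvg_big => [|i _]; first exact: add_continuous.
exact: cvgM (fk i) (gl i).
Qed.

Lemma cvg_row_enorm (f : nat -> 'rV[R]_N) (l : 'rV[R]_N) (e : nat -> R) :
  (forall n, enorm (f n - l) <= e n) -> e @ \oo --> 0 -> f @ \oo --> l.
Proof.
move=> fe e0; apply/cvgrPdist_le => d d0.
have /cvgrPdist_le/(_ d d0) := e0; apply: filterS => n; rewrite sub0r normrN.
move=> ed; rewrite distrC (le_trans (mx_norm_le_enorm _))//.
by rewrite (le_trans (fe n))// (le_trans (ler_norm _)).
Qed.

(** The scalar theorem is applied to one coordinate after another: [s] makes the first [k]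
    coordinates converge and is refined at each step of the induction. *)
Lemma bolzano_weierstrass_row (f : nat -> 'rV[R]_N) (C : R) :
  (forall n, dotp (f n) (f n) <= C) ->
  exists2 s : nat -> nat, {homo s : m n / (m < n)%N} &
    exists l : 'rV[R]_N, f (s n) @[n --> \oo] --> l.
Proof.
move=> fC.
have fi n i : `|f n 0 i| <= Num.sqrt C.
  by rewrite -sqrtr_sqr ler_wsqrtr// (le_trans (sqr_coord_le _ _)).
suff: forall k, (k <= N)%N -> exists2 s : nat -> nat,
    {homo s : m n / (m < n)%N} &
    forall i : 'I_N, (i < k)%N -> cvgn (fun n => f (s n) 0 i).
  move=> /(_ N (leqnn N))[s si sl]; exists s => //.
  exists (\row_i lim (f (s n) 0 i @[n --> \oo])).
  by apply/cvg_rowP => i; rewrite mxE; exact: sl.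
elim=> [_|k IH kN]; first by exists id.
have [s si sl] := IH (ltnW kN).
have [|t ti tl] := @bolzano_weierstrass R (fun n => f (s n) 0 (Ordinal kN)).
  exists (Num.sqrt C); split; first by rewrite num_real.
  by move=> M CM n _ /=; rewrite (le_trans (fi _ _))// ltW.
exists (s \o t).
  move=> m n mn; apply: si; move: mn; rewrite !ltnNge; apply: contra => tnm.
  by have := ti n m; rewrite !leEnat => <-.
move=> i; rewrite ltnS leq_eqVlt => /orP[/eqP ik|ik].
  by have -> : i = Ordinal kN by exact: val_inj.
have /cvg_ex[l sil] := sl i ik; apply/cvg_ex; exists l.
apply: (cvg_comp t (fun n => f (s n) 0 i)) sil => A [M _ MA].
exists M => // n /= Mn; apply: MA => /=; apply: leq_trans Mn _.
elim: n {ti tl IH} (ti) => // n IHn ti; apply: leq_ltn_trans (IHn ti) _.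
by rewrite ltnNge; have := ti n.+1 n; rewrite !leEnat => ->; rewrite ltnn.
Qed.

Lemma homo_ltn_cvg (s : nat -> nat) : {homo s : m n / (m < n)%N} ->
  s @ \oo --> \oo.
Proof.
move=> si A [M _ MA]; exists M => // n /= Mn; apply: MA => /=.
apply: leq_trans Mn _; elim: n => // n IHn; apply: leq_ltn_trans IHn _.
exact: si.
Qed.

Lemma compact_dotp_le (a : 'rV[R]_N) (C : R) :
  compact [set z | dotp (z - a) (z - a) <= C].
Proof.
apply: bounded_closed_compact.
  exists (Num.sqrt C + enorm a); split; first by rewrite num_real.
  move=> M CM z /= zC; rewrite (le_trans (mx_norm_le_enorm _))//.
  apply: le_trans (ltW CM); rewrite -[z](subrK a) (le_trans (enormD _ _))//.
  by rewrite lerD2r ler_wsqrtr.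
apply: (@preimage_closed _ _ (fun z => dotp (z - a) (z - a)) [set t | t <= C]).
  move=> z _; have za : t - a @[t --> z] --> z - a.
    by apply: continuousB => // ?; exact: cst_continuous.
  exact: (cvg_dotp za za).
exact: closed_le.
Qed.

End RowConvergence.

(** * Maximal monotone operators *)

Section Minty.
Context {R : realType} {N : nat}.
Local Notation E := 'rV[R]_N.

(* Maximizing the Lagrange dual over the simplex: for fixed weights [l] the
   function [sum_i l_i <v_i + z, z - a_i>] is minimal at
   [z l = (sum_i l_i (a_i - v_i)) / 2], with value [- h l]. *)
Lemma monotone_finite_family m (a v : 'I_m.+1 -> E) :
  (forall i j, 0 <= dotp (v i - v j) (a i - a j)) ->
  exists z, forall i, dotp (v i + z) (z - a i) <= 0.
Proof.
move=> mon.
pose w i : E := 2^-1 *: (a i - v i).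
pose c i := dotp (v i) (a i).
pose z (l : 'rV[R]_m.+1) := \sum_i l 0 i *: w i.
pose h l := dotp (z l) (z l) + \sum_i l 0 i * c i.
pose Delta : set 'rV[R]_m.+1 :=
  [set l | (forall i, `[0, 1]%classic (l 0 i))] `&`
  [set l | \sum_i l 0 i = 1].
have cDelta : compact Delta.
  apply: compact_closedI.
    by apply: (@rV_compact R _ (fun=> `[0, 1]%classic)) => i; exact: segment_compact.
  apply: (@preimage_closed _ _ (fun l : 'rV[R]_m.+1 => \sum_i l 0 i) [set t | t = 1]).
    move=> l _; apply: (@continuous_big _ _ _ _ _ add_continuous) => i _.
    exact: coord_continuous.
  exact: closed_eq.
have Delta0 : Delta !=set0.
  exists (delta_mx 0 ord0); split => [i|] /=.
    by rewrite mxE eqxx/= in_itv/=; case: (i == _); rewrite ?lexx ?ler01.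
  rewrite (bigD1 ord0)//= mxE !eqxx big1 ?addr0// => i i0.
  by rewrite mxE (negbTE i0).
have clin (q : 'I_m.+1 -> R) :
    continuous (fun u : 'rV[R]_m.+1 => \sum_i u 0 i * q i).
  apply: (@continuous_big _ _ _ _ _ add_continuous) => i _ k.
  apply: (@cvgM _ _ (nbhs k) _ (fun u : 'rV[R]_m.+1 => u 0 i) (cst (q i))).
    exact: coord_continuous.
  exact: cvg_cst.
have zE u j : z u 0 j = \sum_i u 0 i * w i 0 j.
  by rewrite /z summxE; apply: eq_bigr => i _; rewrite mxE.
have ch : continuous h.
  move=> l.
  have zl : z @ l --> z l.
    apply: (@cvg_rowP _ _ _ (nbhs l) (nbhs_filter l) z (z l)).2 => j.
    rewrite zE (_ : (fun u => z u 0 j) = fun u => \sum_i u 0 i * w i 0 j).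
      exact: clin.
    by apply/funext => u; exact: zE.
  have zz := @cvg_dotp _ _ _ (nbhs l) (nbhs_filter l) z z _ _ zl zl.
  exact: (@cvgD _ _ _ (nbhs l) (nbhs_filter l) _ _ _ _ zz (clin c l)).
have [l lD lmin] := @compact_EVT_min _ R h Delta Delta0 cDelta
  (continuous_subspaceT ch).
move: lD; rewrite inE => -[l01 l1].
pose abar := \sum_i l 0 i *: a i; pose vbar := \sum_i l 0 i *: v i.
have l0 i : 0 <= l 0 i by have := l01 i; rewrite /= in_itv/= => /andP[].
pose C := \sum_i l 0 i * c i.
(* Monotonicity weighted by [l i * l j] gives [C >= <vbar, abar>], whence
   [h l >= |abar + vbar|^2 / 4]. *)
have dual_ge0 : 0 <= h l.
  have zlE : z l = 2^-1 *: (abar - vbar).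
    rewrite /z /abar /vbar -sumrB scaler_sumr; apply: eq_bigr => i _.
    by rewrite /w -scalerBr !scalerA mulrC.
  have Ea y : dotp y abar = \sum_j l 0 j * dotp y (a j).
    by rewrite /abar dotp_sumr; apply: eq_bigr => j _; rewrite dotpZr.
  have Ev y : dotp vbar y = \sum_j l 0 j * dotp (v j) y.
    by rewrite /vbar dotp_suml; apply: eq_bigr => j _; rewrite dotpZl.
  have Hi i : 0 <= c i - dotp (v i) abar - dotp vbar (a i) + C.
    have -> : c i - dotp (v i) abar - dotp vbar (a i) + C =
        \sum_j l 0 j * dotp (v i - v j) (a i - a j).
      rewrite Ea Ev /C -[c i]mul1r -l1 mulr_suml -!sumrB -big_split/=.
      by apply: eq_bigr => j _; rewrite !dotpE /c; ring.
    by apply: sumr_ge0 => j _; exact: mulr_ge0.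
  have HC : 0 <= C - dotp vbar abar.
    suff -> : C - dotp vbar abar =
       2^-1 * \sum_i l 0 i * (c i - dotp (v i) abar - dotp vbar (a i) + C).
      by apply: mulr_ge0 => //; apply: sumr_ge0 => i _; exact: mulr_ge0.
    have -> : \sum_i l 0 i * (c i - dotp (v i) abar - dotp vbar (a i) + C) =
        C - dotp vbar abar - dotp vbar abar + C.
      have -> : C - dotp vbar abar - dotp vbar abar + C = C -
          \sum_j l 0 j * dotp (v j) abar - \sum_j l 0 j * dotp vbar (a j) +
          (\sum_j l 0 j) * C by rewrite -Ev -Ea l1 mul1r.
      rewrite mulr_suml {2}/C -!sumrB -big_split/=.
      by apply: eq_bigr => j _; ring.
    by field.
  rewrite /h -/C zlE.
  have := dotp_ge0 (2^-1 *: (abar + vbar)).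
  by rewrite !dotpE (dotpC abar vbar); lra.
exists (z l) => i.
(* First-order optimality of [l] towards the vertex [i] of the simplex; adding [h l >= 0] to it is
   exactly the inequality for [i]. *)
pose lt t := l + t *: (delta_mx 0 i - l).
have ltq t q : \sum_j lt t 0 j * q j =
    \sum_j l 0 j * q j + t * (q i - \sum_j l 0 j * q j).
  under eq_bigr do rewrite !mxE eqxx/= mulrDl mulrBr mulrBl.
  rewrite big_split sumrB/=; congr (_ + _).
  rewrite mulrBr mulr_sumr; congr (_ - _); last first.
    by apply: eq_bigr => j _; rewrite mulrA.
  rewrite (bigD1 i)//= eqxx mulr1 big1 ?addr0// => j ji.
  by rewrite (negbTE ji) mulr0 mul0r.
have [y yE] : exists y : E, y = w i - z l by exists (w i - z l).
have zt t : z (lt t) = z l + t *: y.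
  by apply/rowP => k; rewrite zE ltq -zE yE !mxE.
have ct t : \sum_j lt t 0 j * c j = C + t * (c i - C) := ltq t c.
have ltD t : 0 < t <= 1 -> lt t \in Delta.
  move=> /andP[t0 t1]; rewrite inE; split => /= [j|].
    have := l01 j; rewrite /= !in_itv/= !mxE eqxx/= => /andP[l0' l1'].
    have t1' : 0 <= 1 - t by lra.
    have := mulr_ge0 (ltW t0) l0'; have := mulr_ge0 t1' l0'.
    have l1'' : 0 <= 1 - l 0 j by lra.
    have := mulr_ge0 (ltW t0) l1''; have := mulr_ge0 t1' l1''.
    by case: (j == i) => /= *; apply/andP; split; lra.
  under eq_bigr do rewrite !mxE.
  rewrite big_split -mulr_sumr sumrB /= l1 (bigD1 i)//= !eqxx big1.
    by rewrite /=; ring.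
  by move=> j ji; rewrite (negbTE ji).
have Dge0 t : 0 < t <= 1 ->
    0 <= 2 * dotp (z l) y + (c i - C) + t * dotp y y.
  move=> t01; have /andP[t0 _] := t01.
  rewrite -(pmulr_rge0 _ t0); have := lmin _ (ltD _ t01).
  rewrite /h zt ct -/C -subr_ge0; congr (_ <= _).
  by rewrite !dotpDl !dotpDr !dotpZl !dotpZr (dotpC y (z l)); ring.
have D0 : 0 <= 2 * dotp (z l) y + (c i - C).
  rewrite leNgt; apply/negP => neg.
  set e := - (2 * dotp (z l) y + (c i - C)).
  set q := dotp y y.
  have e0 : 0 < e by rewrite oppr_gt0.
  have q0 : 0 <= q := dotp_ge0 _.
  have eq0 : 0 < e + q + 1 by lra.
  have /Dge0 : 0 < e / (e + q + 1) <= 1.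
    by rewrite divr_gt0//= ler_pdivrMr// mul1r; lra.
  rewrite -/q -[X in X + _]opprK -/e addrC subr_ge0 mulrAC ler_pdivlMr//.
  by rewrite ler_pM2l// ; lra.
move: D0 dual_ge0; rewrite /h -/C yE /w.
rewrite !dotpE -/(c i) (dotpC (z l) (v i)); lra.
Qed.

(** Each [p] in [G] puts [z] in a closed set, and the one of [p0] lies in a ball. Compactness
    therefore reduces the claim to finite families, to which [p0] is added so that their solution
    falls in the ball. The conclusion says that [x - z] is monotonically related to [G] at [z]. *)
Lemma minty (G : set (E * E)) (x : E) : G !=set0 ->
  (forall p q, G p -> G q -> 0 <= dotp (p.2 - q.2) (p.1 - q.1)) ->
  exists z, forall p, G p -> dotp (p.2 - x + z) (z - p.1) <= 0.
Proof.
move=> [p0 Gp0] mon.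
pose K0 := [set z | dotp (z - p0.1) (z - p0.1) <=
  dotp (p0.2 - x + p0.1) (p0.2 - x + p0.1)].
pose K (p : E * E) := [set z | dotp (p.2 - x + z) (z - p.1) <= 0].
have KK0 : K p0 `<=` K0.
  move=> z; rewrite /K0 /K /=.
  have -> : p0.2 - x + z = (p0.2 - x + p0.1) + (z - p0.1).
    by rewrite addrACA addrN addr0 addrAC -addrA.
  rewrite dotpDl => H.
  by have := dotp_youngN (p0.2 - x + p0.1) (z - p0.1); lra.
have clK p : closed (K p).
  apply: (@preimage_closed _ _ (fun z => dotp (p.2 - x + z) (z - p.1)) [set t | t <= 0]); last exact: closed_le.
  move=> z _.
  have h1 : (fun t => p.2 - x + t) @ z --> p.2 - x + z.
    exact: (@cvgD _ _ _ (nbhs z) (nbhs_filter z) (cst (p.2 - x)) idfun _ _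
      (cvg_cst _) (@cvg_id _ _)).
  have h2 : (fun t => t - p.1) @ z --> z - p.1.
    exact: (@cvgB _ _ _ (nbhs z) (nbhs_filter z) idfun (cst p.1) _ _
      (@cvg_id _ _) (cvg_cst _)).
  exact: (@cvg_dotp _ _ _ (nbhs z) (nbhs_filter z) _ _ _ _ h1 h2).
have := @compact_dotp_le R N p0.1 (dotp (p0.2 - x + p0.1) (p0.2 - x + p0.1)).
rewrite -/K0 compact_In0 => /(_ (E * E)%type G (fun p => K0 `&` K p)) [||z Kz].
- by exists K => // p _; exact: clK.
- move=> D DG; pose s := p0 :: enum_fset D.
  have Gs (i : 'I_(size s)) : G (tnth (in_tuple s) i).
    have := mem_tnth i (in_tuple s); rewrite inE => /orP[/eqP->//|].
    by move=> /DG; rewrite inE.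
  have [|z zs] := @monotone_finite_family _
      (fun i : 'I_(size (enum_fset D)).+1 => (tnth (in_tuple s) i).1)
      (fun i : 'I_(size (enum_fset D)).+1 => (tnth (in_tuple s) i).2 - x).
    by move=> i j; rewrite opprB addrA subrK; exact: mon.
  have zK p : p \in s -> K p z.
    by move=> ps; have [i ->] := tnthP (in_tuple s) p ps; exact: zs.
  exists z => p /= pD; split; last by apply: zK; rewrite inE pD orbT.
  by apply: KK0; apply: zK; rewrite inE eqxx.
- by exists z => p Gp; exact: (Kz p Gp).2.
Qed.

End Minty.

(** * Maximality, resolvents and closedness of the graph *)

Section MaximalMonotone.
Context {R : realType} {N : nat}.
Local Notation E := 'rV[R]_N.
Implicit Types (A B : operator R N) (x y z : E).

(** The graph enlarged by [(x, y)] is still monotone, so by maximality it is not larger. *)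
Lemma maximal_monotone_mem A x y : maximal_monotone A ->
  (forall a v, A a v -> 0 <= dotp (y - v) (x - a)) -> A x y.
Proof.
move=> [_ mon max] xy.
pose A' : operator R N := fun a v => A a v \/ (a = x /\ v = y).
change (graph_of A (x, y)); have <- : graph_of A' = graph_of A.
  apply: max; last by move=> p Ap; left.
  move=> a v a' v' [Aav|[/= -> ->]] [Aav'|[/= -> ->]].
  - exact: mon.
  - by rewrite -opprB -[a - x]opprB dotpNl dotpNr opprK; exact: xy.
  - exact: xy.
  - by rewrite subrr dotp0l.
by right.
Qed.

Lemma monotone_le A a v a' v' : monotone_op A -> A a v -> A a' v' ->
  0 <= dotp (v - v') (a - a').
Proof. by move=> mon Av Av'; exact: mon. Qed.

Lemma maximal_monotone_mon A : maximal_monotone A -> monotone_op A.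
Proof. by case. Qed.

(** Minty's theorem for the graph of [g A] yields a [z] such that [(x - z) / g] is monotonically
    related to [A] at [z]; maximality concludes. *)
Lemma resolvent_ex A (g : R) x : maximal_monotone A -> 0 < g ->
  exists z, A z (g^-1 *: (x - z)).
Proof.
move=> mA g0; have [[p Ap] mon _] := mA.
have [||z Gz] := @minty R N [set q | exists2 v, A q.1 v & q.2 = g *: v] x.
- by exists (p.1, g *: p.2); exists p.2.
- move=> [a _] [a' _] /= [v Av ->] [v' Av' ->].
  rewrite -scalerBr dotpZl; apply: mulr_ge0; first exact: ltW.
  exact: monotone_le mon Av Av'.
exists z; apply: maximal_monotone_mem => // a v Av.
have /= := Gz (a, g *: v) (ex_intro2 _ _ v Av erefl).
rewrite -oppr_ge0 -dotpNl => H.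
rewrite -(pmulr_rge0 _ g0) -dotpZl scalerBr scalerA mulfV ?gt_eqF// scale1r.
by move: H; congr (_ <= dotp _ _); rewrite opprD opprB addrAC [x - z + _]addrC addrA addrAC.
Qed.

Lemma resolventP A (g : R) x : maximal_monotone A -> 0 < g ->
  A (resolvent g A x) (g^-1 *: (x - resolvent g A x)).
Proof.
move=> mA g0; rewrite /resolvent.
set S := op_inv _ _; have : S (get S).
  apply: getPex; have [z Az] := resolvent_ex x mA g0.
  exists z; exists z => //; exists (g *: (g^-1 *: (x - z))); first by exists (g^-1 *: (x - z)).
  by rewrite scalerA mulfV ?gt_eqF// scale1r addrC subrK.
case=> z /= -> [_ [v Av <-]] <-.
by rewrite [_ + g *: v]addrC addrK scalerA mulVf ?gt_eqF// scale1r.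
Qed.

(** Firm nonexpansiveness, since [a] is the resolvent of [a + g *: v]. *)
Lemma resolvent_le A (g : R) x a v : maximal_monotone A -> 0 < g -> A a v ->
  dotp (resolvent g A x - a) (resolvent g A x - a) <=
  dotp (resolvent g A x - a) (x - (a + g *: v)).
Proof.
move=> mA g0 Av; set J := resolvent g A x.
have := monotone_le (maximal_monotone_mon mA) (resolventP x mA g0) Av.
rewrite -(pmulr_rge0 _ g0) -dotpZl scalerBr scalerA mulfV ?gt_eqF// scale1r.
rewrite -/J => H; rewrite -subr_ge0 -dotpBr dotpC.
by move: H; congr (_ <= dotp _ _); apply/rowP => i; rewrite !mxE; ring.
Qed.

Lemma resolvent_unique A (g : R) x z : maximal_monotone A -> 0 < g ->
  A z (g^-1 *: (x - z)) -> resolvent g A x = z.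
Proof.
move=> mA g0 Az; apply/eqP; rewrite -subr_eq0; apply/eqP/dotp_eq0.
apply: le_trans (resolvent_le x mA g0 Az) _.
by rewrite scalerA mulfV ?gt_eqF// scale1r [z + _]addrC subrK subrr dotp0r.
Qed.

Lemma resolvent_nonexpansive A (g : R) x y : maximal_monotone A -> 0 < g ->
  dotp (resolvent g A x - resolvent g A y) (resolvent g A x - resolvent g A y)
  <= dotp (x - y) (x - y).
Proof.
move=> mA g0; have := resolvent_le x mA g0 (resolventP y mA g0).
rewrite scalerA mulfV ?gt_eqF// scale1r [_ + (y - _)]addrC subrK.
by have := dotp_young (resolvent g A x - resolvent g A y) (x - y); lra.
Qed.

Lemma maximal_monotone_closed A (x y : nat -> E) (a v : E) :
  maximal_monotone A -> (forall n, A (x n) (y n)) ->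
  x @ \oo --> a -> y @ \oo --> v -> A a v.
Proof.
move=> mA Axy xa yv; apply: maximal_monotone_mem => // b w Abw.
have H : dotp (y n - w) (x n - b) @[n --> \oo] --> dotp (v - w) (a - b).
  by apply: cvg_dotp; apply: cvgB => //; exact: cvg_cst.
apply: (cvgr_to_ge H); apply: nearW => n.
by apply: monotone_le (maximal_monotone_mon mA) _ Abw.
Qed.

Lemma maximal_monotone_convex A x v w (t : R) : maximal_monotone A ->
  0 <= t <= 1 -> A x v -> A x w -> A x (v + t *: (w - v)).
Proof.
move=> mA /andP[t0 t1] Av Aw; apply: maximal_monotone_mem => // a u Au.
have H1 := monotone_le (maximal_monotone_mon mA) Av Au.
have H2 := monotone_le (maximal_monotone_mon mA) Aw Au.
have -> : v + t *: (w - v) - u = (1 - t) *: (v - u) + t *: (w - u).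
  by apply/rowP => i; rewrite !mxE; ring.
by rewrite dotpDl !dotpZl addr_ge0// mulr_ge0// subr_ge0.
Qed.

End MaximalMonotone.

(** * From the dual inequalities to a zero of the sum *)

Section ZeroOfSum.
Context {R : realType} {N : nat}.
Local Notation E := 'rV[R]_N.
Implicit Types (x y z v w : E).

Lemma affine_ge0 (D q : R) : (forall t, 0 < t <= 1 -> 0 <= D + t * q) -> 0 <= D.
Proof.
move=> H; rewrite leNgt; apply/negP => D0.
have q0 : D < q by have := H 1; rewrite ltr01 lexx mul1r => /(_ isT); lra.
have [q1|q1] := leP q 0; first by have := H 1; rewrite ltr01 lexx => /(_ isT); lra.
have e0 : 0 < q - 2 * D by lra.
(* At this parameter the affine function equals [-2 D^2 / (q - 2 D) < 0]. *)
have := H (- D / (q - 2 * D)).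
have -> : D + - D / (q - 2 * D) * q = - (2 * D ^+ 2 / (q - 2 * D)).
  by field; rewrite gt_eqF.
rewrite divr_gt0 ?oppr_gt0// ler_pdivrMr// mul1r.
move=> /(_ ltac:(by lra)); rewrite oppr_ge0 leNgt divr_gt0// mulr_gt0//.
by rewrite exprn_even_gt0//= lt_eqF.
Qed.

Context (A B : operator R N) (xb : E).
Hypothesis mA : maximal_monotone A.
Hypothesis Bclosed : forall (x y : nat -> E) a v, (forall n, B (x n) (y n)) ->
  x @ \oo --> a -> y @ \oo --> v -> B a v.
Hypothesis Bconvex : forall x v w (t : R), 0 <= t <= 1 -> B x v -> B x w ->
  B x (v + t *: (w - v)).
Hypothesis Bbound : exists2 C, 0 <= C &
  forall x y, B x y -> dotp y y <= C * (1 + dotp x x).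
Hypothesis Bfull : forall x, exists y, B x y.
Hypothesis xbP : forall a v w, A a v -> B a w -> 0 <= dotp (v + w) (a - xb).

(* [p] is a limit point of [(xb - z_t) / t] for [z_t = J_(t A)(xb - t w)]. *)
Let resolvent_limit w : exists p y, [/\ A xb (p - w), B xb y,
  dotp p p <= dotp (w - y) p &
  forall v, A xb v -> dotp p p <= dotp (w + v) p].
Proof.
have [[[a va] /= Aa] mon _] := mA.
pose t n : R := n.+1%:R^-1.
have t0 n : 0 < t n by rewrite invr_gt0.
have t1 n : t n <= 1 by rewrite invf_le1// ler1n.
pose z n := resolvent (t n) A (xb - t n *: w).
pose p n := (t n)^-1 *: (xb - z n).
have zE n : z n - xb = - (t n *: p n).
  by rewrite /p scalerA mulfV ?gt_eqF// scale1r opprB.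
have Az n : A (z n) (p n - w).
  have := resolventP (xb - t n *: w) mA (t0 n); rewrite -/(z n).
  congr (A _ _); rewrite /p addrAC scalerBr scalerA mulVf ?gt_eqF//.
  by rewrite scale1r.
have /choice[y By] := fun n => Bfull (z n).
have pw n : dotp (p n) (p n) <= dotp (w - y n) (p n).
  have := xbP (Az n) (By n); rewrite zE dotpNr dotpZr -mulrN pmulr_rge0//.
  by rewrite !dotpE; lra.
have pv n v : A xb v -> dotp (p n) (p n) <= dotp (w + v) (p n).
  move=> Av; have := monotone_le mon (Az n) Av.
  rewrite zE dotpNr dotpZr -mulrN pmulr_rge0//.
  by rewrite !dotpE; lra.
(* Bound for [|z n|^2] from firm nonexpansiveness against [(a, va)] and [t n <= 1]. Linear growth
   then bounds [y n], and [pw] bounds [p n], which makes all three sequences relatively compact. *)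
pose Cz := 2 * (2 * (dotp (xb - a) (xb - a) + dotp (w + va) (w + va))) + 2 * dotp a a.
have zC n : dotp (z n) (z n) <= Cz.
  have := resolvent_le (xb - t n *: w) mA (t0 n) Aa; rewrite -/(z n).
  set q := xb - _ - _; have -> : q = (xb - a) - t n *: (w + va).
    by apply/rowP => i; rewrite !mxE; ring.
  move=> H1; have := dotp_young (z n - a) (xb - a - t n *: (w + va)).
  have := dotp_sqrB (xb - a) (t n *: (w + va)).
  have := dotp_sqrD (z n - a) a; rewrite subrK.
  have : dotp (t n *: (w + va)) (t n *: (w + va)) <= dotp (w + va) (w + va).
    rewrite dotpZl dotpZr mulrA ler_piMl ?dotp_ge0//.
    by rewrite mulr_ile1// ltW.
  by rewrite /Cz; lra.
have [C C0 BC] := Bbound.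
have yC n : dotp (y n) (y n) <= C * (1 + Cz).
  by apply: le_trans (BC _ _ (By n)) _; rewrite ler_wpM2l// lerD2l.
pose Cp := 2 * (dotp w w + C * (1 + Cz)).
have pC n : dotp (p n) (p n) <= Cp.
  have := dotp_sqrB w (y n); have := dotp_young (w - y n) (p n).
  by have := pw n; have := yC n; rewrite /Cp; lra.
have zxb : z @ \oo --> xb.
  apply: (@cvg_row_enorm _ _ _ _ (fun n => Num.sqrt Cp * t n)) => [n|].
    rewrite zE enormN enormZ gtr0_norm// mulrC.
    by apply: ler_wpM2r; [exact: ltW|exact: ler_wsqrtr].
  rewrite -[X in _ --> X](mulr0 (Num.sqrt Cp)); apply: cvgM; first exact: cvg_cst.
  exact: cvg_harmonic.
have [s /homo_ltn_cvg si [pl sp]] := bolzano_weierstrass_row pC.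
have [s' /homo_ltn_cvg s'i [yl sy]] := bolzano_weierstrass_row (fun n => yC (s n)).
pose r n := s (s' n).
have rp : p (r n) @[n --> \oo] --> pl by exact: (cvg_comp _ _ s'i sp).
have rz : z (r n) @[n --> \oo] --> xb.
  exact: (cvg_comp (s \o s') z (cvg_comp s' s s'i si) zxb).
exists pl, yl; split.
- apply: (maximal_monotone_closed mA (fun n => Az (r n)) rz).
  exact: (cvgB rp (cvg_cst w)).
- exact: (Bclosed (fun n => By (r n)) rz sy).
- apply: (ler_cvg_to (cvg_dotp rp rp) (cvg_dotp (cvgB (cvg_cst w) sy) rp)).
  by apply: nearW => n; exact: pw.
- move=> v Av.
  apply: (ler_cvg_to (cvg_dotp rp rp) (cvg_dotp (cvg_cst (w + v)) rp)).
  by apply: nearW => n; exact: pv.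
Qed.

(** Along a minimizing sequence the sums are bounded and the [B]-parts are bounded by [Bbound], so
    both converge on a subsequence; the [A]-part is their difference. Convexity of the two images
    turns minimality of [v + w] into the variational inequality. *)
Let least_norm_sum v0 w0 : A xb v0 -> B xb w0 ->
  exists v w, [/\ A xb v, B xb w & forall v' w', A xb v' -> B xb w' ->
    dotp (v + w) (v + w) <= dotp (v + w) (v' + w')].
Proof.
move=> Av0 Bw0.
pose S := [set r : R | exists v w, [/\ A xb v, B xb w & r = dotp (v + w) (v + w)]].
have S0 : has_inf S.
  split; first by exists (dotp (v0 + w0) (v0 + w0)), v0, w0.
  by exists 0 => _ [v [w [_ _ ->]]]; exact: dotp_ge0.
have /choice[vw Hvw] n : exists vw : E * E, [/\ A xb vw.1, B xb vw.2 &
    dotp (vw.1 + vw.2) (vw.1 + vw.2) <= inf S + n.+1%:R^-1].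
  have [_ [v [w [Av Bw ->]]] lt] := inf_adherent (ltac:(by rewrite invr_gt0) : 0 < n.+1%:R^-1) S0.
  by exists (v, w); split => //=; exact: ltW.
have [C C0 BC] := Bbound.
have wC n : dotp (vw n).2 (vw n).2 <= C * (1 + dotp xb xb).
  by apply: BC; have [] := Hvw n.
have sC n : dotp ((vw n).1 + (vw n).2) ((vw n).1 + (vw n).2) <= inf S + 1.
  have [_ _ H] := Hvw n; apply: le_trans H _; rewrite lerD2l.
  by rewrite invf_le1// ler1n.
have [s /homo_ltn_cvg si [sl ss]] := bolzano_weierstrass_row sC.
have [s' /homo_ltn_cvg s'i [w sw]] := bolzano_weierstrass_row (fun n => wC (s n)).
pose r n := s (s' n).
have rs : (vw (r n)).1 + (vw (r n)).2 @[n --> \oo] --> sl.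
  exact: (cvg_comp _ _ s'i ss).
have Bw : B xb w.
  apply: (@Bclosed (fun=> xb) (fun n => (vw (r n)).2)) => //; last exact: cvg_cst.
  by move=> n; have [] := Hvw (r n).
have Av : A xb (sl - w).
  apply: (@maximal_monotone_closed _ _ _ (fun=> xb) (fun n => (vw (r n)).1)) => //.
  - by move=> n; have [] := Hvw (r n).
  - exact: cvg_cst.
  - rewrite (_ : (fun n => _) = fun n => ((vw (r n)).1 + (vw (r n)).2) - (vw (r n)).2).
      exact: cvgB.
    by apply/funext => n; rewrite addrK.
have min : dotp sl sl <= inf S.
  have cr : inf S + (r n).+1%:R^-1 @[n --> \oo] --> inf S + 0.
    apply: cvgD; first exact: cvg_cst.
    exact: (cvg_comp r (fun n => n.+1%:R^-1) (cvg_comp s' s s'i si) cvg_harmonic).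
  rewrite -[leRHS]addr0; apply: (ler_cvg_to (cvg_dotp rs rs) cr).
  by apply: nearW => n; have [] := Hvw (r n).
exists (sl - w), w; split => // v' w' Av' Bw'.
rewrite subrK -subr_ge0 -dotpBr.
rewrite -(pmulr_rge0 _ (ltr0n R 2)).
have [e eE] : exists e, e = v' + w' - sl by eexists.
rewrite -eE.
apply: (@affine_ge0 _ (dotp e e)) => t /andP[t0 t1].
have t01 : 0 <= t <= 1 by rewrite ltW.
have : inf S <= dotp (sl + t *: e) (sl + t *: e).
  apply: ge_inf; first by case: S0.
  exists (sl - w + t *: (v' - (sl - w))), (w + t *: (w' - w)); split.
  - exact: maximal_monotone_convex.
  - exact: Bconvex.
  have -> : sl + t *: e = sl - w + t *: (v' - (sl - w)) + (w + t *: (w' - w)).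
    by rewrite eE; apply/rowP => i; rewrite !mxE; ring.
  by [].
move=> H; rewrite -(pmulr_rge0 _ t0); have := le_trans min H.
by rewrite !dotpDl !dotpDr !dotpZl !dotpZr (dotpC e sl); lra.
Qed.

(** Let [s = v + w] be the least-norm element and [p] the limit of difference quotients for this
    [w]. Since [p = (p - w) + w] lies in the sum, [|s|^2 <= <s, p>], while [|p|^2 <= <s, p>]; hence
    [p = s]. Then [|s|^2 <= <w - y, s>], and minimality against [(p - w) + y] gives
    [<w - y, s> <= 0]. The preliminary use of [resolvent_limit] at [w0] only shows that [A xb] is
    nonempty. *)
Lemma zero_of_sum : exists v w, [/\ A xb v, B xb w & v + w = 0].
Proof.
have [w0 Bw0] := Bfull xb.
have [p0 [_ [Ap0 _ _ _]]] := resolvent_limit w0.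
have [v [w [Av Bw vwP]]] := least_norm_sum Ap0 Bw0.
exists v, w; split => //; have [s sE] : exists s, s = v + w by eexists.
rewrite -sE in vwP *.
have [p [y [Ap By py pv]]] := resolvent_limit w.
have H1 := pv _ Av; rewrite addrC -sE in H1.
have H2 := vwP _ _ Ap Bw; rewrite subrK in H2.
have /eqP : p - s = 0.
  by apply: dotp_eq0; rewrite !dotpE (dotpC p s); lra.
rewrite subr_eq0 => /eqP ps; rewrite ps in Ap py H1 H2.
apply: dotp_eq0.
have H3 := vwP _ _ Ap By.
by move: H3 py; rewrite !dotpE (dotpC w s) (dotpC y s); lra.
Qed.

End ZeroOfSum.

Notation intg mu f := (integrable mu setT (EFin \o f)).

(** * Integrability and measurability *)

Section RealIntegrals.
Context d (T : measurableType d) (R : realType) (mu : probability T R).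
Implicit Types (f g : T -> R).

Lemma intg_measurable f : intg mu f -> measurable_fun setT f.
Proof. by move=> /measurable_int/measurable_EFinP. Qed.

Lemma intg_le f g : measurable_fun setT f -> intg mu g ->
  (forall t, `|f t| <= g t) -> intg mu f.
Proof.
move=> mf ig fg; apply: le_integrable ig => //; first exact/measurable_EFinP.
by move=> t _ /=; rewrite lee_fin (le_trans (fg t))// ler_norm.
Qed.

Lemma intgD f g : intg mu f -> intg mu g -> intg mu (fun t => f t + g t).
Proof. by move=> mf mg; have := integrableD measurableT mf mg; apply: eq_integrable. Qed.

Lemma intgN f : intg mu f -> intg mu (fun t => - f t).
Proof. by move=> mf; have := integrableN mf; apply: eq_integrable. Qed.

Lemma intgB f g : intg mu f -> intg mu g -> intg mu (fun t => f t - g t).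
Proof. by move=> mf mg; have := intgD mf (intgN mg); apply: eq_integrable. Qed.

Lemma intgZ f c : intg mu f -> intg mu (fun t => c * f t).
Proof. by move=> mf; have := integrableZl measurableT c mf; apply: eq_integrable. Qed.

Lemma intg_cst c : intg mu (fun=> c).
Proof. exact: (finite_measure_integrable_cst mu c). Qed.

Lemma intg_sum (I : eqType) (s : seq I) (F : I -> T -> R) :
  (forall i, i \in s -> intg mu (F i)) -> intg mu (fun t => \sum_(i <- s) F i t).
Proof.
elim: s => [_|i s IH H].
  by have := intg_cst 0; apply: eq_integrable => // t _; rewrite /= big_nil.
have := intgD (H i (mem_head _ _)) (IH (fun j js => H j ltac:(by rewrite inE js orbT))).
by apply: eq_integrable => // t _ /=; rewrite big_cons.
Qed.

Lemma intg_norm f : intg mu f -> intg mu (fun t => `|f t|).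
Proof. by move=> mf; have := integrable_abse mf; apply: eq_integrable. Qed.

Lemma intg_mul f g : measurable_fun setT f -> measurable_fun setT g ->
  intg mu (fun t => f t ^+ 2) -> intg mu (fun t => g t ^+ 2) ->
  intg mu (fun t => f t * g t).
Proof.
move=> mf mg if2 ig2; apply: (intg_le _ (intgD if2 ig2)).
  exact: measurable_funM.
by move=> t; rewrite ler_norml; apply/andP; split; nra.
Qed.

Lemma intg_ge0P f : measurable_fun setT f -> (forall t, 0 <= f t) ->
  (\int[mu]_t (f t)%:E < +oo)%E -> intg mu f.
Proof.
move=> mf f0 fi; apply/integrableP; split; first exact/measurable_EFinP.
by under eq_integral do rewrite /= ger0_norm//.
Qed.

Lemma intg_fin f : intg mu f -> (\int[mu]_t (f t)%:E = (\int[mu]_t f t)%:E)%E.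
Proof. by move=> mf; rewrite fineK//; exact: integrable_fin_num. Qed.

Lemma RintD f g : intg mu f -> intg mu g ->
  \int[mu]_t (f t + g t) = \int[mu]_t f t + \int[mu]_t g t.
Proof. by move=> mf mg; exact: RintegralD. Qed.

Lemma RintB f g : intg mu f -> intg mu g ->
  \int[mu]_t (f t - g t) = \int[mu]_t f t - \int[mu]_t g t.
Proof. by move=> mf mg; exact: RintegralB. Qed.

Lemma RintZ f c : intg mu f -> \int[mu]_t (c * f t) = c * \int[mu]_t f t.
Proof. by move=> mf; exact: RintegralZl. Qed.

Lemma Rint_cst c : \int[mu]_t c = c.
Proof.
have mu1 : fine (mu setT) = 1 by have /= -> := probability_setT mu.
by rewrite Rintegral_cst// -[RHS]mulr1; congr (_ * _).
Qed.

Lemma Rint_sum (I : eqType) (s : seq I) (F : I -> T -> R) :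
  (forall i, i \in s -> intg mu (F i)) ->
  \int[mu]_t (\sum_(i <- s) F i t) = \sum_(i <- s) \int[mu]_t F i t.
Proof.
elim: s => [_|i s IH H].
  by under eq_Rintegral do rewrite big_nil; rewrite Rint_cst big_nil.
have H' j : j \in s -> intg mu (F j) by move=> js; apply: H; rewrite inE js orbT.
under eq_Rintegral do rewrite big_cons.
by rewrite RintD ?IH ?big_cons//; [exact: H (mem_head _ _)|exact: intg_sum].
Qed.

Lemma Rint_le f g : intg mu f -> intg mu g -> (forall t, f t <= g t) ->
  \int[mu]_t f t <= \int[mu]_t g t.
Proof. by move=> mf mg fg; apply: le_Rintegral. Qed.

Lemma Rint_ae f g : intg mu f -> intg mu g -> {ae mu, forall t, f t = g t} ->
  \int[mu]_t f t = \int[mu]_t g t.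
Proof.
move=> mf mg fg; congr fine; apply: ae_eq_integral => //.
- exact: measurable_int mf.
- exact: measurable_int mg.
- by apply: filterS fg => t /= -> .
Qed.

Lemma dominated_cvg_Rint (f_ : nat -> T -> R) f g :
  (forall n, measurable_fun setT (f_ n)) -> measurable_fun setT f ->
  intg mu g -> {ae mu, forall t, f_ ^~ t @ \oo --> f t} ->
  {ae mu, forall t n, `|f_ n t| <= g t} ->
  intg mu f /\ \int[mu]_t f_ n t @[n --> \oo] --> \int[mu]_t f t.
Proof.
move=> mf_ mf ig ff fg.
have [||||fi _ fl] := @dominated_convergence _ T R mu setT measurableT
    (fun n => EFin \o f_ n) (EFin \o f) (EFin \o g) _ _ _ ig _.
- by move=> n; exact/measurable_EFinP.
- exact/measurable_EFinP.
- apply: filterS ff => t ff _ /=; apply/cvg_EFin; last exact: ff.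
  by apply: nearW.
- by apply: filterS fg => t fg n _; rewrite /= lee_fin.
split=> //.
by move: fl; rewrite /= intg_fin// => /fine_cvg.
Qed.

End RealIntegrals.

(** * Measurability of vector-valued maps by coordinates *)

Section RowMeasurability.
Context {R : realType} {N : nat}.
Local Notation E := 'rV[R]_N.

Lemma measurable_coord (i : 'I_N) :
  measurable_fun setT ((fun v : E => v 0 i) : borelRV R N -> R).
Proof.
apply: (measurability _ (RGenOInfty.measurableE R)).
move=> /= _ [_ [a ->]] <-; rewrite setTI; apply: sub_sigma_algebra.
apply: open_comp; last exact: interval_open.
move=> v _; exact: coord_continuous.
Qed.

(** Balls of the sup norm are boxes. An open set is the union of the countably many boxes with
    rational centre and radius [1 / (k + 1)] that it contains, and the preimage of a box is a finite
    intersection of coordinate preimages. *)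
Lemma measurable_rowP d (T : measurableType d) (f : T -> E) :
  measurable_fun setT (f : T -> borelRV R N) <->
  forall i, measurable_fun setT (fun t => f t 0 i).
Proof.
split=> [mf i|mf].
  by apply: (measurableT_comp (measurable_coord i)).
apply: (@measurability _ _ T (borelRV R N) setT f (@open E)) => //.
move=> _ [U oU <-]; rewrite setTI.
pose D : set ('rV[rat]_N * nat) :=
  [set p | ball (map_mx ratr p.1 : E) p.2.+1%:R^-1 `<=` U].
have -> : f @^-1` U = \bigcup_(p in setT)
    (if p \in D then \bigcap_(i in [set: 'I_N])
      [set t | ball (ratr (p.1 0 i) : R) p.2.+1%:R^-1 (f t 0 i)] else set0).
  apply/seteqP; split=> t /=; last first.
    move=> [p _]; case: ifPn => // /set_mem pU H; apply: pU; split.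
      by rewrite invr_gt0.
    by move=> i j; rewrite mxE (ord1 i); exact: H.
  move=> Uft; have /nbhs_ballP[e /= e0 eU] : nbhs (f t) U.
    by move: oU; rewrite openE => /(_ _ Uft).
  have [k k0 ke] : exists2 k : nat, True & k.+1%:R^-1 < e / 2.
    have e20 : 0 < e / 2 by rewrite divr_gt0.
    have [k _ /(_ k (leqnn k))] := near_infty_natSinv_lt (PosNum e20).
    by exists k.
  have /choice[q qP] (i : 'I_N) : exists q : rat,
      ratr q \in `](f t 0 i - k.+1%:R^-1), (f t 0 i + k.+1%:R^-1)[.
    have lt : f t 0 i - k.+1%:R^-1 < f t 0 i + k.+1%:R^-1.
      by rewrite ltrBlDr -addrA ltrDl addr_gt0// invr_gt0.
    by have [q qi] := rat_in_itvoo lt; exists q.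
  have qb i : ball (ratr (q i) : R) k.+1%:R^-1 (f t 0 i).
    have := qP i; rewrite in_itv/= => /andP[h1 h2].
    change (`|ratr (q i) - f t 0 i| < k.+1%:R^-1).
    by rewrite ltr_distl h1 h2.
  exists (\row_i q i, k) => //; rewrite mem_set.
    by move=> i _ /=; rewrite mxE; exact: qb.
  move=> v /= [_ vb]; apply: eU; split=> // i j.
  have := vb i j; rewrite (ord1 i) !mxE => hb.
  have /ball_sym hq := qb j.
  apply: le_ball (ball_triangle hq hb).
  by rewrite [leRHS](splitr e) lerD// ltW.
apply: countable_bigcupT_measurable => // p.
case: ifPn => // _; apply: fin_bigcap_measurable; first exact: finite_finset.
move=> i _; rewrite -[X in measurable X]setTI.
by apply: (mf i measurableT); exact: measurable_ball.
Qed.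

Context d (T : measurableType d).
Implicit Types (f g : T -> E).
Local Notation rmeas f := (forall i, measurable_fun setT (fun t : T => f t 0 i)).

Lemma rmeasD f g : rmeas f -> rmeas g -> rmeas (fun t => f t + g t).
Proof.
move=> mf mg i; under eq_fun do rewrite mxE.
exact: measurable_funD.
Qed.

Lemma rmeasB f g : rmeas f -> rmeas g -> rmeas (fun t => f t - g t).
Proof.
move=> mf mg i; under eq_fun do rewrite !mxE.
exact: measurable_funB.
Qed.

Lemma rmeasZ (h : T -> R) f : measurable_fun setT h -> rmeas f ->
  rmeas (fun t => h t *: f t).
Proof.
move=> mh mf i; under eq_fun do rewrite !mxE.
exact: measurable_funM.
Qed.

Lemma rmeas_cst (c : E) : rmeas ((fun=> c) : T -> E).
Proof. by move=> i; exact: measurable_cst. Qed.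

Lemma measurable_dotp f g : rmeas f -> rmeas g ->
  measurable_fun setT (fun t => dotp (f t) (g t)).
Proof.
by move=> mf mg; apply: measurable_sum => i; exact: measurable_funM.
Qed.

Lemma measurable_enorm f : rmeas f -> measurable_fun setT (fun t => enorm (f t)).
Proof.
move=> mf; apply: (measurableT_comp (f := @Num.sqrt R)).
  by apply: continuous_measurable_fun; exact: sqrt_continuous.
exact: measurable_dotp.
Qed.

Lemma rmeas_ite (Q : set T) f g : measurable Q -> rmeas f -> rmeas g ->
  rmeas (fun t => if t \in Q then f t else g t).
Proof.
move=> mQ mf mg i.
rewrite (_ : (fun t => _) = fun t => if t \in Q then f t 0 i else g t 0 i); last first.
  by apply/funext => t; case: ifP.
apply: measurable_fun_ifT => //.
apply: (measurable_fun_bool true); rewrite setTI.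
by rewrite (_ : _ @^-1` _ = Q)//; apply/seteqP; split => t /= => [/set_mem|/mem_set].
Qed.

Lemma rmeas_cvg (f : nat -> T -> E) (g : T -> E) : (forall n, rmeas (f n)) ->
  (forall t, f ^~ t @ \oo --> g t) -> rmeas g.
Proof.
move=> mf fg i; apply: (measurable_fun_cvg (fun n => mf n i)) => t _.
exact: (cvg_rowP _ _).1 (fg t) i.
Qed.

End RowMeasurability.
Notation rmeas f := (forall i, measurable_fun setT (fun t => f t 0 i)).

Section SquareIntegrable.
Context d (T : measurableType d) (R : realType) (mu : probability T R) (N : nat).
Local Notation E := 'rV[R]_N.
Implicit Types (f g : T -> E).

Definition sqint f := rmeas f /\ intg mu (fun t => dotp (f t) (f t)).

Lemma sqint_le f (h : T -> R) : rmeas f -> intg mu h ->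
  (forall t, dotp (f t) (f t) <= h t) -> sqint f.
Proof.
move=> mf ih fh; split=> //; apply: intg_le ih _; first exact: measurable_dotp.
by move=> t; rewrite ger0_norm// dotp_ge0.
Qed.

Lemma sqintD f g : sqint f -> sqint g -> sqint (fun t => f t + g t).
Proof.
move=> [mf f2] [mg g2]; apply: sqint_le (intgZ 2 (intgD f2 g2)) _.
  exact: rmeasD.
by move=> t; exact: dotp_sqrD.
Qed.

Lemma sqintZ f c : sqint f -> sqint (fun t => c *: f t).
Proof.
move=> [mf f2]; apply: sqint_le (intgZ (c ^+ 2) f2) _.
  by apply: rmeasZ => //; exact: measurable_cst.
by move=> t; rewrite dotpZl dotpZr mulrA.
Qed.

Lemma sqintB f g : sqint f -> sqint g -> sqint (fun t => f t - g t).
Proof.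
move=> [mf f2] [mg g2]; apply: sqint_le (intgZ 2 (intgD f2 g2)) _.
  exact: rmeasB.
by move=> t; exact: dotp_sqrB.
Qed.

Lemma sqint_cst (c : E) : sqint (fun=> c).
Proof. by split; [exact: rmeas_cst|exact: intg_cst]. Qed.

Lemma intg_enorm f : sqint f -> intg mu (fun t => enorm (f t)).
Proof.
move=> [mf f2]; apply: intg_le (intgD f2 (intg_cst mu 1)) _.
  exact: measurable_enorm.
move=> t; rewrite ger0_norm ?enorm_ge0// -sqr_enorm.
by have := enorm_ge0 (f t); nra.
Qed.

Lemma sqint_coord f i : sqint f -> intg mu (fun t => f t 0 i).
Proof.
move=> f2; apply: intg_le (intg_enorm f2) _; first by case: f2.
by move=> t; exact: normr_coord_le.
Qed.

Lemma sqint_coord2 f i : sqint f -> intg mu (fun t => f t 0 i ^+ 2).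
Proof.
move=> [mf f2]; apply: intg_le f2 _; first exact: measurable_funX.
by move=> t; rewrite ger0_norm ?sqr_ge0// sqr_coord_le.
Qed.

Lemma Rint_sqr_ge0 f : 0 <= \int[mu]_t dotp (f t) (f t).
Proof. by apply: Rintegral_ge0 => t _; exact: dotp_ge0. Qed.

Lemma parallelogram f g : sqint f -> sqint g ->
  \int[mu]_t dotp (f t - g t) (f t - g t) =
  2 * \int[mu]_t dotp (f t) (f t) + 2 * \int[mu]_t dotp (g t) (g t)
  - 4 * \int[mu]_t dotp (2^-1 *: (f t + g t)) (2^-1 *: (f t + g t)).
Proof.
move=> f2 g2; have [_ fi] := f2; have [_ gi] := g2.
have [_ hi] := sqintZ 2^-1 (sqintD f2 g2).
rewrite -!RintZ// -RintD ?intgZ// -RintB ?intgZ//; last first.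
  by apply: intgD; exact: intgZ.
apply: eq_Rintegral => t _; rewrite !dotpE (dotpC (g t) (f t)).
by field.
Qed.

(** Integrates [|f| <= |f|^2 / (2 c) + c / 2], which replaces the Cauchy-Schwarz inequality. *)
Lemma Rint_enorm_le f (c : R) : sqint f -> 0 < c ->
  \int[mu]_t dotp (f t) (f t) <= c ^+ 2 -> \int[mu]_t enorm (f t) <= c.
Proof.
move=> f2 c0 fc; have [_ fi] := f2.
have H : \int[mu]_t enorm (f t) <=
    \int[mu]_t ((2 * c)^-1 * dotp (f t) (f t) + c / 2).
  apply: Rint_le; first exact: intg_enorm.
    by apply: intgD; [exact: intgZ|exact: intg_cst].
  move=> t; rewrite -sqr_enorm -subr_ge0.
  have -> : (2 * c)^-1 * enorm (f t) ^+ 2 + c / 2 - enorm (f t) =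
      (2 * c)^-1 * (enorm (f t) - c) ^+ 2 by field; rewrite gt_eqF.
  by rewrite mulr_ge0 ?sqr_ge0// invr_ge0 mulr_ge0// ltW.
apply: le_trans H _.
rewrite (RintD (intgZ _ fi) (intg_cst mu _)) RintZ// Rint_cst.
have cE : (2 * c)^-1 * c ^+ 2 + c / 2 = c by field; rewrite gt_eqF.
rewrite -[leRHS]cE lerD2r; apply: ler_wpM2l => //.
by rewrite invr_ge0 mulr_ge0// ltW.
Qed.

Lemma fatou_Rint (f_ : nat -> T -> R) (f : T -> R) (K : R) :
  (forall n, intg mu (f_ n)) -> (forall n t, 0 <= f_ n t) ->
  (forall t, f_ ^~ t @ \oo --> f t) -> (forall n, \int[mu]_t f_ n t <= K) ->
  intg mu f /\ \int[mu]_t f t <= K.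
Proof.
move=> if_ f_0 ff fK.
have f0 t : 0 <= f t by apply: (cvgr_to_ge (ff t)); apply: nearW.
have mf : measurable_fun setT f.
  by apply: (measurable_fun_cvg (fun n => intg_measurable (if_ n))) => t _; exact: ff.
have bnd : (\int[mu]_t (f t)%:E <= K%:E)%E.
  have -> : (\int[mu]_t (f t)%:E = \int[mu]_t limn_einf (fun n => (f_ n t)%:E))%E.
    apply: eq_integral => t _.
    have ct : (f_ n t)%:E @[n --> \oo] --> (f t)%:E.
      by apply: cvg_EFin; [exact: nearW|exact: ff].
    by rewrite is_cvg_limn_einfE; [exact/esym/cvg_lim|apply/cvg_ex; exists (f t)%:E].
  apply: le_trans (fatou mu measurableT _ _) _ => //.
  - by move=> n; exact: measurable_int (if_ n).
  - by move=> n t _; rewrite lee_fin.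
  rewrite limn_einf_lim; apply: lime_le; first exact: is_cvg_einfs.
  apply: nearW => n; rewrite /einfs /=.
  apply: le_trans (ereal_inf_lbound _) _; first by exists n => /=.
  by rewrite intg_fin// lee_fin.
have fi : intg mu f by apply: intg_ge0P => //; rewrite (le_lt_trans bnd)// ltry.
by split=> //; move: bnd; rewrite intg_fin// lee_fin.
Qed.

End SquareIntegrable.

(** * Strong limits in nested convex subsets of L^2 *)

Section NestedConvexSets.
Context d (T : measurableType d) (R : realType) (mu : probability T R) (N : nat).
Local Notation E := 'rV[R]_N.
Implicit Types (f g : T -> E).
Local Notation Q f := (\int[mu]_t dotp (f t) (f t)).

(** As in the completeness proof of [L^2]: the increments have [L^1] norm at most [2^-(k+1)], so the
    sum [S] of their norms is integrable. It is finite almost everywhere, which gives the pointwise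
    limit, and [|f 0| + S] dominates the sequence, which gives the limit of the integrals. *)
Lemma sqint_fast_cauchy (f : nat -> T -> E) (K : R) :
  (forall n, sqint mu (f n)) -> (forall n, Q (f n) <= K) ->
  (forall k, Q (fun t => f k.+1 t - f k t) <= (1 / (2 ^ k.+1)%:R) ^+ 2) ->
  exists g, [/\ sqint mu g, {ae mu, forall t, f ^~ t @ \oo --> g t} &
    forall i, \int[mu]_t f k t 0 i @[k --> \oo] --> \int[mu]_t g t 0 i].
Proof.
move=> f2 fK fQ.
pose h k t := enorm (f k.+1 t - f k t).
have h0 k t : 0 <= h k t := enorm_ge0 _.
have mf k : rmeas (f k) by case: (f2 k).
have mh k : measurable_fun setT (h k) by apply: measurable_enorm; exact: rmeasB.
have ih k : intg mu (h k) by apply: intg_enorm; exact: sqintB.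
pose S t : \bar R := (\sum_(k <oo) (h k t)%:E)%E.
have mS : measurable_fun setT S.
  by apply: ge0_emeasurable_sum => [k t _ _|k _]; [rewrite lee_fin|exact/measurable_EFinP].
have S0 t : (0 <= S t)%E by apply: nneseries_ge0 => k _ _; rewrite lee_fin.
have iS : mu.-integrable setT S.
  apply/integrableP; split=> //.
  under eq_integral do rewrite gee0_abs//.
  rewrite integral_nneseries//; last 2 first.
  - by move=> k; exact/measurable_EFinP.
  - by move=> k t _; rewrite lee_fin.
  apply: (@le_lt_trans _ _ 1%:E); last exact: ltry.
  apply: le_trans (epsilon_trick0 xpredT ler01); apply: lee_nneseries.
    by move=> k _ _; apply: integral_ge0 => t _; rewrite lee_fin.
  move=> k _; rewrite intg_fin// lee_fin; apply: Rint_enorm_le; last exact: fQ.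
    exact: sqintB.
  by apply: divr_gt0 => //; rewrite ltr0n expn_gt0.
pose G := [set t | (S t < +oo)%E].
have mG : measurable G.
  by rewrite -[G]setTI; exact: emeasurable_fun_infty_o.
have aeG : {ae mu, forall t, G t}.
  apply: filterS (integrable_ae measurableT iS) => t /(_ I).
  by rewrite ge0_fin_numE.
have partial t n : G t -> \sum_(0 <= k < n) h k t <= fine (S t).
  move=> Gt; rewrite -lee_fin fineK ?ge0_fin_numE// -sumEFin.
  by apply: nneseries_lim_ge => k _ _; rewrite lee_fin.
have fE t n i : f n t 0 i = f 0%N t 0 i + \sum_(0 <= k < n) (f k.+1 t - f k t) 0 i.
  under eq_bigr do rewrite !mxE.
  by rewrite telescope_sumr// addrC subrK.
have cf t i : G t -> cvgn (fun n => f n t 0 i).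
  move=> Gt.
  have cs : cvgn (series (fun k => (f k.+1 t - f k t) 0 i)).
    apply: normed_cvg; apply: nondecreasing_is_cvgn.
      move=> m n mn.
      apply: (@nondecreasing_series R (fun k => `|(f k.+1 t - f k t) 0 i|)
        xpredT 0%N) => // k _ _; exact: normr_ge0.
    exists (fine (S t)) => _ [n _ <-].
    apply: le_trans (partial t n Gt); apply: ler_sum => k _.
    exact: normr_coord_le.
  have -> : (fun n => f n t 0 i) =
      (fun n => f 0%N t 0 i + series (fun k => (f k.+1 t - f k t) 0 i) n).
    by apply/funext => n; rewrite fE.
  by apply: is_cvgD => //; exact: is_cvg_cst.
(* Cutting off to 0 where [S] is infinite makes the sequence converge everywhere, so that its limit
   is measurable. *)
pose f' k t := if t \in G then f k t else 0.
pose g t : E := \row_i lim (f' k t 0 i @[k --> \oo]).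
have mf' k : rmeas (f' k) by apply: rmeas_ite => //; exact: rmeas_cst.
have f'g t : f' ^~ t @ \oo --> g t.
  apply/cvg_rowP => i; rewrite mxE /f'; have := @cf t i; rewrite -in_setE.
  by case: (t \in G) => [H|_]; [exact: H|rewrite lim_cst//; exact: cvg_cst].
have mg : rmeas g := rmeas_cvg mf' f'g.
have fg : {ae mu, forall t, f ^~ t @ \oo --> g t}.
  by apply: filterS aeG => t Gt; have := f'g t; rewrite /f' mem_set.
have f'f k t : dotp (f' k t) (f' k t) <= dotp (f k t) (f k t).
  by rewrite /f'; case: ifP => // _; rewrite dotp0l dotp_ge0.
have f'2 k : sqint mu (f' k).
  by apply: sqint_le (f'f k) => //; case: (f2 k).
exists g; split => //.
  split => //; have [] := @fatou_Rint _ _ _ mu (fun k t => dotp (f' k t) (f' k t))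
      (fun t => dotp (g t) (g t)) K _ _ _ _ => //.
  - by move=> k; case: (f'2 k).
  - by move=> k t; exact: dotp_ge0.
  - by move=> t; exact: cvg_dotp.
  - by move=> k; apply: le_trans (fK k); apply: Rint_le => //; [case: (f'2 k)|case: (f2 k)].
move=> i.
have ibnd : intg mu (fun t => enorm (f 0%N t) + fine (S t)).
  apply: intgD; first exact: intg_enorm.
  apply: le_integrable iS => //.
    by apply/measurable_EFinP; exact: (measurableT_comp (fine_measurable measurableT)).
  by move=> t _ /=; have := S0 t; case: (S t) => [r||] //= _; rewrite ?normr0 ?leey.
have [] := @dominated_cvg_Rint _ _ _ mu (fun k t => f k t 0 i) (fun t => g t 0 i) _
   _ _ ibnd _ _ => //.
- by apply: filterS fg => t /cvg_rowP; exact.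
- apply: filterS aeG => t Gt n; rewrite fE (le_trans (ler_normD _ _))// lerD//.
    exact: normr_coord_le.
  apply: le_trans (ler_norm_sum _ _ _) _; apply: le_trans (partial t n Gt).
  by apply: ler_sum => k _; exact: normr_coord_le.
Qed.

(* Nearly minimal-norm elements of nested midpoint-convex sets form a Cauchy
   sequence by the parallelogram identity. *)
Lemma nested_sqint_limit (C : nat -> set (T -> E)) (K : R) :
  (forall n, C n.+1 `<=` C n) -> (forall n f, C n f -> sqint mu f) ->
  (forall n f g, C n f -> C n g -> C n (fun t => 2^-1 *: (f t + g t))) ->
  (forall n, exists2 f, C n f & Q f <= K) ->
  exists (f : nat -> T -> E) g, [/\ forall k, C k (f k), sqint mu g,
    {ae mu, forall t, f ^~ t @ \oo --> g t} &
    forall i, \int[mu]_t f k t 0 i @[k --> \oo] --> \int[mu]_t g t 0 i].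
Proof.
move=> Cdec C2 Cmid CK.
have Cle m n : (m <= n)%N -> C n `<=` C m.
  move=> /subnK <-; elim: (n - m)%N => [|k IH]; first by rewrite add0n.
  by rewrite addSn => f /Cdec; exact: IH.
pose S n := [set Q f | f in C n].
have S0 n : has_inf (S n).
  split; first by have [f Cf _] := CK n; exists (Q f), f.
  by exists 0 => _ [f _ <-]; exact: Rint_sqr_ge0.
pose c n := inf (S n).
have cQ n f : C n f -> c n <= Q f.
  by move=> Cf; apply: ge_inf; [case: (S0 n)|exists f].
have cle m n : (m <= n)%N -> c m <= c n.
  move=> mn; apply: lb_le_inf; first by case: (S0 n).
  by move=> _ [f Cf <-]; apply: cQ; exact: Cle Cf.
have cK n : c n <= K by have [f Cf fK] := CK n; exact: le_trans (cQ n f Cf) fK.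
have cc : cvgn c.
  apply: nondecreasing_is_cvgn => [m n|]; first exact: cle.
  by exists K => _ [n _ <-].
pose cl := limn c.
have ccl n : c n <= cl by apply: nondecreasing_cvgn_le => // a b; exact: cle.
have /choice[f fP] n : exists f, C n f /\ Q f <= c n + harmonic n.
  have n0 : 0 < harmonic n :> R by rewrite invr_gt0.
  have [_ [f Cf <-] fc] := inf_adherent n0 (S0 n).
  by exists f; split => //; exact: ltW.
have f2 n : sqint mu (f n) by apply: (C2 n); case: (fP n).
(* For [m <= n] the midpoint of [f n] and [f m] lies in [C m], so its squared norm is at least
   [c m]; the parallelogram identity then bounds the squared distance by [e m]. *)
pose e n := 2 * (cl - c n) + 4 * harmonic n.
have fe m n : (m <= n)%N -> Q (fun t => f n t - f m t) <= e m.
  move=> mn; have [Cm Qm] := fP m; have [Cn Qn] := fP n.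
  rewrite parallelogram//.
  have := cQ m _ (Cmid _ _ _ (Cle _ _ mn _ Cn) Cm).
  have := ccl n.
  have : harmonic n <= harmonic m :> R by rewrite lef_pV2 ?posrE// ler_nat.
  by rewrite /e; lra.
have e0 : e @ \oo --> 0.
  have -> : 0 = 2 * (cl - cl) + 4 * 0 :> R by rewrite subrr !mulr0 addr0.
  apply: cvgD; apply: cvgM; try exact: cvg_cst.
    by apply: cvgB; [exact: cvg_cst|exact: cc].
  exact: cvg_harmonic.
have /choice[s sP] k : exists n, forall m, (n <= m)%N -> e m <= (1 / (2 ^ k.+1)%:R) ^+ 2.
  have p0 : 0 < (1 / (2 ^ k.+1)%:R) ^+ 2 :> R.
    by apply: exprn_gt0; apply: divr_gt0 => //; rewrite ltr0n expn_gt0.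
  have /cvgrPdist_le/(_ _ p0)[n _ nP] := e0.
  exists n => m nm; have := nP m nm; rewrite sub0r normrN.
  by apply: le_trans; exact: ler_norm.
(* Summing the thresholds makes [r] nondecreasing and at least both [s k] and [k]. *)
pose r k := (k + \sum_(j < k.+1) s j)%N.
have rS k : (r k <= r k.+1)%N.
  by rewrite /r; apply: leq_add => //; rewrite [leqRHS]big_ord_recr leq_addr.
have sr k : (s k <= r k)%N by rewrite /r big_ord_recr/= addnA leq_addl.
have kr k : (k <= r k)%N by exact: leq_addr.
have [|||g [g2 fg ig]] := @sqint_fast_cauchy (fun k => f (r k)) (K + 1).
- by move=> k.
- move=> k; have [_ H] := fP (r k); apply: le_trans H _.
  by apply: lerD => //; rewrite invf_le1// ler1n.
- by move=> k; apply: le_trans (fe _ _ (rS k)) _; exact: sP.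
exists (fun k => f (r k)), g; split => // k.
by apply: (Cle _ _ (kr k)); case: (fP (r k)).
Qed.

End NestedConvexSets.

(** * Selections and mean operators *)

Section RandomOperators.
Context d (Xi : measurableType d) (R : realType) (mu : probability Xi R) (N : nat).
Local Notation E := 'rV[R]_N.

(** The [i]-th coordinate of the resolvent is at least [c] exactly when the graph of [A xi] meets
    the closed set [H] of pairs with [a + g *: v = x] and [c <= a 0 i]. *)
Lemma measurable_resolvent (A : Xi -> operator R N) (g : R) (x : E) :
  random_maximal_monotone A -> 0 < g ->
  rmeas (fun xi => resolvent g (A xi) x).
Proof.
move=> [mA measA] g0 i.
apply: (measurability _ (RGenCInfty.measurableE R)).
move=> /= _ [_ [c ->]] <-; rewrite setTI.
pose H : set (E * E) := [set p | p.1 + g *: p.2 = x /\ c <= p.1 0 i].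
have c1 j : continuous (fun p : E * E => p.1 0 j).
  move=> z; apply: (@continuous_comp _ _ _ fst (fun v : E => v 0 j)).
    exact: cvg_fst.
  exact: coord_continuous.
have c2 j : continuous (fun p : E * E => p.2 0 j).
  move=> z; apply: (@continuous_comp _ _ _ snd (fun v : E => v 0 j)).
    exact: cvg_snd.
  exact: coord_continuous.
have clH : closed H.
  have -> : H = (\bigcap_j [set p : E * E | p.1 0 j + g * p.2 0 j = x 0 j]) `&`
      [set p : E * E | c <= p.1 0 i].
    apply/seteqP; split=> p [H1 H2]; split => //.
      by move=> j _ /=; rewrite -H1 !mxE.
    by apply/rowP => j; rewrite !mxE; exact: H1.
  apply: closedI.
    apply: closed_bigI => j _.
    apply: (@preimage_closed _ _ (fun p : E * E => p.1 0 j + g * p.2 0 j) [set x 0 j]).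
      move=> z _; apply: cvgD; first exact: c1.
      by apply: cvgM; [exact: cvg_cst|exact: c2].
    exact: closed_eq.
  apply: (@preimage_closed _ _ (fun p : E * E => p.1 0 i) [set t | c <= t]).
    by move=> z _; exact: c1.
  exact: closed_ge.
have : <<s @open (E * E)%type >> H.
  have : @measurable _ (g_sigma_algebraType (@open (E * E)%type)) (~` H).
    by apply: sub_sigma_algebra; exact: closed_openC.
  by move=> /measurableC; rewrite setCK.
move=> /measA; congr measurable; apply/seteqP; split=> xi.
  move=> [[z y] [/= Azy [zy cz]]]; rewrite /= in_itv/= andbT.
  rewrite (@resolvent_unique _ _ _ _ _ z)// -zy addrAC subrr add0r.
  by rewrite scalerA mulVf ?gt_eqF// scale1r.
rewrite /= in_itv/= andbT => cJ.
exists (resolvent g (A xi) x, g^-1 *: (x - resolvent g (A xi) x)).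
split; first exact: resolventP.
split => //=; rewrite scalerA mulfV ?gt_eqF// scale1r addrC subrK//.
Qed.

(** Stands in for the closedness of the graph under weak [L^2] convergence of the values. The values
    [psi n] belong to [A xi] at moving points [xs n xi]; moving the base point to [x] costs at most
    [r n * G * (G + |v|)] in the monotonicity inequality against [(a, v)], and the corrected
    inequality is affine in the value. *)
Lemma random_maximal_monotone_limit (A : Xi -> operator R N) (x : E)
    (xs psi : nat -> Xi -> E) (G : Xi -> R) (r : nat -> R) (K : R) :
  (forall xi, maximal_monotone (A xi)) ->
  (forall n, sqint mu (psi n)) ->
  (forall n, \int[mu]_xi dotp (psi n xi) (psi n xi) <= K) ->
  r @ \oo --> 0 ->
  {ae mu, forall xi n, [/\ A xi (xs n xi) (psi n xi), enorm (psi n xi) <= G xi &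
    enorm (xs n xi - x) <= r n * G xi]} ->
  exists g, [/\ sqint mu g, {ae mu, forall xi, A xi x (g xi)} &
    forall i (w : R), \int[mu]_xi psi n xi 0 i @[n --> \oo] --> w ->
      \int[mu]_xi g xi 0 i = w].
Proof.
move=> mA psi2 psiK r0 aeH.
(* Convex constraints met by every [psi k] with [n <= k]: the integrals are as close to any [w] as
   those of the tail are, and monotonicity at [x] holds up to the error above. *)
pose C n : set (Xi -> E) := [set f | [/\ sqint mu f,
  forall i (w c : R), (forall k, (n <= k)%N -> `|\int[mu]_xi psi k xi 0 i - w| <= c) ->
     `|\int[mu]_xi f xi 0 i - w| <= c &
  forall c, (forall k, (n <= k)%N -> r k <= c) ->
     {ae mu, forall xi a v, A xi a v ->
       - (c * G xi * (G xi + enorm v)) <= dotp (f xi - v) (x - a)}]].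
have [||||f [g [fC g2 fg ig]]] := @nested_sqint_limit _ _ _ mu N C K.
- move=> n f [f2 fi fm]; split=> // [i w c H|c H].
    by apply: fi => k nk; apply: H; exact: ltnW.
  by apply: fm => k nk; apply: H; exact: ltnW.
- by move=> n f [].
- move=> n f g [f2 fi fm] [g2 gi gm]; split.
  + exact: sqintZ (sqintD f2 g2).
  + move=> i w c H; have := fi i w c H; have := gi i w c H.
    rewrite !ler_norml => /andP[h1 h2] /andP[h3 h4].
    have -> : \int[mu]_xi (2^-1 *: (f xi + g xi)) 0 i =
        2^-1 * (\int[mu]_xi f xi 0 i + \int[mu]_xi g xi 0 i).
      have fi' := sqint_coord i f2; have gi' := sqint_coord i g2.
      rewrite -(RintD fi' gi') -(RintZ _ (intgD fi' gi')).
      by apply: eq_Rintegral => t _; rewrite !mxE.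
    by apply/andP; split; lra.
  + move=> c H; have aef := fm c H; have aeg := gm c H.
    near=> xi => a v Av.
    have h1 : - (c * G xi * (G xi + enorm v)) <= dotp (f xi - v) (x - a).
      by move: a v Av; near: xi.
    have h2 : - (c * G xi * (G xi + enorm v)) <= dotp (g xi - v) (x - a).
      by move: a v Av {h1}; near: xi.
    have -> : 2^-1 *: (f xi + g xi) - v = 2^-1 *: ((f xi - v) + (g xi - v)).
      by apply/rowP => j; rewrite !mxE; field.
    by rewrite dotpZl dotpDl; lra.
- move=> n; exists (psi n) => //; split => //.
    by move=> i w c; exact.
  move=> c H; apply: filterS aeH => xi /(_ n)[Apsi psiG xG] a v Av.
  have G0 : 0 <= G xi by exact: le_trans (enorm_ge0 _) psiG.
  have -> : x - a = (xs n xi - a) - (xs n xi - x) by apply/rowP => j; rewrite !mxE; ring.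
  rewrite dotpBr.
  have h1 := monotone_le (maximal_monotone_mon (mA xi)) Apsi Av.
  have h2 : dotp (psi n xi - v) (xs n xi - x) <= c * G xi * (G xi + enorm v).
    apply: le_trans (dotp_le_enorm _ _) _; rewrite mulrC.
    apply: ler_pM; rewrite ?enorm_ge0//.
      by apply: le_trans xG _; rewrite ler_wpM2r// H.
    by rewrite (le_trans (enormD _ _))// enormN lerD2r.
  lra.
exists g; split=> //; last first.
  move=> i w psiw; apply: (cvg_unique _ (ig i)); first exact: Rhausdorff.
  apply/cvgrPdist_le => e e0.
  have /cvgrPdist_le/(_ e e0)[n _ nP] := psiw.
  exists n => // k /= nk; rewrite distrC; have [_ fi _] := fC k.
  by apply: fi => m km; rewrite distrC; apply: nP; exact: leq_trans km.
have /choice[m mP] j : exists m, forall k, (m <= k)%N -> r k <= harmonic j.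
  have j0 : 0 < harmonic j :> R by rewrite invr_gt0.
  have /cvgrPdist_le/(_ _ j0)[n _ nP] := r0.
  exists n => k nk; have := nP k nk; rewrite sub0r normrN.
  by apply: le_trans; exact: ler_norm.
(* Restricting to the error levels [1 / (j + 1)], valid from index [m j] on, leaves countably many
   null sets. *)
have aek : {ae mu, forall xi j k, (m j <= k)%N -> forall a v, A xi a v ->
    - (harmonic j * G xi * (G xi + enorm v)) <= dotp (f k xi - v) (x - a)}.
  apply: ae_foralln => j; apply: ae_foralln => k.
  have [mk|km] := leqP (m j) k; last by apply: aeW => xi; rewrite ?leqNgt ?km.
  have [_ _ /(_ (harmonic j))] := fC k.
  have hH l : (k <= l)%N -> r l <= harmonic j by move=> kl; apply: mP; exact: leq_trans kl.
  by move=> /(_ hH); apply: filterS => xi H _.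
near=> xi.
have fgx : f ^~ xi @ \oo --> g xi by near: xi.
have H : forall j k, (m j <= k)%N -> forall a v, A xi a v ->
    - (harmonic j * G xi * (G xi + enorm v)) <= dotp (f k xi - v) (x - a).
  by near: xi.
apply: maximal_monotone_mem => // a v Av.
have lim1 : dotp (f k xi - v) (x - a) @[k --> \oo] --> dotp (g xi - v) (x - a).
  apply: cvg_dotp; last exact: cvg_cst.
  by apply: cvgB => //; exact: cvg_cst.
have lim2 : - (harmonic j * G xi * (G xi + enorm v)) @[j --> \oo] --> - (0 * G xi * (G xi + enorm v)).
  apply: cvgN; apply: cvgM; last exact: cvg_cst.
  by apply: cvgM; [exact: cvg_harmonic|exact: cvg_cst].
rewrite !mul0r oppr0 in lim2.
apply: (cvgr_to_le lim2); apply: nearW => j.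
apply: (cvgr_to_ge lim1); exists (m j) => // k /= jk.
exact: H.
Unshelve. all: by end_near. Qed.

End RandomOperators.

Section Selections.
Context d (Xi : measurableType d) (R : realType) (mu : probability Xi R) (N : nat).
Local Notation E := 'rV[R]_N.
Implicit Types (phi psi : Xi -> E).

Lemma intg_ae_le (f g : Xi -> R) : measurable_fun setT f -> intg mu g ->
  {ae mu, forall t, `|f t| <= g t} ->
  intg mu f /\ \int[mu]_t `|f t| <= \int[mu]_t g t.
Proof.
move=> mf ig fg.
have mg := intg_measurable ig.
have ig' := intg_norm ig.
have H : (\int[mu]_t (`|f t|)%:E <= \int[mu]_t (`|g t|)%:E)%E.
  apply: ae_ge0_le_integral => //.
  - by apply/measurable_EFinP; exact: measurableT_comp.
  - by apply/measurable_EFinP; exact: measurableT_comp.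
  - by apply: filterS fg => t h _; rewrite lee_fin; exact: le_trans h (ler_norm _).
have fi : intg mu f.
  apply/integrableP; split; first exact/measurable_EFinP.
  by apply: (le_lt_trans H); rewrite intg_fin// ltry.
split=> //; have gE : \int[mu]_t `|g t| = \int[mu]_t g t.
  apply: Rint_ae => //; apply: filterS fg => t h; rewrite ger0_norm//.
  exact: le_trans h.
have ifn := intg_norm fi.
by rewrite -gE -lee_fin -intg_fin// -(intg_fin ig').
Qed.

Lemma vLq1P phi : vLq mu 1 phi -> rmeas phi /\ intg mu (fun xi => enorm (phi xi)).
Proof.
move=> [/measurable_rowP mphi phi1]; split=> //; apply: intg_ge0P.
- exact: measurable_enorm.
- by move=> xi; exact: enorm_ge0.
- apply: le_lt_trans phi1; rewrite le_eqVlt; apply/orP; left; apply/eqP.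
  by apply: eq_integral => xi _; rewrite powRr1 ?enorm_ge0.
Qed.

Lemma vLq2_sqint phi : vLq mu 2 phi -> sqint mu phi.
Proof.
move=> [/measurable_rowP mphi phi1]; split=> //; apply: intg_ge0P.
- exact: measurable_dotp.
- by move=> xi; exact: dotp_ge0.
- apply: le_lt_trans phi1; rewrite le_eqVlt; apply/orP; left; apply/eqP.
  by apply: eq_integral => xi _; rewrite powR_mulrn ?enorm_ge0// sqr_enorm.
Qed.

Lemma sqint_vLq1 phi : sqint mu phi -> vLq mu 1 phi.
Proof.
move=> phi2; split; first by apply/measurable_rowP; case: phi2.
under eq_integral do rewrite powRr1 ?enorm_ge0//.
by rewrite intg_fin ?ltry//; exact: intg_enorm.
Qed.

Lemma sqint_ae_le phi (G : Xi -> R) : rmeas phi -> intg mu (fun xi => G xi ^+ 2) ->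
  {ae mu, forall xi, enorm (phi xi) <= G xi} ->
  sqint mu phi /\
  \int[mu]_xi dotp (phi xi) (phi xi) <= \int[mu]_xi G xi ^+ 2.
Proof.
move=> mphi G2 phiG.
have [||i1 i2] := @intg_ae_le (fun xi => dotp (phi xi) (phi xi)) _ _ G2.
- exact: measurable_dotp.
- apply: filterS phiG => xi h; rewrite ger0_norm ?dotp_ge0// -sqr_enorm.
  by rewrite ler_pXn2r// ?nnegrE ?enorm_ge0// (le_trans (enorm_ge0 _) h).
split=> //; apply: le_trans i2; rewrite le_eqVlt; apply/orP; left; apply/eqP.
by apply: eq_Rintegral => xi _; rewrite ger0_norm// dotp_ge0.
Qed.

Lemma vintegralE phi i : vintegral mu phi 0 i = \int[mu]_xi phi xi 0 i.
Proof. by rewrite mxE. Qed.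

Lemma eproj_id (S : set E) x : S x -> eproj S x = x.
Proof.
move=> Sx; have [_ /(_ x Sx)] : is_eproj S x (eproj S x).
  apply: (@getPex _ (is_eproj S x)); exists x; split=> // z _.
  by rewrite le_enorm subrr dotp0l dotp_ge0.
by rewrite le_enorm subrr dotp0l => /dotp_eq0/eqP; rewrite subr_eq0 => /eqP.
Qed.

(* The Yosida approximations [(x - J_g x) / g] are dominated pointwise by any
   selection and bounded in [L^4] by the resolvent estimate. *)
Lemma sqint_selection (A : Xi -> operator R N) (x : E) (C : R) :
  measure_is_complete mu -> random_maximal_monotone A ->
  setfun_integrable mu (fun xi => A xi x) ->
  (forall g : R, 0 < g -> ((g ^- 4)%:E * \int[mu]_xi
     (enorm (resolvent g (A xi) x - eproj (closure (opdom (A xi))) x) ^+ 4)%:E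
     <= C%:E)%E) ->
  exists2 phi, sqint mu phi & {ae mu, forall xi, A xi x (phi xi)}.
Proof.
move=> muC hA [phi [/vLq1P[mphi phi1] Aphi]] HC; have [mA _] := hA.
pose J n xi := resolvent (harmonic n) (A xi) x.
have h0 n : 0 < harmonic n :> R by rewrite invr_gt0.
pose psi n xi := (harmonic n)^-1 *: (x - J n xi).
have mpsi n : rmeas (psi n).
  apply: rmeasZ; first exact: measurable_cst.
  by apply: rmeasB; [exact: rmeas_cst|exact: measurable_resolvent].
have Apsi n xi : A xi (J n xi) (psi n xi) by exact: resolventP.
have Jpsi n xi : J n xi - x = - (harmonic n *: psi n xi).
  by rewrite /psi scalerA mulfV ?gt_eqF// scale1r opprB.
pose D n xi := dotp (J n xi - x) (J n xi - x) ^+ 2.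
have D0 n xi : 0 <= D n xi by rewrite sqr_ge0.
have mD n : measurable_fun setT (D n).
  apply: measurable_funX; apply: measurable_dotp.
    by apply: rmeasB; [exact: measurable_resolvent|exact: rmeas_cst].
  by apply: rmeasB; [exact: measurable_resolvent|exact: rmeas_cst].
have DC n : ((harmonic n ^- 4)%:E * \int[mu]_xi (D n xi)%:E <= C%:E)%E.
  apply: le_trans (HC _ (h0 n)); rewrite le_eqVlt; apply/orP; left; apply/eqP.
  congr (_ * _)%E.
  (* Almost surely [x] lies in the domain and is its own projection. Completeness of [mu] transfers
     measurability to the integrand of the hypothesis. *)
  have aeq : ae_eq mu setT (fun xi => (D n xi)%:E) (fun xi => (enorm
      (resolvent (harmonic n) (A xi) x - eproj (closure (opdom (A xi))) x) ^+ 4)%:E).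
    apply: filterS Aphi => xi Ax _; rewrite eproj_id; last first.
      by apply: subset_closure; exists (phi xi).
    by rewrite (exprM _ 2 2) sqr_enorm.
  have mDe : measurable_fun setT (fun xi => (D n xi)%:E) by exact/measurable_EFinP.
  apply: ae_eq_integral => //.
  exact: (ae_measurable_fun muC aeq).
have iD n : intg mu (D n).
  apply: intg_ge0P => //; rewrite ltey; apply/eqP => e.
  by have := DC n; rewrite e gt0_muley// lte_fin invr_gt0 exprn_gt0.
have DC' n : harmonic n ^- 4 * \int[mu]_xi D n xi <= C.
  by rewrite -lee_fin EFinM -intg_fin.
(* From [t <= 1 + t^2] with [t = |psi|^2]: the fourth-moment bound [C] becomes the second-moment
   bound [1 + C], uniform in [n]. *)
have dD n xi : dotp (psi n xi) (psi n xi) <= 1 + harmonic n ^- 4 * D n xi.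
  have -> : harmonic n ^- 4 * D n xi = dotp (psi n xi) (psi n xi) ^+ 2.
    rewrite /D Jpsi !dotpE opprK.
    by field; rewrite gt_eqF.
  by nra.
have psi2 n : sqint mu (psi n).
  by apply: sqint_le (dD n) => //; apply: intgD; [exact: intg_cst|exact: intgZ].
have [|||g [g2 Ag _]] := @random_maximal_monotone_limit _ Xi R mu N A x J psi
  (fun xi => enorm (phi xi)) harmonic (1 + C) mA psi2.
- move=> n; have [_ i2] := psi2 n.
  have i3 := intgZ (harmonic n ^- 4) (iD n).
  apply: le_trans (Rint_le i2 (intgD (intg_cst mu 1) i3) (dD n)) _.
  by rewrite (RintD (intg_cst mu 1) i3) Rint_cst lerD2l RintZ.
- exact: cvg_harmonic.
- apply: filterS Aphi => xi Ax n.
  have psiphi : enorm (psi n xi) <= enorm (phi xi).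
    rewrite le_enorm.
    have := monotone_le (maximal_monotone_mon (mA xi)) (Apsi n xi) Ax.
    rewrite Jpsi dotpNr dotpZr -mulrN pmulr_rge0// dotpBl.
    by have := dotp_young (phi xi) (psi n xi); lra.
  split=> //; rewrite Jpsi enormN enormZ gtr0_norm//.
  by apply: ler_wpM2l => //; exact: ltW.
by exists g.
Qed.

(** [f n] equals [phi] where [|phi| <= n] and [g] elsewhere: still a selection, now
    square-integrable, and dominated by [|phi| + |g|]. *)
Lemma truncated_selection (A : Xi -> operator R N) (x : E) phi g :
  selections mu 1 (fun xi => A xi x) phi ->
  sqint mu g -> {ae mu, forall xi, A xi x (g xi)} ->
  exists f : nat -> Xi -> E, [/\ forall n, sqint mu (f n),
    forall n, {ae mu, forall xi, A xi x (f n xi)} &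
    vintegral mu (f n) @[n --> \oo] --> vintegral mu phi].
Proof.
move=> [/vLq1P[mphi phi1] Aphi] g2 Ag; have [mg ig2] := g2.
pose Q n := [set xi | enorm (phi xi) <= n%:R].
have mQ n : measurable (Q n).
  rewrite -[Q n]setTI.
  have -> : Q n = [set xi | ((enorm (phi xi))%:E <= n%:R%:E)%E].
    by apply/seteqP; split => xi; rewrite /Q /= lee_fin.
  apply: emeasurable_fun_infty_c => //.
  by apply/measurable_EFinP; exact: measurable_enorm.
pose f n xi := if xi \in Q n then phi xi else g xi.
have mf n : rmeas (f n) by exact: rmeas_ite.
exists f; split.
- move=> n; apply: (@sqint_le _ _ _ _ _ _ (fun xi => n%:R ^+ 2 + dotp (g xi) (g xi))) => //.
    by apply: intgD => //; exact: intg_cst.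
  move=> xi; rewrite /f; case: ifPn => [/set_mem Qx|_].
    rewrite -[leLHS]addr0 lerD ?dotp_ge0// -sqr_enorm.
    by rewrite ler_pXn2r// ?nnegrE ?enorm_ge0.
  by rewrite lerDr sqr_ge0.
- move=> n; apply: filterS2 Aphi Ag => xi A1 A2.
  by rewrite /f; case: ifP.
- apply/cvg_rowP => i; rewrite vintegralE.
  under eq_fun do rewrite vintegralE.
  have ib : intg mu (fun xi => enorm (phi xi) + enorm (g xi)).
    by apply: intgD => //; exact: intg_enorm.
  have [] := @dominated_cvg_Rint _ _ _ mu (fun n xi => f n xi 0 i)
    (fun xi => phi xi 0 i) _ _ _ ib _ _ => //.
  + apply: aeW => xi; apply: cvg_near_cst.
    exists (Num.bound (enorm (phi xi))) => // n /= bn.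
    rewrite /f mem_set// /Q /= (le_trans (ltW (archi_boundP (enorm_ge0 _))))//.
    by rewrite ler_nat.
  + apply: aeW => xi n; rewrite /f; case: ifP => _.
      by rewrite (le_trans (normr_coord_le _ _))// lerDl enorm_ge0.
    by rewrite (le_trans (normr_coord_le _ _))// lerDr enorm_ge0.
Qed.

End Selections.

(** * The mean of an everywhere defined operator of linear growth *)

Section MeanOperator.
Context d (Xi : measurableType d) (R : realType) (mu : probability Xi R) (N : nat).
Local Notation E := 'rV[R]_N.
Context (B : Xi -> operator R N) (b : Xi -> E -> E) (M : Xi -> R).
Hypothesis mB : forall xi, maximal_monotone (B xi).
Hypothesis b_sel : forall x, selections mu 1 (fun xi => B xi x) (b ^~ x).
Hypothesis M0 : forall xi, 0 <= M xi.
Hypothesis M2 : intg mu (fun xi => M xi ^+ 2).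
Hypothesis bM : forall xi x, enorm (b xi x) <= M xi * (1 + enorm x).

Lemma dotp_delta (y : E) i : dotp y (delta_mx 0 i) = y 0 i.
Proof.
rewrite /dotp (bigD1 i)//= mxE !eqxx mulr1 big1 ?addr0// => j ji.
by rewrite mxE (negbTE ji) andbF mulr0.
Qed.

Lemma enorm_delta i : enorm (delta_mx 0 i : E) = 1.
Proof. by rewrite /enorm dotp_delta mxE !eqxx sqrtr1. Qed.

(* Monotonicity bounds each coordinate of [y] in [B xi x] by the values of [b]
   at [x + e_i] and [x - e_i]. *)
Lemma selection_bound x : {ae mu, forall xi y, B xi x y ->
  enorm y <= N%:R * (M xi * (2 + enorm x))}.
Proof.
have ae1 (e : E) : {ae mu, forall xi, B xi (x + e) (b xi (x + e))}.
  by have [] := b_sel (x + e).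
have aei : {ae mu, forall xi (i : 'I_N), B xi (x + delta_mx 0 i) (b xi (x + delta_mx 0 i))
    /\ B xi (x - delta_mx 0 i) (b xi (x - delta_mx 0 i))}.
  apply: filter_forall => i.
  by apply: filterS2 (ae1 (delta_mx 0 i)) (ae1 (- delta_mx 0 i)).
apply: filterS aei => xi H y By.
apply: le_trans (enorm_le_sum _) _.
rewrite -[X in X%:R * _](card_ord N) -sum1_card natr_sum mulr_suml; apply: ler_sum => i _.
rewrite mul1r; have [Bp Bm] := H i.
have bnd (e : E) : enorm e = 1 -> enorm (b xi (x + e)) <= M xi * (2 + enorm x).
  move=> e1; apply: le_trans (bM _ _) _; apply: ler_wpM2l => //.
  by have := enormD x e; rewrite e1; lra.
have h1 := monotone_le (maximal_monotone_mon (mB xi)) Bp By.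
have h2 := monotone_le (maximal_monotone_mon (mB xi)) Bm By.
have b1 := bnd _ (enorm_delta i).
have b2 := bnd (- delta_mx 0 i) (etrans (enormN _) (enorm_delta i)).
have c1 := normr_dotp_le (b xi (x + delta_mx 0 i)) (delta_mx 0 i).
have c2 := normr_dotp_le (b xi (x - delta_mx 0 i)) (delta_mx 0 i).
move: h1 h2 c1 c2; rewrite enorm_delta !mulr1.
rewrite addrAC subrr add0r [x - _ - x]addrAC subrr add0r dotpNr !dotpBl !dotp_delta.
by rewrite !ler_norml => h1 h2 /andP[c1 c2] /andP[c3 c4]; apply/andP; split; lra.
Qed.

Lemma intg_growth2 (c : R) : intg mu (fun xi => (N%:R * (M xi * c)) ^+ 2).
Proof.
have := intgZ ((N%:R * c) ^+ 2) M2; apply: eq_integrable => // xi _ /=.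
by congr EFin; ring.
Qed.

Lemma selection_sqint x (psi : Xi -> E) : rmeas psi -> {ae mu, forall xi, B xi x (psi xi)} ->
  sqint mu psi /\ \int[mu]_xi dotp (psi xi) (psi xi) <=
    (N%:R * (2 + enorm x)) ^+ 2 * \int[mu]_xi M xi ^+ 2.
Proof.
move=> mpsi Bpsi.
have [|h1 h2] := @sqint_ae_le _ _ _ mu _ psi _ mpsi (intg_growth2 (2 + enorm x)).
  by apply: filterS2 (selection_bound x) Bpsi => xi; exact.
split=> //; apply: le_trans h2 _.
rewrite -RintZ// le_eqVlt; apply/orP; left; apply/eqP.
by apply: eq_Rintegral => xi _; ring.
Qed.

Lemma mean_op_nonempty x : exists y, mean_op mu B x y.
Proof. by exists (vintegral mu (b ^~ x)), (b ^~ x). Qed.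

Lemma mean_op_convex x v w (t : R) : 0 <= t <= 1 ->
  mean_op mu B x v -> mean_op mu B x w -> mean_op mu B x (v + t *: (w - v)).
Proof.
move=> t01 [phi [/vLq1P[mphi _] Bphi] <-] [psi [/vLq1P[mpsi _] Bpsi] <-].
have [phi2 _] := selection_sqint mphi Bphi.
have [psi2 _] := selection_sqint mpsi Bpsi.
have f2 : sqint mu (fun xi => phi xi + t *: (psi xi - phi xi)).
  by apply: sqintD => //; apply: sqintZ; exact: sqintB.
exists (fun xi => phi xi + t *: (psi xi - phi xi)).
  split; first exact: sqint_vLq1.
  apply: filterS2 Bphi Bpsi => xi h1 h2; exact: maximal_monotone_convex.
apply/rowP => i; rewrite !mxE.
have i1 := sqint_coord i phi2; have i2 := sqint_coord i psi2.
rewrite -(RintB i2 i1) -(RintZ _ (intgB i2 i1)) -(RintD i1 (intgZ _ (intgB i2 i1))).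
by apply: eq_Rintegral => xi _; rewrite !mxE.
Qed.

(** Each coordinate has nonnegative variance; the factor [N] comes from bounding every squared
    coordinate by the whole squared norm. *)
Lemma dotp_vintegral_le (psi : Xi -> E) : sqint mu psi ->
  dotp (vintegral mu psi) (vintegral mu psi) <=
  N%:R * \int[mu]_xi dotp (psi xi) (psi xi).
Proof.
move=> psi2; have [_ ip] := psi2.
rewrite -[X in X%:R * _](card_ord N) -sum1_card natr_sum mulr_suml.
apply: ler_sum => i _; rewrite mul1r vintegralE -expr2.
have i1 := sqint_coord i psi2; have i2 := sqint_coord2 i psi2.
set m := \int[mu]_xi _.
have : 0 <= \int[mu]_xi (psi xi 0 i ^+ 2 - 2 * m * psi xi 0 i + m ^+ 2).
  apply: Rintegral_ge0 => xi _.
  have -> : psi xi 0 i ^+ 2 - 2 * m * psi xi 0 i + m ^+ 2 = (psi xi 0 i - m) ^+ 2 by ring.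
  exact: sqr_ge0.
rewrite RintD; [|exact: intgB (intgZ _ i1)|exact: intg_cst].
rewrite (RintB i2 (intgZ _ i1)) RintZ// Rint_cst -/m.
have : \int[mu]_xi psi xi 0 i ^+ 2 <= \int[mu]_xi dotp (psi xi) (psi xi).
  by apply: Rint_le => // xi; exact: sqr_coord_le.
nra.
Qed.

Lemma mean_op_bound : exists2 C, 0 <= C &
  forall x y, mean_op mu B x y -> dotp y y <= C * (1 + dotp x x).
Proof.
have m0 : 0 <= \int[mu]_xi M xi ^+ 2 by apply: Rintegral_ge0 => xi _; exact: sqr_ge0.
(* [8] comes from [(2 + |x|)^2 <= 8 (1 + |x|^2)], the outer [N] from [dotp_vintegral_le] and
   [N ^+ 2] from [selection_sqint]. *)
exists (8 * (N%:R * (N%:R ^+ 2 * \int[mu]_xi M xi ^+ 2))).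
  by rewrite !mulr_ge0// sqr_ge0.
move=> x _ [psi [/vLq1P[mpsi _] Bpsi] <-].
have [psi2 H] := selection_sqint mpsi Bpsi.
apply: le_trans (dotp_vintegral_le psi2) _.
set I := \int[mu]_xi M xi ^+ 2 in m0 H *.
have : N%:R * \int[mu]_xi dotp (psi xi) (psi xi) <=
   (N%:R * (N%:R ^+ 2 * I)) * (2 + enorm x) ^+ 2.
  rewrite -[leRHS]mulrA; apply: ler_wpM2l => //; apply: le_trans H _.
  by rewrite le_eqVlt; apply/orP; left; apply/eqP; ring.
move=> /le_trans; apply; rewrite [8 * _]mulrC -[leRHS]mulrA.
apply: ler_wpM2l; first by rewrite !mulr_ge0// sqr_ge0.
by rewrite -sqr_enorm; have := enorm_ge0 x; nra.
Qed.

(** The points [xs n] are bounded, so their selections are dominated by one multiple of [M]. The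
    limit theorem for selections applies with constant base points and identifies the integral of
    the limit as [v]. *)
Lemma mean_op_closed (xs ys : nat -> E) a v :
  (forall n, mean_op mu B (xs n) (ys n)) ->
  xs @ \oo --> a -> ys @ \oo --> v -> mean_op mu B a v.
Proof.
move=> Bxy xa yv.
have /choice[psi psiP] n : exists psi : Xi -> E, selections mu 1 (fun xi => B xi (xs n)) psi
    /\ vintegral mu psi = ys n.
  by have [psi ? ?] := Bxy n; exists psi.
have mpsi n : rmeas (psi n) by have [[/vLq1P[]]] := psiP n.
have Bpsi n : {ae mu, forall xi, B xi (xs n) (psi n xi)} by have [[]] := psiP n.
have cxa : dotp (xs n - a) (xs n - a) @[n --> \oo] --> (0 : R).
  have h : xs n - a @[n --> \oo] --> (0 : E).
    by rewrite -(subrr a); apply: cvgB => //; exact: cvg_cst.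
  by rewrite -(dotp0l (0 : E)); exact: (cvg_dotp h h).
have r0 : enorm (xs n - a) @[n --> \oo] --> (0 : R).
  by rewrite -(@sqrtr0 R); apply: (cvg_comp _ _ cxa); exact: sqrt_continuous.
have [Cx xC] : exists Cx, forall n, enorm (xs n) <= Cx.
  have /cvg_seq_bounded[D [_ DP]] : cvgn (fun n => enorm (xs n - a)).
    by apply/cvg_ex; exists 0.
  exists (D + 1 + enorm a) => n; rewrite -[xs n](subrK a).
  apply: le_trans (enormD _ _) _; rewrite lerD2r.
  by apply: le_trans (ler_norm _) _; apply: DP => //; rewrite ltrDl.
have C0 : 0 <= Cx := le_trans (enorm_ge0 (xs 0%N)) (xC 0%N).
(* The summand 1 makes [G >= 1], so that [|xs n - a| <= |xs n - a| * G]. *)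
pose G xi := N%:R * (M xi * (2 + Cx)) + 1.
have [||||g [g2 Bg gi]] := @random_maximal_monotone_limit _ Xi R mu N B a
  (fun n _ => xs n) psi G (fun n => enorm (xs n - a))
  ((N%:R * (2 + Cx)) ^+ 2 * \int[mu]_xi M xi ^+ 2) mB.
- by move=> n; have [] := selection_sqint (mpsi n) (Bpsi n).
- move=> n; have [_ h] := selection_sqint (mpsi n) (Bpsi n).
  apply: le_trans h _; apply: ler_wpM2r.
    by apply: Rintegral_ge0 => xi _; exact: sqr_ge0.
  rewrite ler_pXn2r ?nnegrE ?mulr_ge0 ?addr_ge0 ?enorm_ge0//.
  by rewrite ler_wpM2l// lerD2l.
- exact: r0.
- apply: ae_foralln => n.
  apply: filterS2 (selection_bound (xs n)) (Bpsi n) => xi H Bxi.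
  split=> //.
    apply: le_trans (H _ Bxi) _; apply: (@le_trans _ _ (N%:R * (M xi * (2 + Cx)))).
      by apply: ler_wpM2l => //; apply: ler_wpM2l => //; rewrite lerD2l.
    by rewrite lerDl.
  rewrite -[leLHS]mulr1; apply: ler_wpM2l; first exact: enorm_ge0.
  by rewrite lerDr mulr_ge0// mulr_ge0// addr_ge0.
exists g; first by split => //; exact: sqint_vLq1.
apply/rowP => i; rewrite vintegralE; apply: gi.
have -> : (fun n => \int[mu]_xi psi n xi 0 i) = (fun n => ys n 0 i).
  by apply/funext => n; rewrite -vintegralE; have [_ ->] := psiP n.
exact: (cvg_rowP _ _).1 yv i.
Qed.

End MeanOperator.

(** * Independent samples and martingales *)

Section Independence.
Context d d1 d2 (T : measurableType d) (T1 : measurableType d1)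
  (T2 : measurableType d2) (R : realType) (P : probability T R).

Definition independent_pair (X : T -> T1) (Y : T -> T2) :=
  forall A B, measurable A -> measurable B ->
    P (X @^-1` A `&` Y @^-1` B) = (P (X @^-1` A) * P (Y @^-1` B))%E.

Context (X : {mfun T >-> T1}) (Y : {mfun T >-> T2}).
Hypothesis XY : independent_pair X Y.

Let pair_measurable : measurable_fun setT (fun w => (X w, Y w)).
Proof. by apply/measurable_fun_pair; exact: measurable_funP. Qed.

Lemma independent_pair_law (C : set (T1 * T2)) : measurable C ->
  P ((fun w => (X w, Y w)) @^-1` C) = (distribution P X \x distribution P Y)%E C.
Proof.
move=> mC.
pose mZ := isMeasurableFun.Build _ _ _ _ _ pair_measurable.
pose Z : {mfun T >-> (T1 * T2)%type} := HB.pack (fun w => (X w, Y w)) mZ.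
by rewrite (@product_measure_unique _ _ _ _ _ _ _ (distribution P Z)).
Qed.

Lemma independent_pair_null (C : set (T1 * T2)) : measurable C ->
  (forall x, P (Y @^-1` [set y | C (x, y)]) = 0%E) ->
  P [set w | C (X w, Y w)] = 0%E.
Proof.
move=> mC C0; have := independent_pair_law mC; rewrite /preimage /= => ->.
rewrite /product_measure1; apply: integral0_eq => x _ /=.
by rewrite /distribution /pushforward -[RHS](C0 x) xsectionE.
Qed.

Lemma ge0_independent_pair_integral (f : T1 * T2 -> \bar R) :
  measurable_fun setT f -> (forall z, 0 <= f z)%E ->
  (\int[P]_w f (X w, Y w) = \int[P]_w \int[P]_w' f (X w, Y w'))%E.
Proof.
move=> mf f0.
pose mZ := isMeasurableFun.Build _ _ _ _ _ pair_measurable.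
pose Z : {mfun T >-> (T1 * T2)%type} := HB.pack (fun w => (X w, Y w)) mZ.
transitivity (\int[distribution P Z]_z f z)%E.
  by rewrite ge0_integral_distribution.
transitivity (\int[distribution P X \x distribution P Y]_z f z)%E.
  apply: eq_measure_integral => A mA _.
  by first [exact: independent_pair_law|exact: (esym (independent_pair_law _))].
rewrite fubini_tonelli1//.
rewrite (@ge0_integral_distribution _ _ _ _ _ P X); last 2 first.
- exact: measurable_fun_fubini_tonelli_F.
- by move=> x; apply: integral_ge0 => y _.
apply: eq_integral => w _; rewrite /fubini_F /=.
rewrite (@ge0_integral_distribution _ _ _ _ _ P Y)//.
exact: (measurableT_comp mf (pair1_measurable _)).
Qed.

End Independence.

Section IndependentProduct.
Context d (T : measurableType d) (R : realType) (P : probability T R).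

Lemma independent_pair_comp d1 d2 (T1 : measurableType d1) (T2 : measurableType d2)
    d3 d4 (T3 : measurableType d3) (T4 : measurableType d4)
    (X : T -> T1) (Y : T -> T2) (f : T1 -> T3) (g : T2 -> T4) :
  measurable_fun setT f -> measurable_fun setT g ->
  independent_pair P X Y -> independent_pair P (f \o X) (g \o Y).
Proof.
move=> mf mg XY A B mA mB; apply: (XY (f @^-1` A) (g @^-1` B)).
  by rewrite -[_ @^-1` _]setTI; exact: mf.
by rewrite -[_ @^-1` _]setTI; exact: mg.
Qed.

Lemma ge0_independent_mul (X Y : T -> R) :
  independent_pair P X Y -> (forall w, 0 <= X w) -> (forall w, 0 <= Y w) ->
  intg P X -> intg P Y ->
  intg P (fun w => X w * Y w) /\
  \int[P]_w (X w * Y w) = \int[P]_w X w * \int[P]_w Y w.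
Proof.
move=> XY X0 Y0 iX iY.
have mX := intg_measurable iX; have mY := intg_measurable iY.
pose hX := isMeasurableFun.Build _ _ _ _ _ mX.
pose hY := isMeasurableFun.Build _ _ _ _ _ mY.
pose X' : {mfun T >-> R} := HB.pack X hX.
pose Y' : {mfun T >-> R} := HB.pack Y hY.
pose f (z : R * R) : \bar R := (`|z.1 * z.2|)%:E.
have mf : measurable_fun setT f.
  apply/measurable_EFinP; apply: measurableT_comp => //.
  by apply: measurable_funM; [exact: measurable_fst|exact: measurable_snd].
have f0 z : (0 <= f z)%E by rewrite lee_fin.
have H := @ge0_independent_pair_integral _ _ _ _ _ _ R P X' Y' XY f mf f0.
have E1 : (\int[P]_w (X w * Y w)%:E = (\int[P]_w X w * \int[P]_w Y w)%:E)%E.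
  transitivity (\int[P]_w f (X w, Y w))%E.
    apply: eq_integral => w _; congr EFin.
    exact: (esym (ger0_norm (mulr_ge0 (X0 w) (Y0 w)))).
  rewrite H; transitivity (\int[P]_w ((\int[P]_w' Y w')%:E * (X w)%:E))%E.
    apply: eq_integral => w _; rewrite /f /= -intg_fin//.
    rewrite muleC -ge0_integralZl_EFin//.
    - apply: eq_integral => w' _; rewrite -EFinM; congr EFin.
      exact: (ger0_norm (mulr_ge0 (X0 w) (Y0 w'))).
    - by move=> w' _; rewrite lee_fin.
    - exact/measurable_EFinP.
  rewrite ge0_integralZl_EFin//.
  - by rewrite intg_fin// -EFinM mulrC.
  - by move=> w' _; rewrite lee_fin.
  - exact/measurable_EFinP.
  - by apply: Rintegral_ge0.
have iXY : intg P (fun w => X w * Y w).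
  apply: intg_ge0P; first exact: measurable_funM.
    by move=> w; rewrite mulr_ge0.
  by rewrite E1 ltry.
by split=> //; move: E1; rewrite intg_fin// => -[].
Qed.

Let rposE (a : R) : a = Num.max a 0 - Num.max (- a) 0.
Proof. by rewrite !maxEle; case: ifP; case: ifP; lra. Qed.

Lemma independent_mul (X Y : T -> R) : independent_pair P X Y ->
  intg P X -> intg P Y ->
  intg P (fun w => X w * Y w) /\
  \int[P]_w (X w * Y w) = \int[P]_w X w * \int[P]_w Y w.
Proof.
move=> XY iX iY.
have mX := intg_measurable iX; have mY := intg_measurable iY.
pose p (a : R) := Num.max a 0; pose m (a : R) := Num.max (- a) 0.
have mp : measurable_fun setT p.
  by apply: measurable_maxr => //; exact: measurable_cst.
have mm : measurable_fun setT m.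
  by apply: measurable_maxr; [exact: oppr_measurable|exact: measurable_cst].
have p0 a : 0 <= p a by rewrite /p le_max lexx orbT.
have m0 a : 0 <= m a by rewrite /m le_max lexx orbT.
have ip (Z : T -> R) : intg P Z -> intg P (p \o Z).
  move=> iZ; apply: intg_le (intg_norm iZ) _.
    by apply: measurableT_comp => //; exact: intg_measurable iZ.
  by move=> w; rewrite ger0_norm ?p0// /p /= ge_max normr_ge0 ler_norm.
have im (Z : T -> R) : intg P Z -> intg P (m \o Z).
  move=> iZ; apply: intg_le (intg_norm iZ) _.
    by apply: measurableT_comp => //; exact: intg_measurable iZ.
  by move=> w; rewrite ger0_norm ?m0// /m /= ge_max normr_ge0 -normrN ler_norm.
have ind (f g : R -> R) : measurable_fun setT f -> measurable_fun setT g ->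
    (forall a, 0 <= f a) -> (forall a, 0 <= g a) ->
    intg P (f \o X) -> intg P (g \o Y) ->
    intg P (fun w => f (X w) * g (Y w)) /\
    \int[P]_w (f (X w) * g (Y w)) = \int[P]_w f (X w) * \int[P]_w g (Y w).
  move=> mf mg f0 g0 ifX igY.
  apply: (@ge0_independent_mul (f \o X) (g \o Y) _ _ _ ifX igY).
  - exact: (independent_pair_comp mf mg XY).
  - by move=> w; exact: f0.
  - by move=> w; exact: g0.
have [i1 e1] := ind p p mp mp p0 p0 (ip _ iX) (ip _ iY).
have [i2 e2] := ind p m mp mm p0 m0 (ip _ iX) (im _ iY).
have [i3 e3] := ind m p mm mp m0 p0 (im _ iX) (ip _ iY).
have [i4 e4] := ind m m mm mm m0 m0 (im _ iX) (im _ iY).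
have XYE w : X w * Y w = (p (X w) * p (Y w) - p (X w) * m (Y w)) -
    (m (X w) * p (Y w) - m (X w) * m (Y w)).
  transitivity ((p (X w) - m (X w)) * (p (Y w) - m (Y w))); last by ring.
  by congr (_ * _); exact: rposE.
have iA := intgB i1 i2; have iB := intgB i3 i4.
have XE : \int[P]_w X w = \int[P]_w p (X w) - \int[P]_w m (X w).
  rewrite -(RintB (ip _ iX) (im _ iX)).
  by apply: eq_Rintegral => w _; exact: rposE.
have YE : \int[P]_w Y w = \int[P]_w p (Y w) - \int[P]_w m (Y w).
  rewrite -(RintB (ip _ iY) (im _ iY)).
  by apply: eq_Rintegral => w _; exact: rposE.
split.
  by have := intgB iA iB; apply: eq_integrable => // w _ /=; rewrite XYE.
under eq_Rintegral do rewrite XYE.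
by rewrite (RintB iA iB) (RintB i1 i2) (RintB i3 i4) e1 e2 e3 e4 XE YE; ring.
Qed.

End IndependentProduct.

(** * The filtration generated by the samples *)

Section Past.
Context d d' (Xi : measurableType d) (Omega : measurableType d') (R : realType).
Implicit Types (u : nat -> Omega -> Xi).

Definition cylinder u n : set (set Omega) :=
  [set S | exists2 H : nat -> set Xi, (forall k, measurable (H k)) &
     S = [set w | forall k, (0 < k <= n)%N -> H k (u k w)]].

(* [Omega] with the sigma-algebra generated by [u 1], ..., [u n]. *)
Definition past u n := g_sigma_algebraType (cylinder u n).

Context (P : probability Omega R) (mu : probability Xi R) (u : nat -> Omega -> Xi).
Hypothesis u_iid : iid_with_law P mu u.

Lemma measurable_past_sample n k : (0 < k <= n)%N ->
  measurable_fun setT (u k : past u n -> Xi).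
Proof.
move=> kn _ H mH; rewrite setTI; apply: sub_sigma_algebra.
exists (fun j => if j == k then H else setT) => [j|]; first by case: ifP.
apply/seteqP; split=> w /= Hw; last by have := Hw k kn; rewrite eqxx.
by move=> j _; case: ifP => // /eqP ->.
Qed.

Lemma past_subset m n S : (m <= n)%N ->
  measurable (S : set (past u m)) -> measurable (S : set (past u n)).
Proof.
move=> mn; apply: smallest_sub; first exact: smallest_sigma_algebra.
move=> _ [H mH ->]; apply: sub_sigma_algebra.
exists (fun k => if (k <= m)%N then H k else setT) => [j|]; first by case: ifP.
apply/seteqP; split=> w /= Hw k.
  by move=> /andP[k0 _]; case: ifP => // km; apply: Hw; rewrite k0.
move=> /andP[k0 km]; have := Hw k; rewrite k0 km (leq_trans km mn).
exact.
Qed.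

Lemma past_measurable n S :
  measurable (S : set (past u n)) -> measurable (S : set Omega).
Proof.
have [mu_ _ _] := u_iid.
apply: smallest_sub; first exact: sigma_algebra_measurable.
move=> _ [H mH ->].
have -> : [set w | forall k, (0 < k <= n)%N -> H k (u k w)] =
    \bigcap_(k in [set k | (0 < k <= n)%N]) (u k @^-1` H k) by [].
apply: bigcap_measurableType => k /= /andP[k0 _].
by rewrite -[X in measurable X]setTI; exact: mu_.
Qed.

Lemma measurable_past_le d1 (T : measurableType d1) m n (f : Omega -> T) : (m <= n)%N ->
  measurable_fun setT (f : past u m -> T) -> measurable_fun setT (f : past u n -> T).
Proof. by move=> mn mf _ B mB; apply: (past_subset mn); exact: mf. Qed.

Lemma measurable_past d1 (T : measurableType d1) n (f : Omega -> T) :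
  measurable_fun setT (f : past u n -> T) -> measurable_fun setT f.
Proof. by move=> mf _ B mB; apply: (@past_measurable n); exact: mf. Qed.

(** Dynkin's argument: the cylinders are stable under intersection and generate the past, and the
    sets satisfying the product formula are stable under complements and countable disjoint
    unions. *)
Lemma independent_past n S H : measurable (S : set (past u n)) -> measurable H ->
  P (S `&` u n.+1 @^-1` H) = (P S * mu H)%E.
Proof.
move=> mS mH; have [mu_ law ind] := u_iid.
pose U := u n.+1 @^-1` H.
have mU : measurable U by rewrite -[U]setTI; exact: mu_.
have PU : P U = mu H by exact: law.
rewrite -PU.
pose Q (S : set Omega) := P (S `&` U) = (P S * P U)%E.
have QC (A : set Omega) : measurable A -> Q A -> Q (~` A).
  rewrite /Q => mA QA.
  have -> : ~` A `&` U = U `\` (A `&` U).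
    by rewrite setDE setCI setIUr setICr setU0 setIC.
  have mAU : measurable (A `&` U) by exact: measurableI.
  have PUlt : (P U < +oo)%E by rewrite ltey_eq fin_num_measure.
  have D : P (U `\` (A `&` U)) = (P U - P (U `&` (A `&` U)))%E by exact: measureD.
  have PC : P (~` A) = (1 - P A)%E by exact: probability_setC.
  rewrite D PC [U `&` _]setIC -setIA setIid QA.
  rewrite -(fineK (fin_num_measure P A mA)) -(fineK (fin_num_measure P U mU)).
  by rewrite -EFinM -!EFinB -EFinM; congr EFin; ring.
have QB (F : nat -> set Omega) : (forall k, measurable (F k)) ->
    trivIset setT F -> (forall k, Q (F k)) -> Q (\bigcup_k F k).
  rewrite /Q => mF tF QF; rewrite setI_bigcupl.
  have PUf : P U \is a fin_num by exact: fin_num_measure.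
  have -> : P (\bigcup_k (F k `&` U)) = (\sum_(k <oo) P (F k `&` U))%E.
    apply: measure_semi_bigcup; first by move=> k; exact: measurableI.
      exact: trivIset_setIr.
    by apply: bigcupT_measurable => k; exact: measurableI.
  have -> : P (\bigcup_k F k) = (\sum_(k <oo) P (F k))%E.
    by apply: measure_semi_bigcup => //; exact: bigcupT_measurable.
  rewrite muleC -(fineK PUf) -nneseriesZl; last by [].
  by apply: eq_eseriesr => k _; rewrite QF (fineK PUf) muleC.
change (Q S); apply: (@dynkin_induction _ (past u n) (cylinder u n) Q _ _ _ _ _ _ S mS) => //.
- move=> _ _ [H1 mH1 ->] [H2 mH2 ->]; exists (fun k => H1 k `&` H2 k).
    by move=> k; exact: measurableI.
  apply/seteqP; split=> w /=.
    by move=> [h1 h2] k kn; split; [exact: h1|exact: h2].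
  by move=> h; split=> k kn; have [] := h k kn.
- by rewrite /Q setTI (probability_setT P) mul1e.
- move=> _ [H' mH' ->]; rewrite /Q.
  (* With [H] placed at index [n + 1], mutual independence over [1..n] and over [1..n+1] differ by
     the single factor [P U]. *)
  pose H2 k := if k == n.+1 then H else H' k.
  have mH2 k : measurable (H2 k) by rewrite /H2; case: ifP.
  have all0 m : all (fun k => 0 < k)%N (iota 1 m).
    by apply/allP => k; rewrite mem_iota => /andP[].
  have E1 := ind (iota 1 n) H2 (iota_uniq _ _) (all0 n) mH2.
  have E2 := ind (iota 1 n.+1) H2 (iota_uniq _ _) (all0 n.+1) mH2.
  have iS : iota 1 n.+1 = iota 1 n ++ [:: n.+1].
    by have := iotaD 1 n 1; rewrite addn1 add1n.
  rewrite iS big_cat/= big_seq1 -E1 in E2.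
  have S1 : \bigcap_(k in [set` iota 1 n]) (u k @^-1` H2 k) =
      [set w | forall k, (0 < k <= n)%N -> H' k (u k w)].
    apply/seteqP; split=> w /= h k.
      move=> kn; have := h k; rewrite /= mem_iota add1n ltnS /H2.
      move=> /(_ kn); rewrite ifF//; apply/eqP => kE.
      by move: kn; rewrite kE ltnn andbF.
    rewrite /= mem_iota add1n ltnS => kn; rewrite /H2 ifF; first exact: h.
    by apply/eqP => kE; move: kn; rewrite kE ltnn andbF.
  have S2 : \bigcap_(k in [set` iota 1 n.+1]) (u k @^-1` H2 k) =
      [set w | forall k, (0 < k <= n)%N -> H' k (u k w)] `&` U.
    rewrite iS -S1; apply/seteqP; split=> w /=.
      move=> h; split=> [k /= kn|].
        by apply: h; rewrite /= mem_cat kn.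
      have := h n.+1; rewrite /= mem_cat inE eqxx orbT => /(_ isT).
      by rewrite /H2 eqxx.
    move=> [h hU] k; rewrite /= mem_cat inE => /orP[kn|/eqP ->]; first exact: h.
    by rewrite /H2 eqxx.
  by rewrite -S2 iS E2 S1 /H2 eqxx.
- by move=> A /past_measurable mA QA; exact: QC.
- by move=> F mF tF QF; apply: QB => // k; exact: past_measurable.
Qed.

End Past.

Section Samples.
Context d d' (Xi : measurableType d) (Omega : measurableType d') (R : realType).
Context (P : probability Omega R) (mu : probability Xi R) (u : nat -> Omega -> Xi).
Hypothesis u_iid : iid_with_law P mu u.

Let mu_ n : (0 < n)%N -> measurable_fun setT (u n).
Proof. by case: u_iid => + _ _; exact. Qed.

Lemma ge0_sample_integral n (f : Xi -> \bar R) : (0 < n)%N ->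
  measurable_fun setT f -> (forall xi, 0 <= f xi)%E ->
  (\int[P]_w f (u n w) = \int[mu]_xi f xi)%E.
Proof.
move=> n0 mf f0; have [_ law _] := u_iid.
pose hu := isMeasurableFun.Build _ _ _ _ _ (mu_ n0).
pose u' : {mfun Omega >-> Xi} := HB.pack (u n) hu.
rewrite -[LHS](@ge0_integral_distribution _ _ _ _ _ P u')//.
by apply: eq_measure_integral => A mA _; first [exact: law|exact: (esym (law _ n0 _ mA))].
Qed.

Lemma sample_integral n (h : Xi -> R) : (0 < n)%N -> intg mu h ->
  intg P (h \o u n) /\ \int[P]_w h (u n w) = \int[mu]_xi h xi.
Proof.
move=> n0 ih; have [_ law _] := u_iid.
have mh := intg_measurable ih.
pose hu := isMeasurableFun.Build _ _ _ _ _ (mu_ n0).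
pose u' : {mfun Omega >-> Xi} := HB.pack (u n) hu.
have ihu : intg P (h \o u n).
  apply/integrableP; split.
    by apply/measurable_EFinP; apply: measurableT_comp => //; exact: mu_.
  have /integrableP[_] := ih; rewrite -(@ge0_sample_integral n)//.
  by apply: measurableT_comp => //; exact/measurable_EFinP.
split=> //; congr fine.
have mh' : measurable_fun setT (EFin \o h) by exact/measurable_EFinP.
rewrite -[LHS](@integral_distribution _ _ _ _ _ P u' (EFin \o h) mh' ihu).
by apply: eq_measure_integral => A mA _; first [exact: law|exact: (esym (law _ n0 _ mA))].
Qed.

Lemma sample_ae n (Q : set Xi) : (0 < n)%N ->
  {ae mu, forall xi, Q xi} -> {ae P, forall w, Q (u n w)}.
Proof.
move=> n0 [N [mN N0 QN]]; have [_ law _] := u_iid.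
exists (u n @^-1` N); split.
- by rewrite -[X in measurable X]setTI; exact: mu_.
- by rewrite law.
- by move=> w /= nQ; apply: QN.
Qed.

Lemma independent_past_sample n d1 d2 (T1 : measurableType d1) (T2 : measurableType d2)
    (X : Omega -> T1) (h : Xi -> T2) :
  measurable_fun setT (X : past u n -> T1) -> measurable_fun setT h ->
  independent_pair P X (h \o u n.+1).
Proof.
move=> mX mh A B mA mB; have [_ law _] := u_iid.
have mhB : measurable (h @^-1` B) by rewrite -[X in measurable X]setTI; exact: mh.
have mXA : measurable (X @^-1` A : set (past u n)).
  by rewrite -[X in measurable X]setTI; exact: mX.
by rewrite (independent_past u_iid mXA mhB) -(law n.+1).
Qed.

Lemma past_sample_mul n (X : Omega -> R) (h : Xi -> R) :
  measurable_fun setT (X : past u n -> R) -> intg P X -> intg mu h ->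
  intg P (fun w => X w * h (u n.+1 w)) /\
  \int[P]_w (X w * h (u n.+1 w)) = \int[P]_w X w * \int[mu]_xi h xi.
Proof.
move=> mX iX ih; have [ihu <-] := sample_integral (ltn0Sn n) ih.
apply: (@independent_mul _ _ _ P X (h \o u n.+1)) => //.
by apply: independent_past_sample => //; exact: intg_measurable ih.
Qed.

(** Fubini for the independent pair [(X, u n.+1)]. The null set may depend on [x]; this is what
    allows a property known at each fixed point to be used at a random iterate. *)
Lemma past_sample_null n d1 (T1 : measurableType d1) (X : Omega -> T1)
    (C : set (T1 * Xi)) :
  measurable_fun setT (X : past u n -> T1) -> measurable C ->
  (forall x, {ae mu, forall xi, C (x, xi)}) ->
  {ae P, forall w, C (X w, u n.+1 w)}.
Proof.
move=> mX mC aeC; have [_ law _] := u_iid.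
pose hu := isMeasurableFun.Build _ _ _ _ _ (mu_ (ltn0Sn n)).
pose u' : {mfun Omega >-> Xi} := HB.pack (u n.+1) hu.
pose hX := isMeasurableFun.Build _ _ _ _ _ (measurable_past u_iid mX).
pose X' : {mfun Omega >-> T1} := HB.pack X hX.
have mC' : measurable (~` C) by exact: measurableC.
exists [set w | (~` C) (X w, u n.+1 w)]; split => //.
- have mp : measurable_fun setT (fun w => (X w, u n.+1 w)).
    apply/measurable_fun_pair; first exact: (measurable_past u_iid mX).
    exact: mu_.
  by rewrite -[X in measurable X]setTI; exact: (mp measurableT (~` C) mC').
- apply: (@independent_pair_null _ _ _ _ _ _ _ P X' u' _ (~` C) mC').
    by have := @independent_past_sample n _ _ _ _ X idfun mX (@measurable_id _ _ _).
  move=> x.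
  have mS : measurable [set xi | (~` C) (x, xi)].
    have := pair1_measurable x measurableT mC'.
    by rewrite setTI.
  rewrite -[LHS]/(P (u n.+1 @^-1` _)) law//.
  by have /negligibleP := aeC x; apply.
Qed.

End Samples.

(** * Almost sure convergence of square-summable orthogonal increments *)

Section MartingaleConvergence.
Context d d' (Xi : measurableType d) (Omega : measurableType d') (R : realType).
Context (P : probability Omega R) (mu : probability Xi R) (u : nat -> Omega -> Xi).
Hypothesis u_iid : iid_with_law P mu u.
Context (X : nat -> Omega -> R) (K : R).
Hypothesis mX : forall k, measurable_fun setT (X k : past u k.+1 -> R).
Hypothesis X2 : forall k, intg P (fun w => X k w ^+ 2).
Hypothesis XK : forall n, \sum_(0 <= k < n) \int[P]_w X k w ^+ 2 <= K.
(** The martingale property in a form free of conditional expectations: orthogonality to every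
    square-integrable function of the past. *)
Hypothesis Xorth : forall k (Z : Omega -> R),
  measurable_fun setT (Z : past u k -> R) -> intg P (fun w => Z w ^+ 2) ->
  \int[P]_w (Z w * X k w) = 0.

Let S n w := \sum_(0 <= k < n) X k w.

(* The increments after time [m], stopped at the first exit from ]-e, e[. *)
Let Y (m : nat) (e : R) := fix Y j w := if j is i.+1 then
  Y i w + (if `|Y i w| < e then 1 else 0) * X (m + i)%N w else 0.

Let ind_lt (e a : R) : R := if `|a| < e then 1 else 0.

Let measurable_ind_lt e : measurable_fun setT (ind_lt e).
Proof.
apply: measurable_fun_ifT; [|exact: measurable_cst|exact: measurable_cst].
by apply: measurable_fun_ltr; [exact: normr_measurable|exact: measurable_cst].
Qed.

Let YS m e j w : Y m e j.+1 w = Y m e j w + ind_lt e (Y m e j w) * X (m + j)%N w.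
Proof. by []. Qed.

Let mY m e j : measurable_fun setT (Y m e j : past u (m + j) -> R).
Proof.
elim: j => [|j IH]; first exact: measurable_cst.
have IH' : measurable_fun setT (Y m e j : past u (m + j.+1) -> R).
  by apply: measurable_past_le IH; rewrite addnS.
apply: measurable_funD => //; apply: measurable_funM.
  exact: (measurableT_comp (measurable_ind_lt e) IH').
by rewrite addnS; exact: mX.
Qed.

Let ind_lt01 e a : 0 <= ind_lt e a <= 1.
Proof. by rewrite /ind_lt; case: ifP; rewrite ?lexx ?ler01. Qed.

(** Expanding the square, the cross term is the integral of a function of the past times
    [X (m + j)], hence 0; the indicator only decreases the remaining square. *)
Let Y2 m e j : intg P (fun w => Y m e j w ^+ 2) /\
  \int[P]_w Y m e j w ^+ 2 <= \sum_(m <= k < m + j) \int[P]_w X k w ^+ 2.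
Proof.
elim: j => [|j [i2 IH]].
  rewrite addn0 big_geq//.
  have E : (fun w : Omega => (0 : R) ^+ 2) = (fun=> 0) by apply/funext => w; rewrite expr2 mulr0.
  by rewrite /= E Rint_cst; split => //; exact: intg_cst.
have mYo : measurable_fun setT (Y m e j) by exact: (measurable_past u_iid (n := (m + j)%N)).
have mXo k : measurable_fun setT (X k) by exact: (measurable_past u_iid (n := k.+1)).
have mI : measurable_fun setT (fun w => ind_lt e (Y m e j w)).
  exact: (measurableT_comp (measurable_ind_lt e) mYo).
pose Z w := Y m e j w * ind_lt e (Y m e j w).
have mZ : measurable_fun setT (Z : past u (m + j) -> R).
  by apply: measurable_funM => //; apply: (measurableT_comp (measurable_ind_lt e)).
have Z2 : intg P (fun w => Z w ^+ 2).
  apply: intg_le i2 _; first by apply: measurable_funX; exact: measurable_funM.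
  move=> w; rewrite ger0_norm ?sqr_ge0// /Z exprMn.
  have /andP[h0 h1] := ind_lt01 e (Y m e j w).
  by rewrite ler_piMr ?sqr_ge0// exprn_ile1.
have orth := Xorth mZ Z2.
pose W w := (ind_lt e (Y m e j w) * X (m + j)%N w) ^+ 2.
have Wle w : W w <= X (m + j)%N w ^+ 2.
  have /andP[h0 h1] := ind_lt01 e (Y m e j w).
  by rewrite /W exprMn ler_piMl ?sqr_ge0// exprn_ile1.
have iW : intg P W.
  apply: intg_le (X2 (m + j)) _; first by apply: measurable_funX; exact: measurable_funM.
  by move=> w; rewrite ger0_norm ?sqr_ge0.
have iZX : intg P (fun w => Z w * X (m + j)%N w).
  by apply: intg_mul => //; exact: measurable_funM.
have YE : (fun w => Y m e j.+1 w ^+ 2) =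
    (fun w => (Y m e j w ^+ 2 + 2 * (Z w * X (m + j)%N w)) + W w).
  by apply/funext => w; rewrite YS /Z /W; ring.
have i3 := intgD i2 (intgZ 2 iZX).
have i4 := intgD i3 iW.
rewrite YE; split=> //.
rewrite (RintD i3 iW) (RintD i2 (intgZ 2 iZX)) RintZ// orth mulr0 addr0.
rewrite addnS big_nat_recr ?leq_addr//=; apply: lerD => //.
exact: Rint_le.
Qed.

(** Either the stopped sum has left []-e, e[] and is frozen there, or it still follows the
    increments of [S] after [m], all of which have stayed inside. *)
Let Y_stop m e j w : 0 < e -> e <= `|Y m e j w| \/
  (Y m e j w = S (m + j) w - S m w /\ forall i, (i <= j)%N -> `|S (m + i) w - S m w| < e).
Proof.
move=> e0; elim: j => [|j [IH|[IH1 IH2]]].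
- right; rewrite addn0 subrr; split => // i; rewrite leqn0 => /eqP ->.
  by rewrite addn0 subrr normr0.
- by left; rewrite YS /ind_lt ltNge IH/= mul0r addr0.
have lt : `|Y m e j w| < e by rewrite IH1; exact: IH2.
have YE : Y m e j.+1 w = S (m + j.+1) w - S m w.
  by rewrite YS /ind_lt lt mul1r IH1 addnS /S big_nat_recr//= addrAC.
have [le|lt'] := leP e `|Y m e j.+1 w|; [by left|right].
split=> // i; rewrite leq_eqVlt => /orP[/eqP ->|]; first by rewrite -YE.
by rewrite ltnS; exact: IH2.
Qed.

Let s n : R := \sum_(0 <= k < n) \int[P]_w X k w ^+ 2.

Let s_nd : nondecreasing_seq s.
Proof.
move=> m n mn; rewrite /s (big_cat_nat (leq0n m) mn)//= lerDl; apply: sumr_ge0 => k _.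
by apply: Rintegral_ge0 => w _; exact: sqr_ge0.
Qed.

Let s_cvg : cvgn s.
Proof. by apply: nondecreasing_is_cvgn s_nd _; exists K => _ [n _ <-]; exact: XK. Qed.

Let F m e j := [set w | e <= `|Y m e j w|].

Let mF m e j : measurable (F m e j).
Proof.
have mYo : measurable_fun setT (Y m e j) by exact: (measurable_past u_iid (n := (m + j)%N)).
have -> : F m e j = [set w | (e%:E <= (`|Y m e j w|)%:E)%E].
  by apply/seteqP; split => w; rewrite /F /= lee_fin.
rewrite -[X in measurable X]setTI; apply: emeasurable_fun_c_infty => //.
by apply/measurable_EFinP; exact: measurableT_comp.
Qed.

(** Chebyshev's inequality for the stopped sum, that is, Kolmogorov's maximal inequality for [S]
    after time [m]. *)
Let PF m e j : 0 < e -> (P (F m e j) <= ((limn s - s m) / e ^+ 2)%:E)%E.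
Proof.
move=> e0; have [i2 le2] := Y2 m e j.
have le3 : \int[P]_w Y m e j w ^+ 2 <= limn s - s m.
  apply: le_trans le2 _; rewrite lerBrDl.
  have -> : s m + \sum_(m <= k < m + j) \int[P]_w X k w ^+ 2 = s (m + j).
    by rewrite /s [in RHS](big_cat_nat (leq0n m) (leq_addr j m)).
  exact: nondecreasing_cvgn_le.
have H : ((e ^+ 2)%:E * P (F m e j) <= (limn s - s m)%:E)%E.
  rewrite -[F m e j]setIT -integral_indic// -ge0_integralZl_EFin ?sqr_ge0//;
    last by apply/measurable_EFinP; exact: measurable_indic.
  apply: (@le_trans _ _ (\int[P]_w (Y m e j w ^+ 2)%:E)%E).
    apply: ge0_le_integral => //.
    - by move=> w _; rewrite -EFinM lee_fin mulr_ge0// sqr_ge0.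
    - by apply/measurable_EFinP; apply: measurable_funM => //; exact: measurable_indic.
    - exact: measurable_int i2.
    - move=> w _; rewrite -EFinM lee_fin indicE.
      have [/set_mem wF|_] := boolP (w \in F m e j); last by rewrite mulr0 sqr_ge0.
      by rewrite mulr1 -[leRHS]real_normK ?num_real// ler_pXn2r ?nnegrE// ltW.
  by rewrite intg_fin// lee_fin.
have Pf : P (F m e j) \is a fin_num by exact: fin_num_measure.
move: H; rewrite -(fineK Pf) -EFinM !lee_fin ler_pdivlMr ?exprn_gt0//.
by rewrite mulrC.
Qed.

Let Finc m e : 0 < e -> nondecreasing_seq (F m e).
Proof.
move=> e0; apply/nondecreasing_seqP => j; apply/subsetPset => w; rewrite /F /= => H.
by rewrite /ind_lt ltNge H/= mul0r addr0.
Qed.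

Let PFU m e : 0 < e -> (P (\bigcup_j F m e j) <= ((limn s - s m) / e ^+ 2)%:E)%E.
Proof.
move=> e0; have mU : measurable (\bigcup_j F m e j) by exact: bigcupT_measurable.
have cv := nondecreasing_cvg_mu (mF m e) mU (Finc m e0).
have -> : P (\bigcup_j F m e j) = limn (P \o F m e) by apply/esym/cvg_lim => //; exact: cv.
apply: lime_le; first by apply/cvg_ex; eexists; exact: cv.
by apply: nearW => j; exact: PF.
Qed.

(** The probability that [S] ever moves by [e] or more after time [m] is at most the tail of the
    variances over [e^2]. So almost surely, for each [e = 1 / (q + 1)], there is an [m] after which
    this never happens, and the partial sums are Cauchy. *)
Lemma orthogonal_series_cvg : {ae P, forall w, cvgn (fun n => \sum_(0 <= k < n) X k w)}.
Proof.
pose G (q : nat) := \bigcap_m \bigcup_j F m (harmonic q) j.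
have h0 q : 0 < harmonic q :> R by rewrite invr_gt0.
have mU m q : measurable (\bigcup_j F m (harmonic q) j) by exact: bigcupT_measurable.
have PG q : P (G q) = 0%E.
  have mG : measurable (G q) by exact: bigcapT_measurable.
  apply/eqP; rewrite eq_le measure_ge0 andbT.
  have le m : (P (G q) <= ((limn s - s m) / harmonic q ^+ 2)%:E)%E.
    apply: le_trans (PFU m (h0 q)); apply: le_measure; rewrite ?inE//.
    by move=> w; exact.
  have cl : ((limn s - s m) / harmonic q ^+ 2)%:E @[m --> \oo] --> (0 : R)%:E.
    apply: cvg_EFin; first exact: nearW.
    rewrite -(mul0r (harmonic q ^+ 2)^-1) -(subrr (limn s)).
    apply: cvgM; last exact: cvg_cst.
    by apply: cvgB; [exact: cvg_cst|exact: s_cvg].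
  change (P (G q) <= (0 : R)%:E)%E.
  rewrite -(cvg_lim (@ereal_hausdorff R) cl); apply: lime_ge; first by apply/cvg_ex; eexists; exact: cl.
  exact: nearW.
have : {ae P, forall w q, ~ G q w}.
  apply: ae_foralln => q; exists (G q); split.
  - exact: bigcapT_measurable.
  - exact: PG.
  - by move=> w /=; rewrite not_notE.
apply: filterS => w Gw; apply/cauchy_cvgP/cauchy_exP => e e0.
have [q _ /(_ q (leqnn q))] := near_infty_natSinv_lt (PosNum e0).
move=> /= qe; have := Gw q; rewrite /G => /existsNP[m /not_implyP[_ nF]].
exists (S m w); exists m => // n /= mn; rewrite /ball/= distrC.
have [H|[_ H]] := Y_stop m (n - m) w (h0 q).
  by exfalso; apply: nF; exists (n - m)%N.
by have := H (n - m)%N (leqnn _); rewrite subnKC// => /lt_trans; apply.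
Qed.

End MartingaleConvergence.

(** * Deterministic convergence of weighted means *)

Section WeightedMeans.
Context {R : realType} {N : nat}.
Local Notation E := 'rV[R]_N.
Context (g : nat -> R).
Hypothesis g_gt0 : forall n, 0 < g n.
Hypothesis g_infty : forall C : R, exists m, forall n, (m <= n)%N ->
  C <= \sum_(0 <= k < n) g k.
Local Notation Gam n := (\sum_(0 <= k < n) g k).

Lemma weights_gt0 n : (0 < n)%N -> 0 < Gam n.
Proof.
case: n => // n _; rewrite big_nat_recr//= ltr_wpDl// sumr_ge0// => k _.
exact: ltW.
Qed.

Lemma cvg_over_weights (C : R) : (Gam n)^-1 * C @[n --> \oo] --> 0.
Proof.
apply/cvgrPdist_le => e e0; have [m mP] := g_infty (`|C| / e).
exists m.+1 => // n /= mn; rewrite sub0r normrN normrM.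
have G0 : 0 < Gam n by apply: weights_gt0; exact: leq_trans mn.
rewrite gtr0_norm ?invr_gt0// mulrC ler_pdivrMr// mulrC -ler_pdivrMr//.
by apply: mP; exact: ltnW.
Qed.

(** Split where [a] comes within [e / 2] of [l]: the head is a constant over diverging weights, and
    the tail is an average of errors at most [e / 2]. *)
Lemma toeplitz (a : nat -> R) (l : R) : a @ \oo --> l ->
  (Gam n)^-1 * (\sum_(0 <= k < n) g k * a k) @[n --> \oo] --> l.
Proof.
move=> al; apply/cvgrPdist_le => e e0; have e20 : 0 < e / 2 by rewrite divr_gt0.
have /cvgrPdist_le/(_ _ e20)[m _ mP] := al.
pose C := \sum_(0 <= k < m) g k * `|l - a k|.
have /cvgrPdist_le/(_ _ e20)[m' _ m'P] := cvg_over_weights C.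
exists (m + m').+1 => // n /= mn.
have n0 : (0 < n)%N by exact: leq_trans mn.
have mn' : (m <= n)%N by apply: leq_trans (ltnW mn); exact: leq_addr.
have G0 := weights_gt0 n0.
have -> : l - (Gam n)^-1 * (\sum_(0 <= k < n) g k * a k) =
    (Gam n)^-1 * \sum_(0 <= k < n) g k * (l - a k).
  have -> : \sum_(0 <= k < n) g k * (l - a k) =
      Gam n * l - \sum_(0 <= k < n) g k * a k.
    by rewrite mulr_suml -sumrB; apply: eq_bigr => k _; rewrite mulrBr.
  by rewrite mulrBr mulrA mulVf ?gt_eqF// mul1r.
rewrite normrM (gtr0_norm (x := (Gam n)^-1)) ?invr_gt0//.
have H1 : `|\sum_(0 <= k < n) g k * (l - a k)| <= C + Gam n * (e / 2).
  apply: le_trans (ler_norm_sum _ _ _) _.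
  rewrite (big_cat_nat (leq0n m) mn')/=; apply: lerD.
    by apply: ler_sum => k _; rewrite normrM gtr0_norm.
  rewrite [X in X * _](big_cat_nat (leq0n m) mn')/= mulrDl.
  apply: (@le_trans _ _ ((\sum_(m <= k < n) g k) * (e / 2))).
    rewrite mulr_suml big_nat_cond [leRHS]big_nat_cond; apply: ler_sum => k.
    rewrite andbT => /andP[mk _]; rewrite normrM gtr0_norm//.
    by apply: ler_wpM2l; [exact: ltW|exact: mP].
  rewrite lerDr; apply: mulr_ge0; last exact: ltW.
  by apply: sumr_ge0 => k _; exact: ltW.
have H2 : (Gam n)^-1 * C <= e / 2.
  have : (m' <= n)%N by apply: leq_trans (ltnW mn); exact: leq_addl.
  by move=> /m'P; rewrite sub0r normrN; apply: le_trans; exact: ler_norm.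
apply: (@le_trans _ _ ((Gam n)^-1 * (C + Gam n * (e / 2)))).
  by apply: ler_wpM2l => //; rewrite invr_ge0 ltW.
by rewrite mulrDr mulrA mulVf ?gt_eqF// mul1r [leRHS](splitr e) lerD2r.
Qed.

Definition wmean (x : nat -> E) n : E :=
  (Gam n)^-1 *: \sum_(0 <= k < n) g k *: x k.

Lemma dotp_wmean (x : nat -> E) (y : E) n :
  dotp y (wmean x n) = (Gam n)^-1 * \sum_(0 <= k < n) g k * dotp y (x k).
Proof.
rewrite dotpZr dotp_sumr; congr (_ * _); apply: eq_bigr => k _.
by rewrite dotpZr.
Qed.

Lemma wmean_bounded (x : nat -> E) (C : R) : (forall n, enorm (x n) <= C) ->
  forall n, enorm (wmean x n) <= C.
Proof.
move=> xC [|n].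
  rewrite /wmean !big_geq// scaler0 /enorm dotp0l sqrtr0.
  exact: le_trans (enorm_ge0 _) (xC 0%N).
have G0 := weights_gt0 (ltn0Sn n).
rewrite /wmean enormZ gtr0_norm ?invr_gt0// mulrC ler_pdivrMr// mulrC.
have : enorm (\sum_(0 <= k < n.+1) g k *: x k) <= \sum_(0 <= k < n.+1) g k * enorm (x k).
  elim: (n.+1) => [|m IH]; first by rewrite !big_geq// /enorm dotp0l sqrtr0.
  rewrite !big_nat_recr//=; apply: le_trans (enormD _ _) _; apply: lerD => //.
  by rewrite enormZ gtr0_norm.
move=> /le_trans; apply; rewrite mulr_suml; apply: ler_sum => k _.
by apply: ler_wpM2l => //; exact: ltW.
Qed.

End WeightedMeans.

(** * Cluster points and countable dense families *)

Section ClusterPoints.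
Context {R : realType} {N : nat}.
Local Notation E := 'rV[R]_N.

Lemma cvg_unique_cluster (f : nat -> E) (p : E) (C : R) :
  (forall n, dotp (f n) (f n) <= C) ->
  (forall (s : nat -> nat) l, {homo s : m n / (m < n)%N} ->
    f (s n) @[n --> \oo] --> l -> l = p) ->
  f @ \oo --> p.
Proof.
move=> fC uniq; apply: contrapT => nfp.
have [e e0 He] : exists2 e : R, 0 < e & forall m, exists n, (m <= n)%N /\ e < `|p - f n|.
  apply: contrapT => H; apply: nfp; apply/cvgrPdist_le => e e0.
  apply: contrapT => nH; apply: H; exists e => // m.
  apply: contrapT => Hm; apply: nH; exists m => // n /= mn.
  by rewrite leNgt; apply/negP => lt; apply: Hm; exists n.
have /choice[r rP] := He.
pose s := fix s k := if k is j.+1 then r (s j).+1 else r 0%N.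
have sP k : e < `|p - f (s k)| by case: k => [|k]; exact: (rP _).2.
have si : {homo s : m n / (m < n)%N}.
  apply: homo_ltn => [|k]; first exact: ltn_trans.
  exact: (rP (s k).+1).1.
have [t ti [l fl]] := bolzano_weierstrass_row (fun n => fC (s n)).
have lp : l = p.
  apply: (uniq (s \o t)) => // m n mn; exact/si/ti.
have := fl; rewrite lp => /cvgrPdist_le/(_ _ e0)[m _ /(_ m (leqnn m))] /=.
by rewrite leNgt sP.
Qed.

(** For each rational pair and each [m] a point of [S] within [1 / (m + 1)] of the pair is chosen
    when there is one, and [p0] otherwise. A point of [S] has a rational pair that close, and the
    point chosen for it is at distance below [2 / (m + 1) < e]. The sequence thus lies in [S]
    itself. *)
Lemma countable_dense_pairs (S : set (E * E)) : S !=set0 ->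
  exists s : nat -> E * E, (forall n, S (s n)) /\
    forall p (e : R), S p -> 0 < e ->
      exists n, enorm (p.1 - (s n).1) < e /\ enorm (p.2 - (s n).2) < e.
Proof.
move=> [p0 Sp0].
pose I : countType := ('rV[rat]_N * 'rV[rat]_N * nat)%type.
pose close_to (i : I) (p : E * E) := S p /\
  (enorm (p.1 - map_mx ratr i.1.1) < harmonic i.2 /\
   enorm (p.2 - map_mx ratr i.1.2) < harmonic i.2).
pose s n : E * E := if @choice.unpickle I n is Some i then xget p0 (close_to i) else p0.
have Ss n : S (s n).
  by rewrite /s; case: choice.unpickle => // i; case: xgetP => // _ -> [].
exists s; split=> // p e Sp e0.
have [m _ /(_ m (leqnn m))] : \forall m \near \oo, harmonic m < e / 2 :> R.
  have e20 : 0 < e / 2 by rewrite divr_gt0.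
  have /cvgrPdist_lt/(_ _ e20) := @cvg_harmonic R.
  by apply: filterS => m; rewrite sub0r normrN => /(le_lt_trans (ler_norm _)).
move=> /= me.
have h0 : 0 < harmonic m :> R by rewrite invr_gt0.
have app (z : E) : exists q : 'rV[rat]_N, enorm (z - map_mx ratr q) < harmonic m.
  have d0 : 0 < harmonic m / N.+1%:R :> R by rewrite divr_gt0.
  have /choice[q qP] (i : 'I_N) : exists q : rat,
      `|z 0 i - ratr q| < harmonic m / N.+1%:R.
    have lt : z 0 i - harmonic m / N.+1%:R < z 0 i + harmonic m / N.+1%:R.
      by rewrite ltrBlDr -addrA ltrDl addr_gt0.
    have [q] := rat_in_itvoo lt; rewrite in_itv/= => /andP[h1 h2].
    by exists q; rewrite distrC ltr_distl h1 h2.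
  exists (\row_i q i); apply: le_lt_trans (enorm_le_sum _) _.
  apply: (@le_lt_trans _ _ (\sum_(i < N) (harmonic m / N.+1%:R))).
    by apply: ler_sum => i _; rewrite !mxE ltW.
  rewrite sumr_const card_ord -[ltLHS]mulr_natr -mulrA gtr_pMr//.
  by rewrite mulrC ltr_pdivrMr// mul1r ltr_nat.
have [q1 h1] := app p.1; have [q2 h2] := app p.2.
pose i : I := ((q1, q2), m).
exists (choice.pickle i); rewrite /s choice.pickleK.
case: xgetP => [r -> [_ [r1 r2]]|/(_ p)]; last by case; split.
have tri (a q c : E) : enorm (a - q) < harmonic m -> enorm (c - q) < harmonic m ->
    enorm (a - c) < e.
  move=> aq cq; rewrite -[a - c](subrKA q); apply: le_lt_trans (enormD _ _) _.
  have : enorm (q - c) < harmonic m by rewrite -enormN opprB.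
  by move=> qc; rewrite [ltRHS](splitr e) ltrD// (lt_trans _ me).
by split; [exact: tri h1 r1|exact: tri h2 r2].
Qed.

End ClusterPoints.

(** * Convergence of the weighted means along one path *)

Section Pathwise.
Context {R : realType} {N : nat}.
Local Notation E := 'rV[R]_N.
Context (g : nat -> R) (x : nat -> E).
Hypothesis g_gt0 : forall n, 0 < g n.
Hypothesis g_infty : forall C : R, exists m, forall n, (m <= n)%N ->
  C <= \sum_(0 <= k < n) g k.

Definition quasi_fejer (p : E * E) := exists2 c : nat -> R, cvgn c &
  forall n, dotp (x n.+1 - p.1) (x n.+1 - p.1) + 2 * g n * dotp p.2 (x n - p.1)
    + 2^-1 * dotp (x n.+1 - x n) (x n.+1 - x n)
    <= dotp (x n - p.1) (x n - p.1) + (c n.+1 - c n).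

Let sq_ge0 (z : E) : 0 <= dotp z z := dotp_ge0 z.

Let cvgn_bounded (c : nat -> R) : cvgn c -> exists C : R, forall n, `|c n| <= C.
Proof.
move=> /cvg_seq_bounded[D [_ DP]]; exists (D + 1) => n.
by apply: DP => //; rewrite ltrDl.
Qed.

(** [|x n - z|^2 - c n] is nonincreasing and bounded below, and twice its decrement dominates
    [|x n.+1 - x n|^2]. *)
Lemma quasi_fejer_cvg z : quasi_fejer (z, 0) ->
  cvgn (fun n => dotp (x n - z) (x n - z)) /\
  dotp (x n.+1 - x n) (x n.+1 - x n) @[n --> \oo] --> 0.
Proof.
move=> [c cc H].
pose W n := dotp (x n - z) (x n - z) - c n.
have HW n : W n.+1 + 2^-1 * dotp (x n.+1 - x n) (x n.+1 - x n) <= W n.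
  by have := H n; rewrite /= dotp0l mulr0 addr0 /W; lra.
have [C cC] := cvgn_bounded cc.
have cW : cvgn W.
  apply: nonincreasing_is_cvgn.
    apply/nonincreasing_seqP => n; have := HW n; have := sq_ge0 (x n.+1 - x n); lra.
  exists (- C) => _ [n _ <-]; rewrite /W.
  by have := cC n; have := sq_ge0 (x n - z); rewrite ler_norml => ? /andP[]; lra.
split.
  have -> : (fun n => dotp (x n - z) (x n - z)) = W \+ c.
    by apply/funext => n; rewrite /W /= subrK.
  exact: is_cvgD.
have cD : 2 * (W n - W n.+1) @[n --> \oo] --> 0.
  have -> : 0 = 2 * (limn W - limn W) :> R by rewrite subrr mulr0.
  apply: cvgM; first exact: cvg_cst.
  apply: cvgB; first exact: cW.
  by rewrite (cvg_shiftS W (nbhs (limn W))).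
apply: (squeeze_cvgr _ (cvg_cst 0) cD); apply: nearW => n.
by rewrite sq_ge0/=; have := HW n; lra.
Qed.

Lemma quasi_fejer_mean p : quasi_fejer p ->
  exists C, forall n, \sum_(0 <= k < n) g k * dotp p.2 (x k - p.1) <= C.
Proof.
move=> [c cc H]; have [C cC] := cvgn_bounded cc.
exists (dotp (x 0%N - p.1) (x 0%N - p.1) + 2 * C) => n.
have : dotp (x n - p.1) (x n - p.1) + 2 * \sum_(0 <= k < n) g k * dotp p.2 (x k - p.1)
   <= dotp (x 0%N - p.1) (x 0%N - p.1) + (c n - c 0%N).
  elim: n => [|n IH]; first by rewrite big_geq// mulr0 subrr.
  rewrite big_nat_recr//=; have := H n; have := sq_ge0 (x n.+1 - x n).
  by move: IH; rewrite -mulrA; lra.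
have := cC n; have := cC 0%N; have := sq_ge0 (x n - p.1).
have := sq_ge0 (x 0%N - p.1).
rewrite !ler_norml => h1 h2 /andP[h3 h4] /andP[h5 h6]; lra.
Qed.

Context (S : set (E * E)) (s s0 : nat -> E * E).
Hypothesis Szero : forall p : E, (forall q, S q -> 0 <= dotp q.2 (q.1 - p)) -> S (p, 0).
Hypothesis s_fejer : forall n, quasi_fejer (s n).
Hypothesis s_dense : forall p (e : R), S p -> 0 < e ->
  exists n, enorm (p.1 - (s n).1) < e /\ enorm (p.2 - (s n).2) < e.
(** A second sequence is needed for the points [(p, 0)]: points of [S] near [(p, 0)] may have
    nonzero second component, and only a zero one makes the distances to the iterates converge. *)
Hypothesis s0_fejer : forall n, quasi_fejer (s0 n).
Hypothesis s0_zero : forall n, (s0 n).2 = 0.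
Hypothesis s0_dense : forall p (e : R), S (p, 0) -> 0 < e ->
  exists n, enorm (p - (s0 n).1) < e.

Let fejer0 n : quasi_fejer ((s0 n).1, 0).
Proof. by rewrite -(s0_zero n) -surjective_pairing. Qed.

Let norm_cvg n : cvgn (fun k => enorm (x k - (s0 n).1)).
Proof.
have [h _] := quasi_fejer_cvg (fejer0 n).
apply/cvg_ex; eexists; apply: (cvg_comp _ _ h); exact: sqrt_continuous.
Qed.

Let x_bounded : exists C, forall n, enorm (x n) <= C.
Proof.
have [C H] := cvgn_bounded (@norm_cvg 0%N).
exists (C + enorm (s0 0%N).1) => n; rewrite -{1}[x n](subrK (s0 0%N).1).
apply: le_trans (enormD _ _) _; rewrite lerD2r.
exact: le_trans (ler_norm _) (H n).
Qed.

Let step0 : enorm (x n.+1 - x n) @[n --> \oo] --> 0.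
Proof.
have [_ h] := quasi_fejer_cvg (fejer0 0%N).
by rewrite -(@sqrtr0 R); apply: (cvg_comp _ _ h); exact: sqrt_continuous.
Qed.

(** The distance of [x k] to [p] differs from that to [s0 n] by at most the distance of [p] to
    [s0 n], uniformly in [k]; hence a Cauchy sequence. *)
Let zero_norm_cvg p : S (p, 0) -> cvgn (fun k => enorm (x k - p)).
Proof.
move=> Sp; apply/cauchy_cvgP/cauchy_exP => e e0.
have e30 : 0 < e / 3 by rewrite divr_gt0.
have [n pn] := s0_dense Sp e30.
have cn := @norm_cvg n.
pose l := limn (fun k => enorm (x k - (s0 n).1)).
exists l; have /cvgrPdist_lt/(_ _ e30)[m _ mP] := cn.
exists m => // k /= mk; rewrite /ball/=.
have h1 := mP k mk.
have h2 : `|enorm (x k - (s0 n).1) - enorm (x k - p)| <= enorm (p - (s0 n).1).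
  have t1 := enormD (x k - p) (p - (s0 n).1).
  have t2 := enormD (x k - (s0 n).1) ((s0 n).1 - p).
  rewrite !subrKA in t1 t2.
  have t3 : enorm ((s0 n).1 - p) = enorm (p - (s0 n).1) by rewrite -enormN opprB.
  by rewrite ler_norml; apply/andP; split; lra.
rewrite -[l - _](subrKA (enorm (x k - (s0 n).1))).
apply: le_lt_trans (ler_normD _ _) _.
rewrite -/l in h1; lra.
Qed.

Let xbar n := wmean g (fun k => x k.+1) n.

Let xbar_bounded : exists C, forall n, dotp (xbar n) (xbar n) <= C.
Proof.
have [C xC] := x_bounded; exists (C ^+ 2) => n.
have C0 : 0 <= C := le_trans (enorm_ge0 _) (xC 0%N).
rewrite -sqr_enorm ler_pXn2r ?nnegrE ?enorm_ge0//.
exact: (wmean_bounded g_gt0 (fun k => xC k.+1)).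
Qed.

(** The means average [x k.+1] with weight [g k], while the drift is taken at [x k]. The discrepancy
    [b n] is an average of [<p.2, x k.+1 - x k>], which vanishes because the steps tend to 0. *)
Let cluster_le p (t : nat -> nat) (l : E) : quasi_fejer p -> {homo t : m n / (m < n)%N} ->
  xbar (t n) @[n --> \oo] --> l -> dotp p.2 (l - p.1) <= 0.
Proof.
move=> fp ti tl; have [C HC] := quasi_fejer_mean fp.
have t_infty := homo_ltn_cvg ti.
pose b n := (\sum_(0 <= k < n) g k)^-1 *
    (\sum_(0 <= k < n) g k * dotp p.2 (x k.+1 - x k)).
have b0 : b @ \oo --> 0.
  apply: toeplitz => //.
  have cl : enorm p.2 * enorm (x n.+1 - x n) @[n --> \oo] --> 0.
    by rewrite -(mulr0 (enorm p.2)); apply: cvgM; [exact: cvg_cst|exact: step0].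
  apply/cvgrPdist_le => e e0; have /cvgrPdist_le/(_ _ e0) := cl.
  apply: filterS => n; rewrite !sub0r !normrN => H.
  apply: le_trans (normr_dotp_le _ _) _.
  by apply: le_trans H; exact: ler_norm.
have bnd n : (0 < n)%N -> dotp p.2 (xbar n - p.1) <=
    (\sum_(0 <= k < n) g k)^-1 * C + b n.
  move=> n0; have G0 := weights_gt0 g_gt0 n0.
  rewrite dotpBr /xbar dotp_wmean /b -mulrDr ler_pdivlMl//.
  rewrite mulrBr mulrA mulfV ?gt_eqF// mul1r.
  apply: le_trans (lerD (HC n) (lexx _)).
  rewrite mulr_suml -sumrB -big_split/= le_eqVlt; apply/orP; left; apply/eqP.
  by apply: eq_bigr => k _; rewrite !dotpBr; ring.
have l1 : dotp p.2 (xbar (t n) - p.1) @[n --> \oo] --> dotp p.2 (l - p.1).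
  by apply: cvg_dotp; [exact: cvg_cst|apply: cvgB => //; exact: cvg_cst].
have l2 : (\sum_(0 <= k < n) g k)^-1 * C + b n @[n --> \oo] --> 0 + 0.
  by apply: cvgD => //; exact: cvg_over_weights.
have l3 := cvg_comp _ _ t_infty l2; rewrite addr0 in l3.
apply: (ler_cvg_to l1 l3); exists 1%N => // n /= n1; apply: bnd.
by case: n n1 => // n _; apply: leq_ltn_trans (leq0n (t 0%N)) _; exact: ti.
Qed.

Let cluster_zero (t : nat -> nat) (l : E) : {homo t : m n / (m < n)%N} ->
  xbar (t n) @[n --> \oo] --> l -> forall q, S q -> 0 <= dotp q.2 (q.1 - l).
Proof.
move=> ti tl q Sq; rewrite leNgt; apply/negP => neg.
set D := - dotp q.2 (q.1 - l); have D0 : 0 < D by rewrite oppr_gt0.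
pose B := 1 + enorm q.2 + enorm (q.1 - l).
have B0 : 0 < B.
  by have := enorm_ge0 q.2; have := enorm_ge0 (q.1 - l); rewrite /B; lra.
(* [e <= 1] bounds [|v|] by [|q.2| + 1]; then [e * B <= D / 2] keeps both approximation errors
   together below [D / 2]. *)
pose e := Num.min 1 (D / (2 * B)).
have e0 : 0 < e by rewrite lt_min ltr01 divr_gt0// mulr_gt0.
have [n [n1 n2]] := s_dense Sq e0.
have := cluster_le (s_fejer n) ti tl.
set v := (s n).2 in n2 *; set a := (s n).1 in n1 *.
have -> : dotp v (l - a) = D + dotp (q.2 - v) (q.1 - l) + dotp v (q.1 - a).
  by rewrite /D !dotpBr !dotpBl; ring.
have h1 := normr_dotp_le (q.2 - v) (q.1 - l).
have h2 := normr_dotp_le v (q.1 - a).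
have h3 : enorm v <= enorm q.2 + 1.
  have -> : v = (v - q.2) + q.2 by rewrite subrK.
  apply: le_trans (enormD _ _) _; rewrite addrC lerD2l -enormN opprB.
  by apply: (le_trans (ltW n2)); rewrite ge_min lexx.
have eD : e * B <= D / 2.
  have : e <= D / (2 * B) by rewrite ge_min lexx orbT.
  rewrite -(ler_pM2r B0) => /le_trans; apply.
  by rewrite le_eqVlt; apply/orP; left; apply/eqP; field; rewrite gt_eqF.
have h4 : enorm (q.2 - v) * enorm (q.1 - l) + enorm v * enorm (q.1 - a) <= e * B.
  rewrite /B mulrDr addrC; apply: lerD.
    by rewrite mulrC; apply: ler_pM; rewrite ?enorm_ge0//; [exact: ltW|rewrite addrC].
  by apply: ler_wpM2r; [exact: enorm_ge0|exact: ltW].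
move: h1 h2; rewrite !ler_norml => /andP[h1 _] /andP[h2 _]; lra.
Qed.

(** Polarization: up to a constant, twice this product is [|x n - p'|^2 - |x n - p|^2]. *)
Let inner_cvg p p' : S (p, 0) -> S (p', 0) -> cvgn (fun n => dotp (x n) (p - p')).
Proof.
move=> Sp Sp'.
have sqc z : S (z, 0) -> cvgn (fun n => enorm (x n - z) ^+ 2).
  by move=> /zero_norm_cvg h; apply: is_cvgM.
have -> : (fun n => dotp (x n) (p - p')) = (fun n => 2^-1 *
    ((enorm (x n - p') ^+ 2 - enorm (x n - p) ^+ 2) + (dotp p p - dotp p' p'))).
  apply/funext => n; rewrite !sqr_enorm !dotpBl !dotpBr (dotpC p (x n)) (dotpC p' (x n)).
  by field.
apply: is_cvgM; first exact: is_cvg_cst.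
apply: is_cvgD; last exact: is_cvg_cst.
by apply: is_cvgB; exact: sqc.
Qed.

Lemma pathwise_convergence : exists U : E,
  (forall q, S q -> 0 <= dotp q.2 (q.1 - U)) /\ xbar n @[n --> \oo] --> U.
Proof.
have [C xC] := xbar_bounded.
have [t ti [U tU]] := bolzano_weierstrass_row xC.
exists U; split; first exact: cluster_zero ti tU.
apply: (cvg_unique_cluster xC) => t' U' t'i t'U'.
have SU := Szero (cluster_zero ti tU); have SU' := Szero (cluster_zero t'i t'U').
have cl := inner_cvg SU' SU; set l := limn _ in cl.
have cl1 : dotp (U' - U) (x n.+1) @[n --> \oo] --> l.
  rewrite (_ : (fun n => _) = fun n => dotp (x n.+1) (U' - U)).
    by rewrite (cvg_shiftS (fun n => dotp (x n) (U' - U)) (nbhs l)).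
  by apply/funext => n; rewrite dotpC.
(* Averaging keeps the limit [l], so the linear form of [U' - U] takes the same value [l] at both
   cluster points. *)
have cl2 := toeplitz g_gt0 g_infty cl1.
have cl3 : dotp (U' - U) (xbar n) @[n --> \oo] --> l.
  by under eq_cvg do rewrite /xbar dotp_wmean.
have e1 : dotp (U' - U) U = l.
  apply: (cvg_unique _ (cvg_dotp (cvg_cst _) tU)); first exact: Rhausdorff.
  exact: (cvg_comp _ _ (homo_ltn_cvg ti) cl3).
have e2 : dotp (U' - U) U' = l.
  apply: (cvg_unique _ (cvg_dotp (cvg_cst _) t'U')); first exact: Rhausdorff.
  exact: (cvg_comp _ _ (homo_ltn_cvg t'i) cl3).
apply/eqP; rewrite -subr_eq0; apply/eqP; apply: dotp_eq0.
by rewrite dotpBr e1 e2 subrr.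
Qed.

End Pathwise.

(** * The stochastic forward-backward algorithm *)

Section Summability.
Context {R : realType}.

Lemma summable_ae d (T : measurableType d) (P : probability T R) (G : nat -> T -> R) (K : R) :
  (forall k w, 0 <= G k w) -> (forall k, intg P (G k)) ->
  (forall n, \sum_(0 <= k < n) \int[P]_w G k w <= K) ->
  {ae P, forall w, cvgn (fun n => \sum_(0 <= k < n) G k w)}.
Proof.
move=> G0 iG GK.
pose S w : \bar R := (\sum_(k <oo) (G k w)%:E)%E.
have mG k : measurable_fun setT (G k) by exact: intg_measurable (iG k).
have S0 w : (0 <= S w)%E by apply: nneseries_ge0 => k _ _; rewrite lee_fin.
have mS : measurable_fun setT S.
  by apply: ge0_emeasurable_sum => [k t _ _|k _]; [rewrite lee_fin|exact/measurable_EFinP].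
have iS : P.-integrable setT S.
  apply/integrableP; split=> //.
  under eq_integral do rewrite gee0_abs//.
  rewrite integral_nneseries//; last 2 first.
  - by move=> k; exact/measurable_EFinP.
  - by move=> k t _; rewrite lee_fin.
  apply: (@le_lt_trans _ _ K%:E); last exact: ltry.
  apply: lime_le; first by apply: is_cvg_nneseries => k _ _; apply: integral_ge0 => t _; rewrite lee_fin.
  apply: nearW => n; rewrite (eq_bigr (fun k => (\int[P]_w G k w)%:E)); last first.
    by move=> k _; rewrite intg_fin.
  by rewrite sumEFin lee_fin.
apply: filterS (integrable_ae measurableT iS) => w /(_ I) fS.
apply: nondecreasing_is_cvgn.
  move=> m n mn; apply: (@nondecreasing_series R (fun k => G k w) xpredT 0%N) => // k _ _.
exists (fine (S w)) => _ [n _ <-].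
rewrite -lee_fin fineK// -sumEFin.
by apply: nneseries_lim_ge => k _ _; rewrite lee_fin.
Qed.

(** The quantity [1 + a n] grows by a factor at most [1 + c * g n ^+ 2 <= expR (c * g n ^+ 2)]. *)
Lemma discrete_gronwall (a g : nat -> R) (c K : R) : 0 <= c ->
  (forall n, 0 <= a n) -> (forall n, \sum_(0 <= k < n) g k ^+ 2 <= K) ->
  (forall n, a n.+1 <= (1 + c * g n ^+ 2) * a n + c * g n ^+ 2) ->
  forall n, a n <= (1 + a 0%N) * expR (c * K).
Proof.
move=> c0 a0 gK rec n.
have H : 1 + a n <= (1 + a 0%N) * expR (c * \sum_(0 <= k < n) g k ^+ 2).
  elim: n => [|n IH]; first by rewrite big_geq// mulr0 expR0 mulr1.
  rewrite big_nat_recr//= mulrDr expRD mulrA.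
  have e1 : 1 + c * g n ^+ 2 <= expR (c * g n ^+ 2) := expR_ge1Dx _.
  have q0 : 0 <= c * g n ^+ 2 by rewrite mulr_ge0// sqr_ge0.
  apply: (@le_trans _ _ ((1 + a n) * (1 + c * g n ^+ 2))).
    by have := rec n; have := a0 n; lra.
  by apply: ler_pM => //; rewrite addr_ge0.
apply: le_trans (_ : 1 + a n <= _); first by rewrite lerDr.
apply: le_trans H _; apply: ler_wpM2l; first by rewrite addr_ge0.
by rewrite ler_expR ler_wpM2l.
Qed.

End Summability.

Section ForwardBackwardStep.
Context {R : realType} {N : nat}.
Local Notation E := 'rV[R]_N.

(** Put [D = J - x] and [q = phi + b]. Monotonicity of [A] between [J] and [z] gives the drift at
    [J]. Replacing [J] by [x] leaves [-2 g <q, D> - |D|^2 / 2], at most [2 g^2 |q|^2] because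
    [|2 g q + D|^2 >= 0]. *)
Lemma forward_backward_step (A : operator R N) (g : R) (x z b phi psi : E) :
  maximal_monotone A -> 0 < g -> A z phi -> 0 <= dotp (b - psi) (x - z) ->
  dotp (resolvent g A (x - g *: b) - z) (resolvent g A (x - g *: b) - z)
  + 2 * g * dotp (phi + psi) (x - z)
  + 2^-1 * dotp (resolvent g A (x - g *: b) - x) (resolvent g A (x - g *: b) - x)
  <= dotp (x - z) (x - z) + 2 * g ^+ 2 * dotp (phi + b) (phi + b).
Proof.
move=> mA g0 Az bpsi.
have := monotone_le (maximal_monotone_mon mA) (resolventP (x - g *: b) mA g0) Az.
set J := resolvent _ _ _ => h1.
have [D DE] : exists D, D = J - x by eexists.
have [a aE] : exists a, a = x - z by eexists.
have [q qE] : exists q, q = phi + b by eexists.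
have JE : J - z = a + D by rewrite DE aE; apply/rowP => i; rewrite !mxE; ring.
have h2 : 0 <= dotp (- D - g *: q) (a + D).
  rewrite -JE; have -> : - D - g *: q = g *: (g^-1 *: (x - g *: b - J) - phi).
    rewrite scalerBr scalerA mulfV ?gt_eqF// scale1r DE qE.
    by apply/rowP => i; rewrite !mxE; ring.
  by rewrite dotpZl mulr_ge0// ltW.
have h3 := dotp_ge0 ((2 * g) *: q + D).
have h4 : dotp (phi + psi) a = dotp q a - dotp (b - psi) a.
  by rewrite qE !dotpDl dotpNl; ring.
have h5 : 0 <= g * dotp (b - psi) a by rewrite aE mulr_ge0// ltW.
rewrite JE -DE -aE -qE h4.
rewrite !dotpDl !dotpDr !dotpNl !dotpZl (dotpC D a) in h2.
rewrite !dotpDl !dotpDr !dotpZl !dotpZr (dotpC D q) in h3.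
have -> : dotp (a + D) (a + D) = dotp a a + 2 * dotp a D + dotp D D.
  by rewrite !dotpDl !dotpDr (dotpC D a); ring.
have -> : 2 * g * (dotp q a - dotp (b - psi) a) =
  2 * (g * dotp q a) - 2 * (g * dotp (b - psi) a) by ring.
have h3' : 0 <= 4 * (g ^+ 2 * dotp q q) + 4 * (g * dotp q D) + dotp D D.
  by move: h3; congr (_ <= _); ring.
have -> : 2 * g ^+ 2 * dotp q q = 2 * (g ^+ 2 * dotp q q) by ring.
lra.
Qed.

(* A nonexpansive [J] satisfies [J_i z = inf_q (J_i q + |z - q|)] over rational
   [q], so measurability in [xi] at each [q] gives joint measurability. *)
Lemma rmeas_resolvent d (Xi : measurableType d) (A : Xi -> operator R N)
    d' (T : measurableType d') (s : T -> Xi) (v : T -> E) (g : R) :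
  random_maximal_monotone A -> 0 < g -> measurable_fun setT s -> rmeas v ->
  rmeas (fun w => resolvent g (A (s w)) (v w)).
Proof.
move=> hA g0 ms mv i; have [mA _] := hA.
apply: (measurability _ (RGenInftyO.measurableE R)).
move=> /= _ [_ [c ->]] <-; rewrite setTI.
pose f (q : 'rV[rat]_N) w := resolvent g (A (s w)) (map_mx ratr q) 0 i +
  enorm (v w - map_mx ratr q).
have mf q : measurable_fun setT (f q).
  apply: measurable_funD.
    exact: (measurableT_comp (measurable_resolvent (map_mx ratr q) hA g0 i) ms).
  by apply: measurable_enorm; apply: rmeasB => //; exact: rmeas_cst.
have -> : (fun w => resolvent g (A (s w)) (v w) 0 i) @^-1` `]-oo, c[%classic =
    \bigcup_q (f q @^-1` `]-oo, c[%classic).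
  have lip w q : `|resolvent g (A (s w)) (v w) 0 i -
      resolvent g (A (s w)) (map_mx ratr q) 0 i| <= enorm (v w - map_mx ratr q).
    have := normr_coord_le (resolvent g (A (s w)) (v w) -
      resolvent g (A (s w)) (map_mx ratr q)) i.
    rewrite !mxE => /le_trans; apply; rewrite le_enorm.
    exact: resolvent_nonexpansive.
  apply/seteqP; split=> w /=; rewrite in_itv/=; last first.
    move=> [q _] /=; rewrite in_itv/= /f; have := lip w q.
    by rewrite ler_norml => /andP[h1 h2] h3; apply: le_lt_trans h3; lra.
  move=> Jc; pose e := c - resolvent g (A (s w)) (v w) 0 i.
  have e0 : 0 < e by rewrite subr_gt0.
  have d0 : 0 < e / 2 / N.+1%:R by rewrite !divr_gt0.
  have /choice[q qP] (j : 'I_N) : exists q : rat,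
      `|v w 0 j - ratr q| < e / 2 / N.+1%:R.
    have lt : v w 0 j - e / 2 / N.+1%:R < v w 0 j + e / 2 / N.+1%:R.
      by rewrite ltrBlDr -addrA ltrDl addr_gt0.
    have [q] := rat_in_itvoo lt; rewrite in_itv/= => /andP[h1 h2].
    by exists q; rewrite distrC ltr_distl h1 h2.
  exists (\row_j q j) => //=; rewrite in_itv/= /f.
  have vq : enorm (v w - map_mx ratr (\row_j q j)) < e / 2.
    apply: le_lt_trans (enorm_le_sum _) _.
    apply: (@le_lt_trans _ _ (\sum_(j < N) (e / 2 / N.+1%:R))).
      by apply: ler_sum => j _; rewrite !mxE ltW.
    rewrite sumr_const card_ord -[ltLHS]mulr_natr -mulrA gtr_pMr ?divr_gt0//.
    by rewrite mulrC ltr_pdivrMr// mul1r ltr_nat.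
  have := lip w (\row_j q j); rewrite ler_norml => /andP[h1 h2].
  by rewrite /e in vq e0 *; lra.
apply: countable_bigcupT_measurable => // q.
by rewrite -[X in measurable X]setTI; exact: mf.
Qed.

End ForwardBackwardStep.

(** * The step inequality along the random iterates *)

Section StochasticForwardBackward.
Context (R : realType) (N : nat) d (Xi : measurableType d) (mu : probability Xi R).
Local Notation E := 'rV[R]_N.
Context (A B : Xi -> operator R N) (b : Xi -> E -> E) (M : Xi -> R).
Hypothesis hA : random_maximal_monotone A.
Hypothesis mB : forall xi, maximal_monotone (B xi).
Hypothesis b_meas : measurable_fun setT
  ((fun z => b z.1 z.2) : Xi * borelRV R N -> borelRV R N).
Hypothesis b_sel : forall x, selections mu 1 (fun xi => B xi x) (b ^~ x).
Hypothesis M0 : forall xi, 0 <= M xi.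
Hypothesis M2 : intg mu (fun xi => M xi ^+ 2).
Hypothesis bM : forall xi x, enorm (b xi x) <= M xi * (1 + enorm x).
Context d' (Omega : measurableType d') (P : probability Omega R) (u : nat -> Omega -> Xi).
Hypothesis u_iid : iid_with_law P mu u.
Context (gamma : nat -> R) (x0 : E) (K : R).
Hypothesis gamma_gt0 : forall n, (0 < n)%N -> 0 < gamma n.
Hypothesis gamma2 : forall n, \sum_(0 <= k < n) gamma k.+1 ^+ 2 <= K.

Local Notation x := (fb_iter A b u gamma x0).
Local Notation g k := (gamma k.+1).

Lemma measurable_fb_iter n :
  forall i, measurable_fun setT ((fun w => x n w 0 i) : past u n -> R).
Proof.
elim: n => [|n IH]; first exact: rmeas_cst.
have mu_ : measurable_fun setT (u n.+1 : past u n.+1 -> Xi).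
  by apply: measurable_past_sample; rewrite ltnS leqnn.
have mx i : measurable_fun setT ((fun w => x n w 0 i) : past u n.+1 -> R).
  exact: measurable_past_le (leqnSn n) (IH i).
apply: rmeas_resolvent => //; first exact: gamma_gt0.
apply: rmeasB => //; apply: rmeasZ; first exact: measurable_cst.
have mxb : measurable_fun setT (x n : past u n.+1 -> borelRV R N).
  exact/measurable_rowP.
have mp : measurable_fun setT
    ((fun w => (u n.+1 w, x n w)) : past u n.+1 -> (Xi * borelRV R N)%type).
  exact/measurable_fun_pair.
have := measurableT_comp b_meas mp.
by move=> /measurable_rowP.
Qed.

Lemma rmeas_fb_iter n : rmeas (x n).
Proof. by move=> i; apply: (measurable_past u_iid (n := n)); exact: measurable_fb_iter. Qed.

Context (z : E) (phi psi : Xi -> E).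
Hypothesis phi2 : sqint mu phi.
Hypothesis psi2 : sqint mu psi.
Hypothesis Aphi : {ae mu, forall xi, A xi z (phi xi)}.
Hypothesis Bpsi : {ae mu, forall xi, B xi z (psi xi)}.
Let theta xi := phi xi + psi xi.
Let V n w := dotp (x n w - z) (x n w - z).

Lemma fb_iter_step : {ae P, forall w n,
  V n.+1 w + 2 * g n * dotp (theta (u n.+1 w)) (x n w - z)
  + 2^-1 * dotp (x n.+1 w - x n w) (x n.+1 w - x n w)
  <= V n w + 2 * g n ^+ 2 *
     dotp (phi (u n.+1 w) + b (u n.+1 w) (x n w)) (phi (u n.+1 w) + b (u n.+1 w) (x n w))}.
Proof.
have [mA _] := hA; have [mpsi _] := psi2.
apply: ae_foralln => n.
have ae1 := sample_ae u_iid (ltn0Sn n) Aphi.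
(* The null set where [b] fails to select from [B] depends on the point. The comparison with [psi]
   is therefore proved at each fixed [y] and carried to [x n] by [past_sample_null]. *)
pose C : set (borelRV R N * Xi) :=
  [set q | 0 <= dotp (b q.2 q.1 - psi q.2) ((q.1 : E) - z)].
have mC : measurable C.
  have -> : C = [set q | (0%:E <=
      (dotp (b q.2 q.1 - psi q.2) ((q.1 : E) - z))%:E)%E].
    by apply/seteqP; split => q; rewrite /C /= lee_fin.
  rewrite -[X in measurable X]setTI; apply: emeasurable_fun_c_infty => //.
  apply/measurable_EFinP; apply: measurable_dotp; apply: rmeasB.
  - have : measurable_fun setT ((fun q => b q.2 q.1) : borelRV R N * Xi -> borelRV R N).
      have ms : measurable_fun setT
          ((fun q => (q.2, q.1)) : borelRV R N * Xi -> (Xi * borelRV R N)%type).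
        by apply/measurable_fun_pair; [exact: measurable_snd|exact: measurable_fst].
      exact: (measurableT_comp b_meas ms).
    by move=> /measurable_rowP.
  - by move=> i; exact: (measurableT_comp (mpsi i) measurable_snd).
  - by move=> i; exact: (measurableT_comp (measurable_coord i) measurable_fst).
  - exact: rmeas_cst.
have mx : measurable_fun setT (x n : past u n -> borelRV R N).
  by apply/measurable_rowP; exact: measurable_fb_iter.
have ae2 := past_sample_null u_iid mx mC.
have aeC (y : borelRV R N) : {ae mu, forall xi, C (y, xi)}.
  have [_ By] := b_sel y.
  apply: filterS2 By Bpsi => xi h1 h2.
  exact: (monotone_le (maximal_monotone_mon (mB xi)) h1 h2).
apply: filterS2 ae1 (ae2 aeC) => w h1 h2.
exact: (forward_backward_step (mA _) (gamma_gt0 (ltn0Sn n)) h1 h2).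
Qed.

Let I1 := \int[mu]_xi dotp (phi xi) (phi xi).
Let I2 := \int[mu]_xi M xi ^+ 2.

Let I10 : 0 <= I1. Proof. exact: Rint_sqr_ge0. Qed.
Let I20 : 0 <= I2. Proof. by apply: Rintegral_ge0 => xi _; exact: sqr_ge0. Qed.

(** Bound for the noise in which the past enters only through [V n] and the new sample only through
    [phi] and [M], so that independence computes its mean. It uses [(1 + |x|)^2 <= 2 + 2 |x|^2] and
    [|x|^2 <= 2 V + 2 |z|^2]. *)
Let H n w := 4 * dotp (phi (u n.+1 w)) (phi (u n.+1 w)) +
  4 * ((2 + 4 * dotp z z + 4 * V n w) * M (u n.+1 w) ^+ 2).

Let noise_le n w : 2 * dotp (phi (u n.+1 w) + b (u n.+1 w) (x n w))
    (phi (u n.+1 w) + b (u n.+1 w) (x n w)) <= H n w.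
Proof.
have h1 := dotp_sqrD (phi (u n.+1 w)) (b (u n.+1 w) (x n w)).
have h2 : dotp (b (u n.+1 w) (x n w)) (b (u n.+1 w) (x n w)) <=
    (1 + enorm (x n w)) ^+ 2 * M (u n.+1 w) ^+ 2.
  rewrite -sqr_enorm mulrC -exprMn ler_pXn2r ?nnegrE ?enorm_ge0//.
  by rewrite mulr_ge0// addr_ge0// enorm_ge0.
have h3 : (1 + enorm (x n w)) ^+ 2 <= 2 + 4 * dotp z z + 4 * V n w.
  have := dotp_sqrD (x n w - z) z; rewrite subrK -sqr_enorm -/(V n w).
  by have := sqr_ge0 (1 - enorm (x n w)); rewrite !expr2; lra.
have h4 := ler_wpM2r (sqr_ge0 (M (u n.+1 w))) h3.
by rewrite /H; lra.
Qed.

Let mV n : measurable_fun setT (V n : past u n -> R).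
Proof.
apply: measurable_dotp; apply: rmeasB; try exact: rmeas_cst.
  exact: measurable_fb_iter.
exact: measurable_fb_iter.
Qed.

Let V0 n w : 0 <= V n w. Proof. exact: dotp_ge0. Qed.

Let noise_integral n : intg P (V n) -> intg P (H n) /\
  \int[P]_w H n w = 4 * I1 + 4 * ((2 + 4 * dotp z z + 4 * \int[P]_w V n w) * I2).
Proof.
move=> iV; have [_ iphi] := phi2.
have [ip ep] := sample_integral u_iid (ltn0Sn n) iphi.
have iW : intg P (fun w => 2 + 4 * dotp z z + 4 * V n w).
  by apply: intgD; [exact: intg_cst|exact: intgZ].
have mW : measurable_fun setT ((fun w => 2 + 4 * dotp z z + 4 * V n w) : past u n -> R).
  by apply: measurable_funD => //; apply: measurable_funM.
have [iq eq_] := past_sample_mul u_iid mW iW M2.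
have ip' : intg P (fun w => dotp (phi (u n.+1 w)) (phi (u n.+1 w))) := ip.
split; first by apply: intgD; exact: intgZ.
rewrite (RintD (intgZ 4 ip') (intgZ 4 iq)) (RintZ 4 ip') (RintZ 4 iq) eq_ ep.
by rewrite (RintD (intg_cst P _) (intgZ 4 iV)) Rint_cst RintZ.
Qed.

Let drift n w := dotp (theta (u n.+1 w)) (x n w - z).

Let sqint_x n : intg P (V n) -> sqint P (fun w => x n w - z).
Proof.
move=> iV; split => //; apply: rmeasB; [exact: rmeas_fb_iter|exact: rmeas_cst].
Qed.

Let theta2 : sqint mu theta. Proof. exact: sqintD. Qed.

Let drift_integral n : intg P (V n) -> intg P (drift n) /\
  \int[P]_w drift n w =
    \sum_i (\int[P]_w (x n w - z) 0 i * \int[mu]_xi theta xi 0 i).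
Proof.
move=> iV; have sx := sqint_x iV.
have mx i : measurable_fun setT ((fun w => (x n w - z) 0 i) : past u n -> R).
  by apply: rmeasB; [exact: measurable_fb_iter|exact: rmeas_cst].
have H1 i := past_sample_mul u_iid (mx i) (sqint_coord i sx) (sqint_coord i theta2).
have E1 : drift n = fun w => \sum_i ((x n w - z) 0 i * theta (u n.+1 w) 0 i).
  by apply/funext => w; apply: eq_bigr => i _; rewrite mulrC.
rewrite E1; split.
  by apply: intg_sum => i _; have [] := H1 i.
rewrite Rint_sum; last by move=> i _; have [] := H1 i.
by apply: eq_bigr => i _; have [] := H1 i.
Qed.

(** [V n.+1] is nonnegative and almost surely below a combination of [V n], the drift and the noise,
    which are integrable by independence of the new sample. Integrability is thus propagated
    together with the estimate. *)
Let moment_step n : intg P (V n) -> intg P (V n.+1) /\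
  \int[P]_w V n.+1 w <= \int[P]_w V n w - 2 * g n * \int[P]_w drift n w
    + g n ^+ 2 * \int[P]_w H n w.
Proof.
move=> iV; have [iH eH] := noise_integral iV; have [iD eD] := drift_integral iV.
have mV1 : measurable_fun setT (V n.+1) by exact: (measurable_past u_iid (n := n.+1)).
have i1 := intgB iV (intgZ (2 * g n) iD).
have i2 := intgD i1 (intgZ (g n ^+ 2) iH).
have [|h1 h2] := intg_ae_le mV1 i2.
- apply: filterS fb_iter_step => w /(_ n) st.
  rewrite ger0_norm; last exact: V0.
  have := noise_le n w; have := dotp_ge0 (x n.+1 w - x n w).
  have := sqr_ge0 (g n); rewrite -/(drift n w) in st *.
  move=> q0 h3 h4; have := ler_wpM2l q0 h4; lra.
split=> //.
have -> : \int[P]_w V n.+1 w = \int[P]_w `|V n.+1 w|.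
  by apply: eq_Rintegral => w _; rewrite ger0_norm//; exact: V0.
apply: le_trans h2 _.
by rewrite (RintD i1 (intgZ (g n ^+ 2) iH)) (RintB iV (intgZ _ iD)) !RintZ.
Qed.

Lemma fb_iter_sqint n : sqint P (x n).
Proof.
have iV : intg P (V n).
  elim: n => [|n IH]; first exact: (intg_cst P (dotp (x0 - z) (x0 - z))).
  by have [] := moment_step IH.
have -> : x n = fun w => (x n w - z) + z by apply/funext => w; rewrite subrK.
apply: sqintD; [exact: sqint_x|exact: sqint_cst].
Qed.

Let intg_V n : intg P (V n).
Proof.
by have [] : sqint P (fun w => x n w - z)
  by apply: sqintB; [exact: fb_iter_sqint|exact: sqint_cst].
Qed.

Lemma fb_iter_moment : vintegral mu theta = 0 ->
  exists C, forall n, \int[P]_w V n w <= C.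
Proof.
(* Chosen so that the mean of [H n] is at most [c * (1 + EV)]; the [4] beside [4 * dotp z z]
   accommodates the term [16 * EV * I2]. *)
move=> th0; pose c := 4 * I1 + 4 * ((4 + 4 * dotp z z) * I2).
have zz0 := dotp_ge0 z.
have c0 : 0 <= c.
  by rewrite addr_ge0 ?mulr_ge0// addr_ge0// mulr_ge0.
exists ((1 + \int[P]_w V 0%N w) * expR (c * K)).
apply: (@discrete_gronwall _ _ (fun k => g k) c K) => // n.
  by apply: Rintegral_ge0 => w _; exact: V0.
have [_ h] := moment_step (intg_V n).
have [_ eH] := noise_integral (intg_V n); have [_ eD] := drift_integral (intg_V n).
have D0 : \int[P]_w drift n w = 0.
  by rewrite eD big1// => i _; rewrite -(vintegralE mu theta) th0 mxE mulr0.
rewrite D0 mulr0 subr0 eH in h; apply: le_trans h _.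
have EV0 : 0 <= \int[P]_w V n w by apply: Rintegral_ge0 => w _; exact: V0.
set EV := \int[P]_w V n w in EV0 *.
have -> : (1 + c * g n ^+ 2) * EV + c * g n ^+ 2 = EV + g n ^+ 2 * (c * EV + c) by ring.
rewrite lerD2l; apply: ler_wpM2l; first exact: sqr_ge0.
have e1 : 0 <= I1 * EV by exact: mulr_ge0.
have e3 : 0 <= dotp z z * I2 * EV by rewrite !mulr_ge0.
rewrite -subr_ge0.
have -> : c * EV + c - (4 * I1 + 4 * ((2 + 4 * dotp z z + 4 * EV) * I2)) =
    4 * (I1 * EV) + 8 * I2 + 16 * (dotp z z * I2 * EV) by rewrite /c; ring.
by rewrite !addr_ge0// mulr_ge0.
Qed.

(** From here on the integral of [theta] is arbitrary, so the recursion no longer bounds the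
    moments; the bound found at a zero is supplied instead. *)
Hypothesis moment : exists C, forall n, \int[P]_w dotp (x n w) (x n w) <= C.

Let V_moment : exists2 C, 0 <= C & forall n, \int[P]_w V n w <= C.
Proof.
have [C xC] := moment.
exists (2 * (C + dotp z z)).
  apply: mulr_ge0 => //; apply: addr_ge0; last exact: dotp_ge0.
  by apply: le_trans (xC 0%N); exact: Rint_sqr_ge0.
move=> n; have [_ ix] := fb_iter_sqint n.
have i1 := intgD ix (intg_cst P (dotp z z)).
apply: le_trans (Rint_le (intg_V n) (intgZ 2 i1) _) _.
  by move=> w; exact: dotp_sqrB.
rewrite RintZ// (RintD ix (intg_cst P _)) Rint_cst.
by apply: ler_wpM2l => //; rewrite lerD2r.
Qed.

Let noise_summable : {ae P, forall w,
  cvgn (fun n => \sum_(0 <= k < n) g k ^+ 2 * H k w)}.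
Proof.
have [C C0 VC] := V_moment; have zz0 := dotp_ge0 z.
pose D := 4 * I1 + 4 * ((2 + 4 * dotp z z + 4 * C) * I2).
have D0 : 0 <= D.
  by rewrite addr_ge0 ?mulr_ge0// addr_ge0 ?mulr_ge0// addr_ge0// mulr_ge0.
apply: (@summable_ae _ _ _ P _ (K * D)).
- move=> k w; apply: mulr_ge0; first exact: sqr_ge0.
  by apply: le_trans (noise_le k w); rewrite mulr_ge0// dotp_ge0.
- by move=> k; have [iH _] := noise_integral (intg_V k); exact: intgZ.
- move=> n; apply: (@le_trans _ _ (\sum_(0 <= k < n) g k ^+ 2 * D)); last first.
    by rewrite -mulr_suml; apply: ler_wpM2r.
  apply: ler_sum => k _; have [iH eH] := noise_integral (intg_V k).
  rewrite RintZ//; apply: ler_wpM2l; first exact: sqr_ge0.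
  rewrite eH lerD2l; apply: ler_wpM2l => //; apply: ler_wpM2r => //.
  by rewrite lerD2l ler_wpM2l.
Qed.

Let y := vintegral mu phi + vintegral mu psi.

Let yE i : y 0 i = \int[mu]_xi theta xi 0 i.
Proof.
rewrite /y mxE !vintegralE -RintD; [|exact: sqint_coord|exact: sqint_coord].
by apply: eq_Rintegral => xi _; rewrite mxE.
Qed.

(** Each increment is a function of the past, with second moment at most [C * g k ^+ 2], times a
    centred square-integrable function of the new sample. *)
Let martingale_coord i : {ae P, forall w, cvgn (fun n =>
  \sum_(0 <= k < n) g k * (x k w - z) 0 i * (theta (u k.+1 w) 0 i - y 0 i))}.
Proof.
have [C C0 VC] := V_moment.
pose h xi := theta xi 0 i - y 0 i.
have ith := sqint_coord i theta2.
have h2s : sqint mu (fun xi => theta xi - y) by apply: sqintB => //; exact: sqint_cst.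
have subE (a c : E) : a 0 i - c 0 i = (a - c) 0 i by rewrite !mxE.
have hE xi : h xi = (theta xi - y) 0 i := subE _ _.
have ih : intg mu h := intgB ith (intg_cst mu (y 0 i)).
have ih2 : intg mu (fun xi => h xi ^+ 2).
  by have := sqint_coord2 i h2s; apply: eq_integrable => // xi _ /=; rewrite hE.
have h0 : \int[mu]_xi h xi = 0.
  by rewrite (RintB ith (intg_cst mu _)) Rint_cst -yE subrr.
pose W k w := g k * (x k w - z) 0 i.
have mW k : measurable_fun setT (W k : past u k -> R).
  apply: measurable_funM => //.
  by apply: rmeasB; [exact: measurable_fb_iter|exact: rmeas_cst].
have mWo k : measurable_fun setT (W k) by exact: (measurable_past u_iid (n := k)).
have sx k : sqint P (fun w => x k w - z).
  by apply: sqintB; [exact: fb_iter_sqint|exact: sqint_cst].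
have W2E k : (fun w => W k w ^+ 2) = fun w => g k ^+ 2 * ((x k w - z) 0 i ^+ 2).
  by apply/funext => w; rewrite /W exprMn.
have iW2 k : intg P (fun w => W k w ^+ 2).
  by rewrite W2E; apply: intgZ; exact: sqint_coord2 (sx k).
have EW2 k : \int[P]_w W k w ^+ 2 <= g k ^+ 2 * C.
  rewrite W2E RintZ; last exact: sqint_coord2 (sx k).
  apply: ler_wpM2l; first exact: sqr_ge0.
  apply: le_trans (VC k); apply: Rint_le => //; first exact: sqint_coord2 (sx k).
  by move=> w; exact: sqr_coord_le.
have mW2 k : measurable_fun setT ((fun w => W k w ^+ 2) : past u k -> R).
  exact: measurable_funX.
have X2 k := past_sample_mul u_iid (mW2 k) (iW2 k) ih2.
have X2E k : (fun w => (W k w * h (u k.+1 w)) ^+ 2) =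
    fun w => W k w ^+ 2 * h (u k.+1 w) ^+ 2.
  by apply/funext => w; rewrite exprMn.
have hh0 : 0 <= \int[mu]_xi h xi ^+ 2 by apply: Rintegral_ge0 => xi _; exact: sqr_ge0.
apply: (@orthogonal_series_cvg _ _ _ _ _ P mu u u_iid (fun k w => W k w * h (u k.+1 w))
  (K * (C * \int[mu]_xi h xi ^+ 2))).
- move=> k; apply: measurable_funM; first exact: measurable_past_le (leqnSn k) (mW k).
  have mu_ : measurable_fun setT (u k.+1 : past u k.+1 -> Xi).
    by apply: measurable_past_sample; rewrite ltnS leqnn.
  exact: (measurableT_comp (intg_measurable ih) mu_).
- by move=> k; rewrite X2E; have [] := X2 k.
- move=> n; apply: (@le_trans _ _
     (\sum_(0 <= k < n) g k ^+ 2 * (C * \int[mu]_xi h xi ^+ 2))).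
    apply: ler_sum => k _; rewrite X2E; have [_ ->] := X2 k.
    by rewrite mulrA; apply: ler_wpM2r.
  by rewrite -mulr_suml; apply: ler_wpM2r => //; exact: mulr_ge0.
- move=> k Z mZ Z2.
  have mZo : measurable_fun setT Z by exact: (measurable_past u_iid (n := k)).
  have iZW : intg P (fun w => Z w * W k w) by exact: intg_mul.
  have mZW : measurable_fun setT ((fun w => Z w * W k w) : past u k -> R).
    exact: measurable_funM.
  have [_] := past_sample_mul u_iid mZW iZW ih; rewrite h0 mulr0 => <-.
  by apply: eq_Rintegral => w _; rewrite mulrA.
Qed.

Lemma fb_iter_quasi_fejer :
  {ae P, forall w, quasi_fejer (fun k => g k) (fun n => x n w) (z, y)}.
Proof.
have aeM : {ae P, forall w i, cvgn (fun n =>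
    \sum_(0 <= k < n) g k * (x k w - z) 0 i * (theta (u k.+1 w) 0 i - y 0 i))}.
  by apply: filter_forall => i; exact: martingale_coord.
apply: filterS3 fb_iter_step aeM noise_summable => w st cM cN.
pose Q n := \sum_i \sum_(0 <= k < n) g k * (x k w - z) 0 i * (theta (u k.+1 w) 0 i - y 0 i).
(* Replacing [theta (u n.+1 w)] by its mean [y] in the drift produces [-2] times the martingale
   increment. *)
exists (fun n => -2 * Q n + \sum_(0 <= k < n) g k ^+ 2 * H k w).
  apply: is_cvgD => //; apply: is_cvgM; first exact: is_cvg_cst.
  apply/cvg_ex; eexists; apply: cvg_big; first exact: add_continuous.
  by move=> i _; exact: cM.
move=> n; have := st n; rewrite /V /=.
have -> : Q n.+1 = Q n + g n * (dotp (theta (u n.+1 w)) (x n w - z) - dotp y (x n w - z)).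
  rewrite /Q; under eq_bigr do rewrite big_nat_recr//=.
  rewrite big_split/=; congr (_ + _).
  rewrite -dotpBl /dotp mulr_sumr; apply: eq_bigr => i _.
  by rewrite !mxE; ring.
rewrite big_nat_recr//=.
have := ler_wpM2l (sqr_ge0 (g n)) (noise_le n w).
lra.
Qed.

End StochasticForwardBackward.

(** * Step sizes and power integrability *)

Section StepSizes.
Context {R : realType}.
Implicit Types (c : nat -> R).

Lemma sum_shift1 c n : \sum_(1 <= k < n.+1) c k = \sum_(0 <= k < n) c k.+1.
Proof. by rewrite big_add1. Qed.

Lemma nneseries_lty_bound c : (forall n, (0 < n)%N -> 0 <= c n) ->
  (\sum_(1 <= n <oo) (c n)%:E < +oo)%E ->
  exists K, forall n, \sum_(0 <= k < n) c k.+1 <= K.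
Proof.
move=> c0 cfin; exists (fine (\sum_(1 <= n <oo) (c n)%:E)%E) => n.
rewrite -lee_fin fineK; last first.
  by rewrite ge0_fin_numE//; apply: nneseries_ge0 => k k0 _; rewrite lee_fin c0.
rewrite -sum_shift1 -sumEFin.
by apply: nneseries_lim_ge => k k0 _; rewrite lee_fin c0.
Qed.

Lemma nneseries_pinfty_unbounded c : (forall n, (0 < n)%N -> 0 <= c n) ->
  (\sum_(1 <= n <oo) (c n)%:E = +oo)%E ->
  forall C, exists m, forall n, (m <= n)%N -> C <= \sum_(0 <= k < n) c k.+1.
Proof.
move=> c0 cinf C; have [[m Cm]|noC] := pselect (exists m, C <= \sum_(0 <= k < m) c k.+1).
  exists m => n mn; apply: le_trans Cm _.
  by rewrite [leRHS](big_cat_nat (n := m))//= lerDl sumr_ge0// => k _; exact: c0.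
suff : (\sum_(1 <= n <oo) (c n)%:E <= C%:E)%E by rewrite cinf leye_eq.
apply: lime_le.
  by apply: is_cvg_nneseries => k k0 _; rewrite lee_fin c0.
exists 1%N => // -[//|n] _; rewrite sumEFin lee_fin sum_shift1 leNgt.
by apply/negP => /ltW h; apply: noC; exists n.
Qed.

End StepSizes.

Lemma intg_sqr_of_power d (T : measurableType d) (R : realType) (mu : probability T R)
    (M : T -> R) (p : nat) : (1 <= p)%N -> (forall t, 0 <= M t) ->
  intg mu (fun t => M t ^+ (2 * p)) -> intg mu (fun t => M t ^+ 2).
Proof.
move=> p1 M0 Mp; have mM : measurable_fun setT M.
  (* Only [M ^+ (2 * p)] is given as measurable; [M] is recovered as its root. *)
  have -> : M = (fun t => (M t ^+ (2 * p)) `^ (2 * p)%:R^-1).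
    apply/funext => t; rewrite -powR_mulrn// -powRrM mulfV ?powRr1//.
    by rewrite pnatr_eq0 muln_eq0 negb_or/= -lt0n.
  exact: (measurableT_comp (measurable_powR _) (intg_measurable Mp)).
apply: intg_le (intgD (intg_cst mu 1) Mp) _; first exact: measurable_funX.
move=> t; rewrite ger0_norm ?sqr_ge0//.
have [t1|/ltW t1] := leP (M t) 1.
  by rewrite -[leLHS]addr0 lerD ?exprn_ge0// exprn_ile1.
by rewrite -[leLHS]add0r lerD// ler_weXn2l// leq_pmulr.
Qed.

(** * Measurable almost sure limits and their support *)

Section AlmostSureLimit.
Context {R : realType} {N : nat} d (T : measurableType d) (P : probability T R).
Local Notation E := 'rV[R]_N.

(** The limit is set to 0 on a measurable null set outside which it exists; it is then the
    everywhere limit of the [f n] cut off on that set, hence measurable. *)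
Lemma ae_limit_ex (f : nat -> T -> E) (Q : set E) : (forall n, rmeas (f n)) ->
  {ae P, forall w, exists l : E, Q l /\ f ^~ w @ \oo --> l} ->
  exists U : T -> E, [/\ measurable_fun setT (U : T -> borelRV R N),
    {ae P, forall w, f ^~ w @ \oo --> U w} & {ae P, forall w, Q (U w)}].
Proof.
move=> mf [Z [mZ PZ fZ]].
have /choice[l lP] w : exists l : E, w \notin Z -> Q l /\ f ^~ w @ \oo --> l.
  have [wZ|wZ] := boolP (w \in Z); first by exists 0.
  have [[l ?]|nl] := pselect (exists l : E, Q l /\ f ^~ w @ \oo --> l); first by exists l.
  by exfalso; move/negP: wZ; apply; apply/mem_set; exact: fZ.
exists (fun w => if w \in Z then 0 else l w); split.
- apply/measurable_rowP.
  apply: (@rmeas_cvg _ _ _ _ (fun n w => if w \in Z then 0 else f n w)).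
    by move=> n; apply: rmeas_ite => //; exact: rmeas_cst.
  move=> w; have [wZ|wZ] := boolP (w \in Z); first exact: cvg_cst.
  by have [] := lP w wZ.
- exists Z; split => // w; apply: contra_notP => wZ.
  have {}wZ : w \notin Z by apply/negP => /set_mem.
  by rewrite /= (negbTE wZ); have [] := lP w wZ.
- exists Z; split => // w; apply: contra_notP => wZ.
  have {}wZ : w \notin Z by apply/negP => /set_mem.
  by rewrite /= (negbTE wZ); have [] := lP w wZ.
Qed.

Lemma law_support_closed (U : T -> E) (Q : set E) :
  measurable_fun setT (U : T -> borelRV R N) -> closed Q ->
  {ae P, forall w, Q (U w)} -> law_support P U `<=` Q.
Proof.
move=> mU cQ QU x Ux; apply: contrapT => Qx.
have oQ : open (~` Q) by exact: closed_openC.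
have mQ : measurable (U @^-1` ~` Q).
  by rewrite -[X in measurable X]setTI; apply: mU => //; exact: sub_gen_smallest.
have P0 : P (U @^-1` ~` Q) = 0%E by apply/negligibleP.
by have := Ux _ oQ Qx; rewrite P0 ltxx.
Qed.

Lemma closed_dual_halfspaces (S : set (E * E)) :
  closed [set p : E | forall q, S q -> 0 <= dotp q.2 (q.1 - p)].
Proof.
have -> : [set p : E | forall q, S q -> 0 <= dotp q.2 (q.1 - p)] =
    \bigcap_(q in S) ((fun p => dotp q.2 (q.1 - p)) @^-1` [set r | 0 <= r]).
  by apply/seteqP; split => p /= h q Sq; exact: h.
apply: closed_bigI => q _; apply: preimage_closed; last exact: closed_ge.
move=> p _; apply: (@cvg_dotp _ _ _ _ (nbhs_filter p)); first exact: cvg_cst.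
by apply: cvgB; [exact: cvg_cst|exact: cvg_id].
Qed.

End AlmostSureLimit.

Section SquareIntegrableGraph.
Context (R : realType) (N : nat) d (Xi : measurableType d) (mu : probability Xi R).
Local Notation E := 'rV[R]_N.
Context (A B : Xi -> operator R N).

(** The pairs to which the almost sure inequality applies: they come from square-integrable
    selections, for which the martingale has finite variance. *)
Definition sqint_graph : set (E * E) := [set q | exists phi psi : Xi -> E,
  [/\ sqint mu phi, sqint mu psi, {ae mu, forall xi, A xi q.1 (phi xi)},
      {ae mu, forall xi, B xi q.1 (psi xi)} &
      q.2 = vintegral mu phi + vintegral mu psi]].

Lemma sqint_graph_zero x : representations mu 2 A B x !=set0 -> sqint_graph (x, 0).
Proof.
move=> [[phi psi] [/= [phi2 Aphi] [psi2 Bpsi] e]].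
by exists phi, psi; split => //=; exact: vLq2_sqint.
Qed.

Context (b : Xi -> E -> E) (M : Xi -> R) (C : E -> R).
Hypothesis mu_complete : measure_is_complete mu.
Hypothesis hA : random_maximal_monotone A.
Hypothesis A_int : forall x, essdom mu A x -> setfun_integrable mu (fun xi => A xi x).
Hypothesis meanA_max : maximal_monotone (mean_op_essdom mu A).
Hypothesis resolvent_proj : forall x (g : R), 0 < g ->
  ((g ^- 4)%:E * \int[mu]_xi
     (enorm (resolvent g (A xi) x - eproj (closure (opdom (A xi))) x) ^+ 4)%:E
   <= (C x)%:E)%E.
Hypothesis mB : forall xi, maximal_monotone (B xi).
Hypothesis b_sel : forall x, selections mu 1 (fun xi => B xi x) (b ^~ x).
Hypothesis M0 : forall xi, 0 <= M xi.
Hypothesis M2 : intg mu (fun xi => M xi ^+ 2).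
Hypothesis bM : forall xi x, enorm (b xi x) <= M xi * (1 + enorm x).

(* Truncated selections make the image of [sqint_graph] at [a] dense in the sum
   of the Aumann integrals, so the hypothesis extends to the whole graph. *)
Lemma sqint_graph_dual_zero x :
  (forall q, sqint_graph q -> 0 <= dotp q.2 (q.1 - x)) ->
  zeros (op_add (mean_op_essdom mu A) (mean_op mu B)) x.
Proof.
move=> xP.
have xP' a v w : mean_op_essdom mu A a v -> mean_op mu B a w -> 0 <= dotp (v + w) (a - x).
  move=> [Da [phi phiA <-]] [psi [/vLq1P[mpsi _] Bpsi] <-].
  have [psi2 _] := selection_sqint mB b_sel M0 M2 bM mpsi Bpsi.
  have [f f2 fA] := sqint_selection mu_complete hA (A_int Da) (@resolvent_proj a).
  have [h [h2 hA' hphi]] := truncated_selection phiA f2 fA.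
  have cv : vintegral mu (h n) + vintegral mu psi @[n --> \oo] -->
      vintegral mu phi + vintegral mu psi by apply: cvgD => //; exact: cvg_cst.
  apply: (ler_cvg_to (cvg_cst 0) (cvg_dotp cv (cvg_cst (a - x)))).
  apply: nearW => n; apply: (xP (a, _)).
  by exists (h n), psi.
have [v [w [Av Bw e]]] := zero_of_sum meanA_max
  (mean_op_closed mB b_sel M0 M2 bM) (mean_op_convex mB b_sel M0 M2 bM)
  (mean_op_bound mB b_sel M0 M2 bM) (mean_op_nonempty b_sel) xP'.
by exists v => //; exists w.
Qed.

End SquareIntegrableGraph.

Theorem corollary3p1 (R : realType) (N : nat)
  (d : measure_display) (Xi : measurableType d) (mu : probability Xi R)
  (mu_complete : measure_is_complete mu)
  (A : Xi -> operator R N)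
  (hA : random_maximal_monotone A)
  (domA_neq0 : essdom mu A !=set0)
  (A_int : forall x, essdom mu A x -> setfun_integrable mu (fun xi => A xi x))
  (B : Xi -> operator R N)
  (hB : random_maximal_monotone B)
  (domB : {ae mu, forall xi, opdom (B xi) = setT})
  (B_int : forall x, setfun_integrable mu (fun xi => B xi x))
  (b : Xi -> 'rV[R]_N -> 'rV[R]_N)
  (b_meas : measurable_fun setT
     ((fun z => b z.1 z.2) : Xi * borelRV R N -> borelRV R N))
  (b_sel : forall x, selections mu 1 (fun xi => B xi x) (b ^~ x))
  (d' : measure_display) (Omega : measurableType d') (P : probability Omega R)
  (u : nat -> Omega -> Xi)
  (u_iid : iid_with_law P mu u)
  (gamma : nat -> R)
  (gamma_gt0 : forall n, (0 < n)%N -> 0 < gamma n)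
  (gamma_l2 : (\sum_(1 <= n <oo) (gamma n ^+ 2)%:E < +oo)%E)
  (gamma_nl1 : (\sum_(1 <= n <oo) (gamma n)%:E = +oo)%E)
  (meanA_max : maximal_monotone (mean_op_essdom mu A))
  (p : nat) (p_gt0 : (1 <= p)%N)
  (zero_rep_2p : exists2 x,
     zeros (op_add (mean_op_essdom mu A) (mean_op mu B)) x &
     representations mu (2 * p)%:R A B x !=set0)
  (A0_moments : forall K : set 'rV[R]_N, compact K ->
     exists2 eps : R, 0 < eps <= 1 &
       (ereal_sup [set \int[mu]_xi (enorm (least_norm (A xi) x) `^ (1 + eps))%:E
                  | x in K `&` essdom mu A] < +oo)%E /\
       exists2 y0, essdom mu A y0 &
         (\int[mu]_xi (enorm (least_norm (A xi) y0) `^ (1 + eps^-1))%:E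
            < +oo)%E)
  (dist_lb : exists2 C : R, 0 < C & forall x,
     ((C * eucl_dist (essdom mu A) x ^+ 2)%:E
        <= \int[mu]_xi (eucl_dist (opdom (A xi)) x ^+ 2)%:E)%E)
  (gamma_ratio : (gamma n.+1 / gamma n) @[n --> \oo] --> (1 : R))
  (resolvent_proj : exists2 C : R, 0 < C & forall x (g : R), 0 < g ->
     ((g ^- 4)%:E * \int[mu]_xi
        (enorm (resolvent g (A xi) x - eproj (closure (opdom (A xi))) x) ^+ 4)%:E
        <= (C * (1 + enorm x ^+ (2 * p)))%:E)%E)
  (b_growth : exists M : Xi -> R,
     [/\ forall xi, 0 <= M xi,
         mu.-integrable setT (fun xi => (M xi ^+ (2 * p))%:E) &
         forall xi x, enorm (b xi x) <= M xi * (1 + enorm x)])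
  (b_moment4 : exists2 C : R, 0 < C & forall x,
     (\int[mu]_xi (enorm (b xi x) ^+ 4)%:E
        <= (C * (1 + enorm x ^+ (2 * p)))%:E)%E)
  (zero_rep_2 : forall x,
     zeros (op_add (mean_op_essdom mu A) (mean_op mu B)) x ->
     representations mu 2 A B x !=set0) :
  forall x0 : 'rV[R]_N, exists U : Omega -> 'rV[R]_N,
    [/\ measurable_fun setT (U : Omega -> borelRV R N),
        {ae P, forall w,
           weighted_mean gamma (fb_iter A b u gamma x0) n w @[n --> \oo] --> U w} &
        law_support P U `<=` zeros (op_add (mean_op_essdom mu A) (mean_op mu B))].
Proof.
move=> x0; have [mA _] := hA; have [mB _] := hB.
have [M [M0 Mp bM]] := b_growth.
have M2 := intg_sqr_of_power p_gt0 M0 Mp.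
have [C C0 resC] := resolvent_proj.
have [K gK] : exists K, forall n, \sum_(0 <= k < n) gamma k.+1 ^+ 2 <= K.
  by apply: nneseries_lty_bound gamma_l2 => n _; exact: sqr_ge0.
have g_infty : forall L : R, exists m, forall n, (m <= n)%N ->
    L <= \sum_(0 <= k < n) gamma k.+1.
  by apply: nneseries_pinfty_unbounded gamma_nl1 => n /gamma_gt0/ltW.
set Z := zeros _; pose S := sqint_graph mu A B.
(* [Z'] is an intersection of closed half-spaces, hence closed, which places the support of the
   limit law inside it. *)
pose Z' := [set x : 'rV[R]_N | forall q, S q -> 0 <= dotp q.2 (q.1 - x)].
have ZS x : Z x -> S (x, 0) by move=> /zero_rep_2/sqint_graph_zero.
have Z'Z : Z' `<=` Z.
  exact: (sqint_graph_dual_zero mu_complete hA A_int meanA_max resC mB b_sel M0 M2 bM).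
have [z0 Zz0 _] := zero_rep_2p; have Sz0 := ZS _ Zz0.
(* This representation of 0 at [z0] yields the second-moment bound used at all other points of
   [S]. *)
have [phi [psi [phi2 psi2 Aphi Bpsi yE]]] := Sz0; rewrite /= in Aphi Bpsi yE.
pose x := fb_iter A b u gamma x0.
have mx n : rmeas (x n) by move=> i; exact: (rmeas_fb_iter hA b_meas u_iid x0 gamma_gt0).
have x2 n : sqint P (x n) :=
  fb_iter_sqint hA mB b_meas b_sel M0 M2 bM u_iid x0 gamma_gt0 phi2 psi2 Aphi Bpsi n.
have moment : exists L, forall n, \int[P]_w dotp (x n w) (x n w) <= L.
  have th0 : vintegral mu (fun xi => phi xi + psi xi) = 0.
    rewrite yE; apply/rowP => i; rewrite !mxE.
    rewrite -RintD; [|exact: sqint_coord|exact: sqint_coord].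
    by apply: eq_Rintegral => xi _; rewrite mxE.
  have [L VL] := fb_iter_moment hA mB b_meas b_sel M0 M2 bM u_iid x0 gamma_gt0 gK
    phi2 psi2 Aphi Bpsi th0.
  exists (2 * (L + dotp z0 z0)) => n.
  have [_ ix] := x2 n.
  have [_ iV] : sqint P (fun w => x n w - z0) by apply: sqintB => //; exact: sqint_cst.
  have i1 := intgD iV (intg_cst P (dotp z0 z0)).
  apply: le_trans (Rint_le ix (intgZ 2 i1) _) _.
    by move=> w; have := dotp_sqrD (x n w - z0) z0; rewrite subrK.
  rewrite RintZ// (RintD iV (intg_cst P _)) Rint_cst.
  by apply: ler_wpM2l => //; rewrite lerD2r; exact: VL.
have fejer q : S q -> {ae P, forall w, quasi_fejer (fun k => gamma k.+1) (x ^~ w) q}.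
  case: q => a y [f [h [f2 h2 Af Bh /= ->]]].
  exact: (fb_iter_quasi_fejer hA mB b_meas b_sel M0 M2 bM u_iid gamma_gt0 gK
    f2 h2 Af Bh moment).
have [s [Ss sD]] : exists s : nat -> 'rV[R]_N * 'rV[R]_N, (forall n, S (s n)) /\
    forall q (e : R), S q -> 0 < e ->
      exists n, enorm (q.1 - (s n).1) < e /\ enorm (q.2 - (s n).2) < e.
  by apply: countable_dense_pairs; exists (z0, 0).
have [s0 [Ss0 s0D]] : exists s0 : nat -> 'rV[R]_N * 'rV[R]_N,
    (forall n, S (s0 n) /\ (s0 n).2 = 0) /\
    forall q (e : R), S q /\ q.2 = 0 -> 0 < e ->
      exists n, enorm (q.1 - (s0 n).1) < e /\ enorm (q.2 - (s0 n).2) < e.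
  by apply: (@countable_dense_pairs _ _ [set q | S q /\ q.2 = 0]); exists (z0, 0).
have lim_ex : {ae P, forall w, exists l : 'rV[R]_N, Z' l /\
    weighted_mean gamma x n w @[n --> \oo] --> l}.
  have ae1 : {ae P, forall w n, quasi_fejer (fun k => gamma k.+1) (x ^~ w) (s n)}.
    by apply: ae_foralln => n; apply: fejer; exact: Ss.
  have ae2 : {ae P, forall w n, quasi_fejer (fun k => gamma k.+1) (x ^~ w) (s0 n)}.
    by apply: ae_foralln => n; apply: fejer; have [] := Ss0 n.
  apply: filterS2 ae1 ae2 => w h1 h2.
  have [||l [l1 l2]] := pathwise_convergence
    (fun n => gamma_gt0 _ (ltn0Sn n)) g_infty (fun q Z'q => ZS q (Z'Z q Z'q)) h1 sD h2.
  - by move=> n; have [] := Ss0 n.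
  - by move=> q e Sq e0; have [] := s0D (q, 0) e (conj Sq erefl) e0; move=> n []; exists n.
  exists l; split => //.
  (* The weighted mean sums from index 1; shifting weights and iterates by one gives [wmean]. *)
  rewrite (_ : (fun n => _) = wmean (fun k => gamma k.+1) (fun k => x k.+1 w))//.
  by apply/funext => n; rewrite /weighted_mean /wmean !big_add1.
have mw n : rmeas (fun w => weighted_mean gamma x n w).
  apply: rmeasZ; first exact: measurable_cst.
  move=> i; rewrite (_ : (fun w => _) = fun w => \sum_(1 <= k < n.+1) gamma k * x k w 0 i).
    by apply: measurable_sum => k; apply: measurable_funM => //; exact: mx.
  by apply/funext => w; rewrite summxE; apply: eq_bigr => k _; rewrite mxE.
have [U [mU cU ZU]] := ae_limit_ex mw lim_ex.
exists U; split => //.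
apply: subset_trans Z'Z.
by apply: law_support_closed => //; exact: closed_dual_halfspaces.
Qed.
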